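(* Let $\rho=\lambda_1+\lambda_2$, so $-\rho=\beta_1+\beta_2=2\alpha_1+2\alpha_2+\alpha_3$. Let $$p_1=(\alpha_2(-2)+\alpha_2(-1)^2)\mathbf 1\otimes e^{-\rho},\quad p_2=(-\alpha_1(-1)^2+\alpha_3(-1)^2)\mathbf 1\otimes e^{-\rho},\quad p_3=\alpha_1(-1)\alpha_3(-1)\mathbf 1\otimes e^{-\rho},$$ which lie in $P_1$, and let $\bar p_i$ be their classes in $\overline P_1$. Then a basis of the space $Low_{\overline P_1}(-\rho)$ of lowest-weight vectors for $\mathrm{Fib}$ of weight $-\rho$ in $\overline P_1$ is $(\bar x_1,\bar x_2)$, where $$\bar x_1=\bar p_1+2\bar p_2,\qquad \bar x_2=-\bar p_1+3\bar p_3.$$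
   Context: Let $A=(a_{ij})=\begin{pmatrix}2&-2&0\\-2&2&-1\\0&-1&2\end{pmatrix}$, and let $\mathcal F$ be the Kac–Moody algebra over $\mathbb C$ with generators $h_i,e_i,f_i$ ($i=1,2,3$) and Cartan matrix $A$ ($[h_i,e_j]=a_{ij}e_j$, $[h_i,f_j]=-a_{ij}f_j$, $[e_i,f_j]=\delta_{ij}h_i$, $[h_i,h_j]=0$, Serre relations), simple roots $\alpha_i$, form $(\alpha_i,\alpha_j)=a_{ij}$, root lattice $Q=\bigoplus\mathbb Z\alpha_i$, and fundamental weights $\omega_i\in\mathbb Q\otimes Q$, $(\omega_i,\alpha_j)=\delta_{ij}$. Put $\beta_1=2\alpha_1+\alpha_2+\alpha_3$, $\beta_2=\alpha_2$, $\lambda_1=-\frac15(2\beta_1+3\beta_2)$, $\lambda_2=-\frac15(3\beta_1+2\beta_2)$, $E_1=\frac12[e_1,[e_1,[e_2,e_3]]]$, $F_1=-\frac12[f_1,[f_1,[f_2,f_3]]]$, $H_1=2h_1+h_2+h_3$, $E_2=e_2$, $F_2=f_2$, $H_2=h_2$; $\mathrm{Fib}$ is the subalgebra generated by $E_i,F_i,H_i$ ($i=1,2$), a Kac–Moody algebra with Cartan matrix $\begin{pmatrix}2&-3\\-3&2\end{pmatrix}$. Vertex algebra $V_{\mathcal F}=S\otimes\mathbb C[Q]$: $S$ is the polynomial algebra in the commuting variables $\alpha_i(-n)$ ($i=1,2,3$, $n>0$), with unit $\mathbf 1$, a Fock module for the Heisenberg algebra $[\alpha_i(m),\alpha_j(n)]=m(\alpha_i,\alpha_j)\delta_{m,-n}$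 ($\alpha_i(n)\mathbf 1=0$ for $n>0$); $\alpha(n)$ is extended linearly in $\alpha\in\mathbb C\otimes Q$; $\mathbb C[Q]$ has basis $e^\gamma$, $e^\beta e^\gamma=e^{\beta+\gamma}$, and $\alpha(0)e^\gamma=(\alpha,\gamma)e^\gamma$. $\varepsilon:Q\times Q\to\{\pm1\}$ is the bilinear 2-cocycle with $(\varepsilon(\alpha_i,\alpha_j))=\begin{pmatrix}-1&1&1\\1&-1&1\\1&-1&-1\end{pmatrix}$. Vertex operators: $Y(\mathbf 1\otimes e^\beta,z)=\exp\big(\sum_{k>0}\frac{\beta(-k)}kz^k\big)\exp\big(-\sum_{k>0}\frac{\beta(k)}kz^{-k}\big)e^\beta z^{\beta(0)}\varepsilon_\beta$, where on $S\otimes e^\gamma$, $z^{\beta(0)}$ acts as $z^{(\beta,\gamma)}$ and $\varepsilon_\beta$ as $\varepsilon(\beta,\gamma)$ (these act before $e^\beta$); and $Y(\alpha_{i_1}(-m_1-1)\cdots\alpha_{i_r}(-m_r-1)\mathbf 1\otimes e^\beta,z)={:}\alpha_{i_1}^{(m_1)}(z)\cdots\alpha_{i_r}^{(m_r)}(z)Y(\mathbf 1\otimes e^\beta,z){:}$ with $\alpha^{(m)}(z)=\frac1{m!}(\frac d{dz})^m\sum_n\alpha(n)z^{-n-1}$ and bosonic normal ordering. Write $Y(v,z)=\sum_nv_nz^{-n-1}$. The conformal vector is $\omega=\frac12\sum_{i=1}^3\alpha_i(-1)\omega_i(-1)\mathbf 1\otimes e^0$, and $L_n=\omega_{n+1}$.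 $P_i=\{v\in V_{\mathcal F}:L_0v=iv,\ L_mv=0\ \forall m>0\}$, and $\overline P_1=P_1/L_{-1}(P_0)$, a Lie algebra with bracket $[\bar u,\bar v]=\overline{u_0(v)}$ (Borcherds). It is graded by $Q$; $\overline P_1^{\,\mu}$ is the image of $P_1\cap(S\otimes e^\mu)$. There is a Lie algebra homomorphism $\pi_{\mathcal F}:\mathcal F\to\overline P_1$, $e_i\mapsto\mathbf 1\otimes e^{\alpha_i}$, $f_i\mapsto-\mathbf 1\otimes e^{-\alpha_i}$, $h_i\mapsto\alpha_i(-1)\mathbf 1\otimes e^0$ (classes understood), with $\pi_{\mathcal F}(E_i)=\mathbf 1\otimes e^{\beta_i}$, $\pi_{\mathcal F}(F_i)=-\mathbf 1\otimes e^{-\beta_i}$. $\mathrm{Fib}$ acts on $\overline P_1$ by $X\cdot\bar v=[\pi_{\mathcal F}(X),\bar v]$. $Low_{\overline P_1}(-\rho)=\{\bar x\in\overline P_1^{\,-\rho}:F_1\cdot\bar x=F_2\cdot\bar x=0\}$. *)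

(* Defs.v *)
From HB Require Import structures.
From mathcomp Require Import all_boot all_order all_algebra.
From mathcomp Require Import finmap.
From mathcomp Require Import boolp classical_sets fsbigop.
From mathcomp Require Import monalg.

Set Implicit Arguments.
Unset Strict Implicit.
Unset Printing Implicit Defensive.

Import GRing.Theory Num.Theory.
Import Quotient.Exports.

Local Open Scope classical_set_scope.
Local Open Scope ring_scope.
Local Open Scope quotient_scope.

Definition linext (K : pzRingType) (I : choiceType) (W : lmodType K)
    (f : I -> W) (v : {malg K[I]}) : W :=
  \sum_(b <- msupp v) v@_b *: f b.

Section LinextTheory.
Variables (K : nzRingType) (I : choiceType) (W : lmodType K) (f : I -> W).

Lemma linextEw (d : {fset I}) (v : {malg K[I]}) :
  (msupp v `<=` d)%fset -> linext f v = \sum_(b <- d) v@_b *: f b.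
Proof.
move=> le; rewrite /linext (big_fset_incl _ le) // => x _ /mcoeff_outdom ->.
by rewrite scale0r.
Qed.

Lemma linext_is_linear : linear (linext f).
Proof.
move=> a u v.
pose d := (msupp u `|` msupp v `|` msupp (a *: u + v))%fset.
have hu : (msupp u `<=` d)%fset by rewrite /d -fsetUA fsubsetUl.
have hv : (msupp v `<=` d)%fset.
  by apply/fsubsetP => x xv; rewrite !inE xv orbT.
have huv : (msupp (a *: u + v) `<=` d)%fset by rewrite fsubsetUr.
rewrite (linextEw hu) (linextEw hv) (linextEw huv) scaler_sumr -big_split /=.
by apply: eq_bigr => b _; rewrite mcoeffD mcoeffZ scalerDl scalerA.
Qed.

HB.instance Definition _ :=
  GRing.isLinear.Build K {malg K[I]} W *:%R (linext f) linext_is_linear.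

End LinextTheory.

(* The quotient of a module by a submodule: the library's quotient of a Z-module
   by a subgroup, with the scalars added. *)
Section LmodQuotient.
Variables (K : pzRingType) (V : lmodType K) (U : submodClosed V).

Definition submod_pred : {pred V} := U.

HB.instance Definition _ :=
  GRing.isSubmodClosed.Build K V submod_pred (submodClosedP U).

Definition lquot : Type := Quotient.quot submod_pred.
HB.instance Definition _ := GRing.Zmodule.on lquot.

Definition lclass (v : V) : lquot := \pi_(Quotient.quot submod_pred) v.
Definition lrepr (x : lquot) : V := repr (x : Quotient.quot submod_pred).

Lemma lreprK : cancel lrepr lclass.
Proof. exact: reprK. Qed.

Lemma lclass_eq u v : lclass u = lclass v <-> u - v \in U.
Proof.
rewrite -[_ \in U]/(_ \in submod_pred) Quotient.idealrBE.
by split=> [/eqP|/eqP].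
Qed.

Lemma lclassD : {morph lclass : u v / u + v}.
Proof. exact: raddfD. Qed.

Definition lscale (a : K) (x : lquot) : lquot := lclass (a *: lrepr x).

Lemma lclassZ a : {morph lclass : v / a *: v >-> lscale a v}.
Proof.
by move=> v; apply/lclass_eq; rewrite -scalerBr rpredZ //; apply/lclass_eq;
  rewrite lreprK.
Qed.

Lemma lscaleA a b x : lscale a (lscale b x) = lscale (a * b) x.
Proof. by rewrite -[x]lreprK -!lclassZ scalerA. Qed.

Lemma lscale1 : left_id 1 lscale.
Proof. by move=> x; rewrite -[x]lreprK -lclassZ scale1r. Qed.

Lemma lscaleDr : right_distributive lscale +%R.
Proof.
move=> a x y; rewrite -[x]lreprK -[y]lreprK -lclassD -!lclassZ scalerDr.
exact: lclassD.
Qed.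

Lemma lscaleDl x : {morph lscale^~ x : a b / a + b}.
Proof.
move=> a b; rewrite -[x]lreprK -!lclassZ scalerDl; exact: lclassD.
Qed.

HB.instance Definition _ := GRing.Zmodule_isLmodule.Build K lquot
  lscaleA lscale1 lscaleDr lscaleDl.

Lemma lclass_linear : linear lclass.
Proof. by move=> a u v; rewrite lclassD lclassZ. Qed.

HB.instance Definition _ := GRing.isLinear.Build K V lquot *:%R lclass
  lclass_linear.

End LmodQuotient.

Definition is_basis (K : pzRingType) (M : lmodType K) (W : set M) (n : nat)
    (x : n.-tuple M) : Prop :=
  [/\ forall i, W (tnth x i),
      forall c : 'I_n -> K,
        \sum_i c i *: tnth x i = 0 -> forall i, c i = 0
    & forall w, W w -> exists c : 'I_n -> K, w = \sum_i c i *: tnth x i].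

(* Kac-Moody algebras by generators and relations: the free nonassociative
   algebra on the h_i, e_i, f_i modulo the two-sided ideal generated by the Lie
   axioms and the defining relations. *)

Inductive kmgen (n : nat) := Hgen of 'I_n | Egen of 'I_n | Fgen of 'I_n.

Inductive lieword (X : Type) :=
  | Letter of X
  | Bracket of lieword X & lieword X.

HB.instance Definition _ (X : Type) := gen_eqMixin (lieword X).
HB.instance Definition _ (X : Type) := gen_choiceMixin (lieword X).

Section KacMoody.
Variables (K : numFieldType) (n : nat) (A : 'M[int]_n).

Definition freealg : Type := {malg K[lieword (kmgen n)]}.
HB.instance Definition _ := GRing.Lmodule.on freealg.

Definition fa_gen (x : kmgen n) : freealg := << Letter x >>.

Definition fa_mul (x y : freealg) : freealg :=
  linext (fun a => linext (fun b => << Bracket a b >> : freealg) y) x.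

Local Notation h i := (fa_gen (Hgen i)).
Local Notation e i := (fa_gen (Egen i)).
Local Notation f i := (fa_gen (Fgen i)).

Inductive km_ideal : freealg -> Prop :=
  | KM_alt x : km_ideal (fa_mul x x)
  | KM_jacobi x y z :
      km_ideal (fa_mul x (fa_mul y z) + fa_mul y (fa_mul z x)
                + fa_mul z (fa_mul x y))
  | KM_hh i j : km_ideal (fa_mul (h i) (h j))
  | KM_he i j : km_ideal (fa_mul (h i) (e j) - (A i j)%:~R *: e j)
  | KM_hf i j : km_ideal (fa_mul (h i) (f j) + (A i j)%:~R *: f j)
  | KM_ef i j : km_ideal (fa_mul (e i) (f j) - (i == j)%:R *: h i)
  | KM_serre_e i j : i != j ->
      km_ideal (iter `|1 - A i j|%N (fa_mul (e i)) (e j))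
  | KM_serre_f i j : i != j ->
      km_ideal (iter `|1 - A i j|%N (fa_mul (f i)) (f j))
  | KM_0 : km_ideal 0
  | KM_lin a x y : km_ideal x -> km_ideal y -> km_ideal (a *: x + y)
  | KM_mull x y : km_ideal y -> km_ideal (fa_mul x y)
  | KM_mulr x y : km_ideal x -> km_ideal (fa_mul x y).

Definition km_pred : {pred freealg} := fun x => `[< km_ideal x >].

Lemma km_pred_submod : submod_closed km_pred.
Proof.
split; first by apply/asboolP; exact: KM_0.
by move=> a x y /asboolP hx /asboolP hy; apply/asboolP; exact: KM_lin.
Qed.

HB.instance Definition _ :=
  GRing.isSubmodClosed.Build K freealg km_pred km_pred_submod.

Definition kac_moody : Type := lquot km_pred.
HB.instance Definition _ := GRing.Lmodule.on kac_moody.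

Definition kmH i : kac_moody := lclass km_pred (h i).
Definition kmE i : kac_moody := lclass km_pred (e i).
Definition kmF i : kac_moody := lclass km_pred (f i).

Definition km_br (x y : kac_moody) : kac_moody :=
  lclass km_pred (fa_mul (lrepr x) (lrepr y)).

Lemma fa_mul_linearl y : linear (fa_mul^~ y).
Proof. by move=> a u v; rewrite /fa_mul linearP. Qed.

Lemma fa_mul_linearr x : linear (fa_mul x).
Proof.
move=> a u v; rewrite /fa_mul /linext scaler_sumr -big_split /=.
apply: eq_bigr => b _.
by rewrite -/(linext _ _) linearP scalerDr !scalerA mulrC.
Qed.

HB.instance Definition _ x :=
  GRing.isLinear.Build K freealg freealg *:%R (fa_mul x) (fa_mul_linearr x).

Lemma fa_mulBl (x x' y : freealg) : fa_mul (x - x') y = fa_mul x y - fa_mul x' y.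
Proof. exact: linearB. Qed.

Lemma fa_mulBr (x y y' : freealg) : fa_mul x (y - y') = fa_mul x y - fa_mul x y'.
Proof. exact: linearB. Qed.

Lemma km_brE (x y : freealg) :
  km_br (lclass km_pred x) (lclass km_pred y) = lclass km_pred (fa_mul x y).
Proof.
rewrite /km_br; set x' := lrepr _; set y' := lrepr _.
have hx : km_ideal (x' - x).
  by apply/asboolP; apply/(@lclass_eq _ _ km_pred); rewrite lreprK.
have hy : km_ideal (y' - y).
  by apply/asboolP; apply/(@lclass_eq _ _ km_pred); rewrite lreprK.
apply/lclass_eq/asboolP.
have -> : fa_mul x' y' - fa_mul x y
    = 1 *: fa_mul (x' - x) y' + fa_mul x (y' - y).
  by rewrite scale1r fa_mulBl fa_mulBr addrA addrNK.
by apply: KM_lin; [exact: KM_mulr | exact: KM_mull].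
Qed.

End KacMoody.

(* The indices 1, 2, 3 are the ordinals 0, 1, 2. *)
Definition i1 : 'I_3 := @Ordinal 3 0 isT.
Definition i2 : 'I_3 := @Ordinal 3 1 isT.
Definition i3 : 'I_3 := @Ordinal 3 2 isT.

Definition mx3 (s : seq (seq int)) : 'M[int]_3 :=
  \matrix_(i, j) nth 0 (nth [::] s i) j.

Definition cartan : 'M[int]_3 := mx3 [:: [:: 2; -2; 0];
                                         [:: -2; 2; -1];
                                         [:: 0; -1; 2]].

Definition eps_mx : 'M[int]_3 := mx3 [:: [:: -1; 1; 1];
                                         [:: 1; -1; 1];
                                         [:: 1; -1; -1]].

(* Row vectors of coordinates in the basis alpha_1, alpha_2, alpha_3. *)
Notation lattice := 'rV[int]_3.

Definition alpha (i : 'I_3) : lattice := delta_mx 0 i.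

Definition form (b c : lattice) : int := (b *m cartan *m c^T) 0 0.

Definition eps (b c : lattice) : int :=
  \prod_i \prod_j eps_mx i j ^ (b 0 i * c 0 j).

Definition beta1 : lattice := alpha i1 *+ 2 + alpha i2 + alpha i3.
Definition beta2 : lattice := alpha i2.

Definition to_rat (b : lattice) : 'rV[rat]_3 := map_mx intr b.
Definition lambda1 : 'rV[rat]_3 :=
  - (5^-1 *: (2 *: to_rat beta1 + 3 *: to_rat beta2)).
Definition lambda2 : 'rV[rat]_3 :=
  - (5^-1 *: (3 *: to_rat beta1 + 2 *: to_rat beta2)).
Definition rho : 'rV[rat]_3 := lambda1 + lambda2.
(* The element of the root lattice equal to - rho. *)
Definition mrho : lattice := beta1 + beta2.

Section LatticeVertexAlgebra.
Variable K : numFieldType.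

(* The pair (i, m) stands for the variable alpha_i(-m-1). *)
Notation mono := {cmonom ('I_3 * nat)%type}.

(* S (x) C[Q], as the vector space with basis << (s, gamma) >> = s (x) e^gamma,
   where s runs through the monomials of S. *)
Definition VF : Type := {malg K[(mono * lattice)%type]}.
HB.instance Definition _ := GRing.Lmodule.on VF.

Definition ket (s : mono) (g : lattice) : VF := << (s, g) >>.

(* 1 (x) e^gamma *)
Definition expQ (g : lattice) : VF := ket (onecm _) g.

Definition to_K (b : lattice) : 'rV[K]_3 := map_mx intr b.

Definition formK (a c : 'rV[K]_3) : K := (a *m map_mx intr cartan *m c^T) 0 0.

(* a(k), for a in C (x) Q: multiplication by a variable for k < 0, the scalar
   (a, gamma) for k = 0, a derivation of S for k > 0. *)
Definition heis (a : 'rV[K]_3) (k : int) : VF -> VF :=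
  linext (fun sg : mono * lattice => let: (s, g) := sg in
    match k with
    | Negz m => \sum_j a 0 j *: ket (mulcm (ucm (j, m)) s) g
    | Posz 0 => formK a (to_K g) *: ket s g
    | Posz m.+1 =>
        \sum_j (m.+1%:R * formK a (to_K (alpha j)) * (s (j, m))%:R)
               *: ket (divcm s (ucm (j, m))) g
    end).

(* Coefficient of t^m in A(t)^r v and in exp(A(t)) v, where
   A(t) = \sum_(k >= 1) a_k t^k. *)
Fixpoint pow_coef (a : nat -> VF -> VF) (r m : nat) (v : VF) : VF :=
  if r is r'.+1 then \sum_(1 <= k < m.+1) a k (pow_coef a r' (m - k) v)
  else if m == 0%N then v else 0.

Definition exp_coef (a : nat -> VF -> VF) (m : nat) (v : VF) : VF :=
  \sum_(r < m.+1) (r`!%:R)^-1 *: pow_coef a r m v.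

(* Coefficient of z^p in exp(\sum_(k > 0) b(-k)/k z^k). *)
Definition creation (b : lattice) (p : nat) : VF -> VF :=
  exp_coef (fun k v => k%:R^-1 *: heis (to_K b) (- k%:Z) v) p.

(* Coefficient of z^-q in exp(- \sum_(k > 0) b(k)/k z^-k). *)
Definition annihilation (b : lattice) (q : nat) : VF -> VF :=
  exp_coef (fun k v => - k%:R^-1 *: heis (to_K b) k%:Z v) q.

(* A field B(z) = \sum_n B_n z^(-n-1) is represented by its modes n |-> B_n.
   All sums \sum_(_ \in _) below are locally finite: on a given vector only
   finitely many terms are nonzero. *)
Definition modes := int -> VF -> VF.

(* Y(1 (x) e^b, z) *)
Definition Yexp (b : lattice) : modes := fun n =>
  linext (fun sg : mono * lattice => let: (s, g) := sg in
    (eps b g)%:~R *: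
      \sum_(pq \in [set pq : nat * nat |
                      pq.1%:Z - pq.2%:Z + form b g = - n - 1])
        creation b pq.1 (annihilation b pq.2 (ket s (b + g)))).

(* alpha_i^(m)(z) = \sum_k dcoef m k alpha_i(k) z^(-k-1-m) *)
Definition dcoef (m : nat) (k : int) : K :=
  (\prod_(i < m) (- k - 1 - i%:Z))%:~R / m`!%:R.

(* :alpha_i^(m)(z) B(z): for x = (i, m), with the creation operators alpha_i(k),
   k < 0, on the left of B and the alpha_i(k), k >= 0, on its right. *)
Definition normord (x : 'I_3 * nat) (B : modes) : modes := fun n =>
  let a := heis (to_K (alpha x.1)) in
  linext (fun sg : mono * lattice => let v := ket sg.1 sg.2 in
    \sum_(k \in [set k : int | (k < 0)%R])
      dcoef x.2 k *: a k (B (n - k - x.2%:Z - 1) v)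
    + \sum_(k \in [set k : int | (0 <= k)%R])
      dcoef x.2 k *: B (n - k - x.2%:Z - 1) (a k v)).

(* The variables of a monomial, with multiplicity; normally ordered products do
   not depend on the order of the list. *)
Definition factors (s : mono) : seq ('I_3 * nat) :=
  flatten [seq nseq (s x) x | x <- finsupp s].

Definition Ymode (v : VF) (n : int) (w : VF) : VF :=
  linext (fun sg : mono * lattice =>
    foldr normord (Yexp sg.2) (factors sg.1) n w) v.

(* omega_i in the basis of the alpha_j: (omega_i, alpha_j) = delta_ij. *)
Definition fundw (i : 'I_3) : 'rV[K]_3 := row i (invmx (map_mx intr cartan)).

Definition conformal : VF :=
  2^-1 *: \sum_i heis (to_K (alpha i)) (-1) (heis (fundw i) (-1) (expQ 0)).

Definition Lop (n : int) : VF -> VF := Ymode conformal (n + 1).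

Definition Pspace (i : int) : set VF :=
  [set v | Lop 0 v = i%:~R *: v /\ forall m : int, (0 < m)%R -> Lop m v = 0].

(* S (x) e^g *)
Definition in_degree (g : lattice) : set VF :=
  [set v | forall b, b \in msupp v -> b.2 = g].

Lemma foldr_normord_linear b l n : linear (foldr normord (Yexp b) l n).
Proof. by case: l => [|x l] /=; exact: linext_is_linear. Qed.

Lemma Ymode_linear v n : linear (Ymode v n).
Proof.
move=> a u w; rewrite /Ymode /linext scaler_sumr -big_split /=.
apply: eq_bigr => sg _.
by rewrite foldr_normord_linear scalerDr !scalerA mulrC.
Qed.

HB.instance Definition _ v n :=
  GRing.isLinear.Build K VF VF *:%R (Ymode v n) (Ymode_linear v n).
HB.instance Definition _ n := GRing.Linear.copy (Lop n) (Ymode conformal (n + 1)).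

(* L_(-1)(P_0) *)
Definition LP0 : {pred VF} := fun v => `[< (Lop (-1) @` Pspace 0) v >].

Lemma LP0_submod : submod_closed LP0.
Proof.
split; first by apply/asboolP; exists 0; rewrite ?linear0 //; split => [|m _];
  rewrite linear0 ?scaler0.
move=> a _ _ /asboolP[u [u0 um] <-] /asboolP[w [w0 wm] <-].
apply/asboolP; exists (a *: u + w); last by rewrite linearP.
split=> [|m m0]; rewrite linearP /=; last by rewrite um // wm // scaler0 addr0.
by rewrite u0 w0 !scale0r scaler0 addr0.
Qed.

HB.instance Definition _ := GRing.isSubmodClosed.Build K VF LP0 LP0_submod.

(* V / L_(-1)(P_0), which contains P_1 / L_(-1)(P_0). *)
Definition Vbar : Type := lquot LP0.
HB.instance Definition _ := GRing.Lmodule.on Vbar.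

Definition cls (v : VF) : Vbar := lclass LP0 v.

Definition P1bar : set Vbar := cls @` Pspace 1.

Definition P1bar_deg (g : lattice) : set Vbar :=
  cls @` (Pspace 1 `&` in_degree g).

(* [u, v] = u_0(v) on classes. On P_1 / L_(-1)(P_0) the class of the result does
   not depend on the representatives (Borcherds). *)
Definition P1bar_br (x y : Vbar) : Vbar :=
  cls (Ymode (lrepr x) 0 (lrepr y)).

Notation FF := (kac_moody K cartan).

Record is_piF (p : {linear FF -> Vbar}) : Prop := IsPiF {
  piF_in : forall X, P1bar (p X);
  piF_br : forall X Y, p (km_br X Y) = P1bar_br (p X) (p Y);
  piF_e : forall i, p (kmE K cartan i) = cls (expQ (alpha i));
  piF_f : forall i, p (kmF K cartan i) = cls (- expQ (- alpha i));
  piF_h : forall i,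
    p (kmH K cartan i) = cls (heis (to_K (alpha i)) (-1) (expQ 0))
}.

(* The lowering generators F_1, F_2 of Fib; Fib acts through the restriction of
   the action of the whole Kac-Moody algebra. *)
Definition fibF1 : FF :=
  let f := kmF K cartan in
  - (2^-1 *: km_br (f i1) (km_br (f i1) (km_br (f i2) (f i3)))).
Definition fibF2 : FF := kmF K cartan i2.

Definition act (p : FF -> Vbar) (X : FF) (v : Vbar) : Vbar := P1bar_br (p X) v.

Definition Low (p : FF -> Vbar) (g : lattice) : set Vbar :=
  [set x | [/\ P1bar_deg g x, act p fibF1 x = 0 & act p fibF2 x = 0]].

Let al i := heis (to_K (alpha i)).

Definition p1 : VF :=
  al i2 (-2) (expQ mrho) + al i2 (-1) (al i2 (-1) (expQ mrho)).
Definition p2 : VF :=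
  - al i1 (-1) (al i1 (-1) (expQ mrho)) + al i3 (-1) (al i3 (-1) (expQ mrho)).
Definition p3 : VF := al i1 (-1) (al i3 (-1) (expQ mrho)).

Definition x1 : Vbar := cls p1 + 2 *: cls p2.
Definition x2 : Vbar := - cls p1 + 3 *: cls p3.

End LatticeVertexAlgebra.

(* Main.v *)
Require Import Defs.
From HB Require Import structures.
From mathcomp Require Import all_boot all_order all_algebra.
From mathcomp Require Import finmap boolp classical_sets fsbigop.
From mathcomp Require Import complex reals.
From mathcomp Require Import monalg ring zify.
Set Implicit Arguments.
Unset Strict Implicit.
Unset Printing Implicit Defensive.
Import Order.TTheory GRing.Theory Num.Theory.
Local Open Scope ring_scope.
Local Notation form := Defs.form.
Local Notation mono := {cmonom ('I_3 * nat)%type}.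

(** A class of degree - rho is determined by three numbers, and each of F_1, F_2
    imposes on them one and the same linear equation.

    Since (rho, rho) = -2, the eigenvalue 1 of L_0 in degree - rho belongs to the
    level-two part of S, spanned by the nine vectors alpha_i(-2) and
    alpha_i(-1) alpha_j(-1) applied to e^(-rho) (level_two). The equations
    L_1 v = L_2 v = 0 then leave the combinations of p_1, p_2, p_3 and of the
    images under L_(-1) of alpha_1(-1) and alpha_3(-1) applied to e^(-rho), and
    the latter two vectors are in P_0 because (alpha_1, rho) = (alpha_3, rho) = 0
    (level_two_primary). So every class of degree - rho is that of some
    A p_1 + B p_2 + C p_3, and B and C vanish if the class does
    (p_independent).

    The images of F_1 and F_2 in P_1 / L_(-1)(P_0) are the classes of nonzero
    multiples of e^b with b = - beta_1 and b = - beta_2 (piF_fibF1,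
    piF_lowering). In both cases (b, b) = 2 and (b, - rho) = 1, so that the zero
    mode of Y(e^b, z) sends A p_1 + B p_2 + C p_3 to a multiple of e^(b - rho);
    commuting the alpha_i(-m) through the vertex operator, the multiple is
    A (c_2^2 - c_2) + B (c_3^2 - c_1^2) + C c_1 c_3 up to a sign, where
    c_i = (alpha_i, b) (Y_p_comb). For (c_1, c_2, c_3) = (-2, 3, -1) as for
    (2, -2, 1) this is 6 A - 3 B + 2 C. As e^(b - rho) has nonzero class, the
    lowest-weight vectors are given by 6 A - 3 B + 2 C = 0, and (1, 2, 0) and
    (-1, 0, 3) span the solutions.

    These computations rest on four facts about the vertex algebra. The modes of
    the conformal vector are the Sugawara operators, hence
    [a(l), L_n] = l a(n + l) (Lop_comm). The modes of e^b satisfy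
    [a(k), Y_n] = (a, b) Y_(n+k) (Yexp_comm). If (b, b) = 2, the field of e^b is
    primary of weight one (Yexp_primary). And L_(-1) acts on states as d/dz acts
    on fields (Ymode_LopN1). The last two make the bracket with the class of e^b
    computable on any representative (bracket_expQ). Identities between
    operators are checked on the e^g and carried along the creation operators
    alpha_i(-m) by commutation, since these generate everything (VF_ind). *)

(** * The Fock space and its Heisenberg operators *)

Section Basis.
Variable K : numFieldType.

Lemma eq_scale (W : lmodType K) (a b : K) (v w : W) :
  a = b -> v = w -> a *: v = b *: w.
Proof. by move=> -> ->. Qed.

Lemma eq_add (W : nmodType) (a b v w : W) : a = b -> v = w -> a + v = b + w.
Proof. by move=> -> ->. Qed.

Lemma scale_swap (W : lmodType K) (a b : K) (v : W) :
  a *: (b *: v) = b *: (a *: v).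
Proof. by rewrite !scalerA mulrC. Qed.

Lemma linextU (I : choiceType) (W : lmodType K) (f : I -> W) b :
  linext f << b >> = f b.
Proof.
by rewrite (linextEw _ msuppU_le) big_seq_fset1 mcoeffUU scale1r.
Qed.

HB.instance Definition _ (a : 'rV[K]_3) k :=
  GRing.isLinear.Build K (VF K) (VF K) *:%R (heis a k) (linext_is_linear _).
HB.instance Definition _ (b : lattice) n :=
  GRing.isLinear.Build K (VF K) (VF K) *:%R (Yexp b n) (linext_is_linear _).
HB.instance Definition _ x (B : modes K) n :=
  GRing.isLinear.Build K (VF K) (VF K) *:%R (normord x B n) (linext_is_linear _).

Lemma mono_ind (P : mono -> Prop) :
  P (onecm _) -> (forall x s, P s -> P (mulcm (ucm x) s)) -> forall s, P s.
Proof.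
move=> P1 PM s; elim: {s}(mdeg s) {-2}s (erefl (mdeg s)) => [|d IH] s ds.
  by rewrite (mdeg_eq0I ds).
have [x xs] : exists x, x \in finsupp s.
  apply/fset0Pn/eqP => s0; have : s = onecm _ by apply/eqP/cmP => i;
    rewrite onecmE; apply/eqP; rewrite cmE_eq0 s0 in_fset0.
  by move=> s1; rewrite s1 mdeg1 in ds.
have sE : s = mulcm (ucm x) (divcm s (ucm x)).
  apply/eqP/cmP => i; rewrite mulcmE divcmE ucmE; case: eqP => [<-|_].
    by rewrite addnC subnK // lt0n cmE_neq0.
  by rewrite subn0.
rewrite sE; apply/PM/IH.
have := ds; rewrite {1}sE mdegM mdegU => /eqP; rewrite add1n eqSS => /eqP; exact.
Qed.

Lemma ketE (v : VF K) : v = \sum_(b <- msupp v) v@_b *: ket K b.1 b.2.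
Proof.
rewrite {1}[v]monalgE; apply: eq_bigr => -[s g] _ /=; apply/malgP => k.
by rewrite mcoeffU [RHS]mcoeffZ /ket mcoeffU mulrnAr mulr1.
Qed.

Lemma heis_ketN a m s g : heis a (Negz m) (ket K s g) =
  \sum_j a 0 j *: ket K (mulcm (ucm (j, m)) s) g.
Proof. by rewrite /heis /ket linextU. Qed.

Lemma heis_ket0 a s g : heis a 0 (ket K s g) = formK a (to_K K g) *: ket K s g.
Proof. by rewrite /heis /ket linextU. Qed.

Lemma heis_ketP a m s g : heis a (Posz m.+1) (ket K s g) =
  \sum_j (m.+1%:R * formK a (to_K K (alpha j)) * (s (j, m))%:R)
               *: ket K (divcm s (ucm (j, m))) g.
Proof. by rewrite /heis /ket linextU. Qed.

Lemma to_K_alpha i j : to_K K (alpha i) 0 j = (j == i)%:R.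
Proof. by rewrite !mxE eqxx; case: (j == i). Qed.

Lemma heis_alphaN i m s g :
  heis (to_K K (alpha i)) (Negz m) (ket K s g) = ket K (mulcm (ucm (i, m)) s) g.
Proof.
rewrite heis_ketN (bigD1 i) //= to_K_alpha eqxx scale1r big1 ?addr0 // => j ji.
by rewrite to_K_alpha (negPf ji) scale0r.
Qed.

(** Every vector is obtained from the e^g by linear combinations and creation
    operators, so that an operator identity may be checked against these. *)
Lemma VF_ind (P : VF K -> Prop) :
  P 0 -> (forall c u v, P u -> P v -> P (c *: u + v)) ->
  (forall g, P (expQ K g)) ->
  (forall i m v, P v -> P (heis (to_K K (alpha i)) (Negz m) v)) ->
  forall v, P v.
Proof.
move=> P0 PL P1 PM v; rewrite [v]ketE.
elim/big_ind: _ => // [u w Pu Pw|[s g] _].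
  by rewrite -[u]scale1r; apply: PL.
rewrite -[X in P X]addr0; apply: (PL) => //.
elim/mono_ind: s => [|[i m] s IH]; first exact: P1.
by have := PM i m _ IH; rewrite heis_alphaN.
Qed.

Lemma ket_ext (W : lmodType K) (f h : VF K -> W) : linear f -> linear h ->
  (forall s g, f (ket K s g) = h (ket K s g)) -> f =1 h.
Proof.
move=> lf lh fh v; rewrite [v]ketE.
pose F : {linear VF K -> W} := HB.pack f (GRing.isLinear.Build K _ _ _ f lf).
pose H : {linear VF K -> W} := HB.pack h (GRing.isLinear.Build K _ _ _ h lh).
rewrite -[LHS]/(F _) -[RHS]/(H _) !linear_sum; apply: eq_bigr => -[s g] _.
by rewrite !linearZ /= fh.
Qed.

Lemma formKD a b c : formK (a + b) c = formK a c + formK b c :> K.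
Proof. by rewrite /formK !mulmxDl mxE. Qed.
Lemma formKDr a b c : formK c (a + b) = formK c a + formK c b :> K.
Proof. by rewrite /formK linearD /= mulmxDr mxE. Qed.
Lemma formKZ x a c : formK (x *: a) c = x * formK a c :> K.
Proof. by rewrite /formK -!scalemxAl mxE. Qed.
Lemma formKZr x a c : formK c (x *: a) = x * formK c a :> K.
Proof. by rewrite /formK linearZ /= -scalemxAr mxE. Qed.
Lemma cartan_sym : cartan^T = cartan.
Proof.
apply/matrixP => i j; rewrite !mxE.
by case: i => [[|[|[|i]]] //= _]; case: j => [[|[|[|j]]] //= _].
Qed.
Lemma formKC a b : formK a b = formK b a :> K.
Proof.
transitivity ((a *m map_mx intr cartan *m b^T)^T 0 0 : K); first by rewrite mxE.
by rewrite !trmx_mul trmxK map_trmx cartan_sym mulmxA.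
Qed.
Lemma to_K_alphaE i : to_K K (alpha i) = delta_mx 0 i.
Proof. by apply/rowP => j; rewrite to_K_alpha mxE eqxx. Qed.
Lemma row_alpha (b : 'rV[K]_3) : b = \sum_j b 0 j *: to_K K (alpha j).
Proof.
by rewrite {1}[b]row_sum_delta; apply: eq_bigr => j _; rewrite to_K_alphaE.
Qed.
Lemma formKE a b : formK a b = \sum_j b 0 j * formK a (to_K K (alpha j)) :> K.
Proof.
rewrite {1}[b]row_alpha /formK linear_sum mulmx_sumr summxE.
by apply: eq_bigr => j _; rewrite linearZ /= -scalemxAr mxE.
Qed.
Lemma formK_int b c : formK (to_K K b) (to_K K c) = (form b c)%:~R.
Proof. by rewrite /formK /form /to_K map_trmx -!map_mxM mxE. Qed.

Lemma heisD a b k v : heis (a + b) k v = heis a k v + heis b k v :> VF K.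
Proof.
move: v; apply: ket_ext => [c u v|c u v|s g].
- exact: linearP.
- by rewrite !linearP scalerDr addrACA.
case: k => [[|k]|k].
- by rewrite !heis_ket0 formKD scalerDl.
- rewrite !heis_ketP -big_split; apply: eq_bigr => j _ /=.
  by rewrite formKD mulrDr mulrDl scalerDl.
- rewrite !heis_ketN -big_split; apply: eq_bigr => j _ /=.
  by rewrite mxE scalerDl.
Qed.

Lemma heisZ x a k v : heis (x *: a) k v = x *: heis a k v :> VF K.
Proof.
move: v; apply: ket_ext => [c u v|c u v|s g].
- exact: linearP.
- by rewrite [heis a k (_ + _)]linearP scalerDr !scalerA mulrC.
case: k => [[|k]|k].
- by rewrite !heis_ket0 formKZ scalerA.
- rewrite !heis_ketP scaler_sumr; apply: eq_bigr => j _ /=.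
  by rewrite formKZ mulrCA -!mulrA scalerA.
- rewrite !heis_ketN scaler_sumr; apply: eq_bigr => j _ /=.
  by rewrite mxE scalerA.
Qed.

Lemma heis_lin (a : 'rV[K]_3) k : linear (heis a k).
Proof. exact: linearP. Qed.
Lemma heisLZ (a : 'rV[K]_3) k c v : heis a k (c *: v) = c *: heis a k v.
Proof. exact: linearZ. Qed.
Lemma heisLD (a : 'rV[K]_3) k u v : heis a k (u + v) = heis a k u + heis a k v.
Proof. exact: linearD. Qed.
Lemma heisL0 (a : 'rV[K]_3) k : heis a k 0 = 0.
Proof. exact: linear0. Qed.
Lemma heis_sum (a : 'rV[K]_3) k I r (P : pred I) (F : I -> VF K) :
  heis a k (\sum_(i <- r | P i) F i) = \sum_(i <- r | P i) heis a k (F i).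
Proof. exact: linear_sum. Qed.
End Basis.

(** * The Heisenberg commutation relations *)

(* Unification would otherwise unfold these down to finite maps. *)
Local Opaque divcm mulcm ucm onecm heis Defs.ket VF.
Section Heis.
Variable K : numFieldType.

Implicit Types (s : mono) (x y : 'I_3 * nat).

Lemma divcmK x s : divcm (mulcm (ucm x) s) (ucm x) = s.
Proof. by apply/eqP/cmP => i; rewrite divcmE mulcmE addKn. Qed.

Lemma mulcmKK x s : (0 < s x)%N -> mulcm (ucm x) (divcm s (ucm x)) = s.
Proof.
move=> sx; apply/eqP/cmP => i; rewrite mulcmE divcmE ucmE.
by case: eqP => [<-|_]; rewrite ?subn0 // addnC subnK.
Qed.

Lemma divcm_mulcm x y s : x != y ->
  divcm (mulcm (ucm x) s) (ucm y) = mulcm (ucm x) (divcm s (ucm y)).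
Proof.
move=> xy; apply/eqP/cmP => i; rewrite !(mulcmE, divcmE) !ucmE.
by case: (x =P i) => [<-|_] //; rewrite [y == x]eq_sym (negPf xy) !subn0.
Qed.

Lemma mulcmCA (s t u : mono) : mulcm s (mulcm t u) = mulcm t (mulcm s u).
Proof. by rewrite mulcmA [mulcm s t]mulcmC -mulcmA. Qed.

Lemma divcmAC s x y : divcm (divcm s (ucm x)) (ucm y) =
  divcm (divcm s (ucm y)) (ucm x).
Proof.
apply/eqP/cmP => i; rewrite [LHS]divcmE.
rewrite divcmE divcmE divcmE; exact: subnAC.
Qed.

Local Notation ket := (ket K).

(** Leibniz rule for a first-order differential operator applied to a product
    with one variable; divcm truncates, so the case of a variable that does not
    occur in s has to be treated apart. *)
Lemma deriv_mul (W : lmodType K) (kt : mono -> W) (c b : 'I_3 -> K) n p m s j :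
  \sum_i b j *: ((n * c i * (mulcm (ucm (j, m)) s (i, p))%:R)
                 *: kt (divcm (mulcm (ucm (j, m)) s) (ucm (i, p)))) =
  \sum_i (n * c i * (s (i, p))%:R)
     *: (b j *: kt (mulcm (ucm (j, m)) (divcm s (ucm (i, p)))))
  + (n * (b j * c j) *+ (p == m)) *: kt s.
Proof.
rewrite (bigD1 j) //= [X in _ = X + _](bigD1 j) //= [RHS]addrAC; congr (_ + _).
  case: (eqVneq p m) => [->|pm]; last first.
    have xy : (j, m) != (j, p) by apply: contra pm => /eqP[->].
    rewrite divcm_mulcm // mulcmE ucmE (negPf xy) add0n mulr0n scale0r addr0.
    by rewrite !scalerA mulrC.
  rewrite divcmK mulcmE ucmE eqxx natrD mulr1n.
  have [s0|s0] := posnP (s (j, m)).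
    by rewrite s0 addr0 mulr1 mulr0 scale0r add0r scalerA mulrCA.
  rewrite mulcmKK // !scalerA -scalerDl; congr (_ *: _); rewrite mulr1n; ring.
apply: eq_bigr => i ij; have xy : (j, m) != (i, p).
  by apply: contra ij => /eqP[->].
by rewrite divcm_mulcm // mulcmE ucmE (negPf xy) add0n !scalerA mulrC.
Qed.

(** The canonical commutation relation, for an annihilation and a creation
    operator: differentiation and multiplication by a variable. *)
Lemma heis_commPN (a b : 'rV[K]_3) p m s g :
  heis a (Posz p.+1) (heis b (Negz m) (ket s g)) =
  heis b (Negz m) (heis a (Posz p.+1) (ket s g))
  + (p.+1%:R * formK a b *+ (p == m)) *: ket s g.
Proof.
rewrite heis_ketN heis_ketP !heis_sum.
under [X in X = _ + _]eq_bigr do rewrite heisLZ heis_ketP scaler_sumr.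
under [X in _ = X + _]eq_bigr do rewrite heisLZ heis_ketN scaler_sumr.
rewrite [in RHS]exchange_big [formK a b]formKE mulr_sumr -sumrMnl scaler_suml.
rewrite -big_split; apply: eq_bigr => j _.
exact: (@deriv_mul _ (fun s => ket s g) (fun i => formK a (to_K K (alpha i))) (fun j => b 0 j)).
Qed.

Lemma heis_commPP (a b : 'rV[K]_3) p q s g :
  heis a (Posz p.+1) (heis b (Posz q.+1) (ket s g)) =
  heis b (Posz q.+1) (heis a (Posz p.+1) (ket s g)).
Proof.
rewrite !heis_ketP !heis_sum.
under [X in X = _]eq_bigr do rewrite heisLZ heis_ketP scaler_sumr.
under [X in _ = X]eq_bigr do rewrite heisLZ heis_ketP scaler_sumr.
rewrite [in RHS]exchange_big; apply: eq_bigr => i _; apply: eq_bigr => j _.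
rewrite [LHS]scalerA [RHS]scalerA.
rewrite [X in _ *: ket X _ = _]divcmAC; apply: eq_scale; last exact: erefl.
rewrite [divcm s _ (j, p)]divcmE [divcm s _ (i, q)]divcmE 2!ucmE.
rewrite [(j, p) == _]eq_sym; case: eqP => [[-> ->]|_]; last by rewrite 2!subn0; ring.
ring.
Qed.

Lemma heis_commNN (a b : 'rV[K]_3) p q s g :
  heis a (Negz p) (heis b (Negz q) (ket s g)) =
  heis b (Negz q) (heis a (Negz p) (ket s g)).
Proof.
rewrite !heis_ketN !heis_sum.
under [X in X = _]eq_bigr do rewrite heisLZ heis_ketN scaler_sumr.
under [X in _ = X]eq_bigr do rewrite heisLZ heis_ketN scaler_sumr.
rewrite [in RHS]exchange_big; apply: eq_bigr => i _; apply: eq_bigr => j _.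
rewrite [LHS]scalerA [RHS]scalerA; apply: eq_scale; first exact: mulrC.
by rewrite [X in ket X _ = _]mulcmCA.
Qed.

Lemma heis_comm0 (a b : 'rV[K]_3) k s g :
  heis a 0 (heis b k (ket s g)) = heis b k (heis a 0 (ket s g)).
Proof.
rewrite [heis a 0 (ket s g)]heis_ket0 heisLZ; case: k => [[|q]|q].
- by rewrite [heis b 0 _]heis_ket0 heisLZ heis_ket0 [LHS]scalerA [RHS]scalerA mulrC.
- rewrite heis_ketP heis_sum scaler_sumr; apply: eq_bigr => i _.
  by rewrite heisLZ heis_ket0 [LHS]scalerA [RHS]scalerA mulrC.
- rewrite heis_ketN heis_sum scaler_sumr; apply: eq_bigr => i _.
  by rewrite heisLZ heis_ket0 [LHS]scalerA [RHS]scalerA mulrC.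
Qed.

Lemma heis_comm (a b : 'rV[K]_3) k l v :
  heis a k (heis b l v) =
  heis b l (heis a k v) + (k%:~R * formK a b *+ (k + l == 0)) *: v.
Proof.
move: v; apply: ket_ext => [c u v|c u v|s g].
- by rewrite !linearP.
- by rewrite !(heisLD, heisLZ) !scalerDr !scalerA [c * _]mulrC addrACA.
case: k l => [[|k]|k] [[|l]|l].
- by rewrite heis_comm0 mul0r mul0rn scale0r addr0.
- by rewrite heis_comm0 mul0r mul0rn scale0r addr0.
- by rewrite heis_comm0 mul0r mul0rn scale0r addr0.
- by rewrite -heis_comm0 addr0 mulr0n scale0r addr0.
- by rewrite heis_commPP mulr0n scale0r addr0.
- have -> : (Posz k.+1 + Negz l == 0) = (k == l) by apply/eqP/eqP; lia.
  exact: heis_commPN.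
- by rewrite -heis_comm0 addr0 mulr0n scale0r addr0.
- have -> : (Negz k + Posz l.+1 == 0) = (l == k) by apply/eqP/eqP; lia.
  rewrite [heis b (Posz _) (heis a _ _)]heis_commPN -[RHS]addrA -scalerDl.
  rewrite [X in _ = _ + X *: _](_ : _ = 0); first by rewrite scale0r addr0.
  rewrite formKC; case: eqP => [->|_]; last by rewrite addr0.
  by rewrite 2!mulr1n NegzE mulrNz mulNr subrr.
- by rewrite heis_commNN mulr0n scale0r addr0.
Qed.

Lemma heis_expQ_gt0 (a : 'rV[K]_3) k g : (0 < k)%R -> heis a k (expQ K g) = 0.
Proof.
case: k => [[|k]|k] // _; rewrite /expQ heis_ketP big1 // => j _.
by rewrite onecmE mulr0 scale0r.
Qed.

Lemma heis_expQ0 (a : 'rV[K]_3) g :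
  heis a 0 (expQ K g) = formK a (to_K K g) *: expQ K g.
Proof. exact: heis_ket0. Qed.
End Heis.
Local Transparent divcm mulcm ucm onecm heis Defs.ket VF.

(** * Exponentials of operator series *)

Section Exp.
Lemma triangle_exchange (V : nmodType) m (F : nat -> nat -> V) :
  \sum_(1 <= k < m.+1) \sum_(1 <= j < (m - k).+1) F k j =
  \sum_(1 <= j < m.+1) \sum_(1 <= k < (m - j).+1) F k j.
Proof.
have H (G : nat -> nat -> V) :
    \sum_(1 <= k < m.+1) \sum_(1 <= j < (m - k).+1) G k j =
    \sum_(1 <= k < m.+1) \sum_(1 <= j < m.+1 | (j + k <= m)%N) G k j.
  apply: eq_big_nat => k /andP[_ km].
  rewrite (@big_nat_widen _ _ _ _ _ m.+1) ?ltnS ?leq_subr //.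
  by apply: eq_bigl => j; rewrite andTb ltnS leq_subRL // addnC.
rewrite H (H (fun j k => F k j)) (exchange_big_dep predT) //=.
by apply: eq_bigr => j _; apply: eq_bigl => k; rewrite addnC.
Qed.

Variables (K : numFieldType) (a : nat -> VF K -> VF K).
Hypothesis alin : forall k, linear (a k).
Hypothesis acomm : forall j k v, a j (a k v) = a k (a j v).

Let al k : {linear VF K -> VF K} :=
  HB.pack (a k) (GRing.isLinear.Build K _ _ _ (a k) (alin k)).
Let a_sum k I r (P : pred I) (F : I -> VF K) :
  a k (\sum_(i <- r | P i) F i) = \sum_(i <- r | P i) a k (F i).
Proof. exact: (linear_sum (al k)). Qed.
Let aZ k c v : a k (c *: v) = c *: a k v.
Proof. exact: (linearZZ (al k)). Qed.
Let a0 k : a k 0 = 0.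
Proof. exact: (linear0 (al k)). Qed.

Lemma pow_coef_linear r m : linear (pow_coef a r m).
Proof.
elim: r m => [|r IH] m c u v /=; first by case: eqP; rewrite ?scaler0 ?addr0.
rewrite scaler_sumr -big_split; apply: eq_bigr => k _.
by rewrite IH alin.
Qed.

Lemma pow_coef_gt r m v : (m < r)%N -> pow_coef a r m v = 0.
Proof.
elim: r m => [//|r IH] m mr /=; rewrite big_nat big1 // => k /andP[k0 km].
by rewrite IH ?a0 //; lia.
Qed.

(** This is t (A^r)' = r t A' A^(r-1) for A = \sum_k a_k t^k. *)
Lemma pow_coef_deriv r m v : m%:R *: pow_coef a r m v =
  r%:R *: \sum_(1 <= k < m.+1) k%:R *: a k (pow_coef a r.-1 (m - k) v).
Proof.
elim: r m => [|r IH] m.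
  by rewrite scale0r /=; case: eqP => [->|]; rewrite ?scale0r ?scaler0.
rewrite [pow_coef a r.+1 m v]/= [in RHS]/= scaler_sumr.
rewrite -natr1 scalerDl scale1r addrC.
have -> : r%:R *: (\sum_(1 <= k < m.+1) k%:R *: a k (pow_coef a r (m - k) v)) =
   \sum_(1 <= k < m.+1) a k ((m - k)%:R *: pow_coef a r (m - k) v).
  under [RHS]eq_bigr => k _ do rewrite IH aZ a_sum.
  case: r {IH} => [|r]; first by rewrite scale0r big1 // => k _; rewrite scale0r.
  rewrite -[RHS]scaler_sumr; apply: eq_scale; first exact: erefl.
  rewrite [RHS]triangle_exchange.
  apply: eq_bigr => k _; rewrite a_sum scaler_sumr; apply: eq_bigr => j _.
  by rewrite aZ acomm subnAC.
rewrite -big_split; apply: eq_big_nat => k /andP[_ km] /=.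
by rewrite aZ -scalerDl -natrD subnKC.
Qed.

Lemma exp_coef_widen N m v : (m < N)%N ->
  exp_coef a m v = \sum_(r < N) (r`!%:R)^-1 *: pow_coef a r m v.
Proof.
move=> mN; rewrite /exp_coef.
rewrite -!(big_mkord xpredT (fun r => (r`!%:R)^-1 *: pow_coef a r m v)).
rewrite [RHS](big_cat_nat (n := m.+1)) // [X in _ = _ + X]big_nat.
rewrite [X in _ = _ + X]big1; first by rewrite [RHS]addr0.
by move=> r /andP[mr _]; rewrite pow_coef_gt // scaler0.
Qed.

Lemma exp_coef0 v : exp_coef a 0 v = v.
Proof. by rewrite /exp_coef big_ord1 invr1 scale1r. Qed.

(** This is t E' = t A' E for E = exp A. With E_0 = 1 it determines E, so that it
    replaces the explicit formula for the exponential from here on. *)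
Lemma exp_coef_rec m v : m%:R *: exp_coef a m v =
  \sum_(1 <= k < m.+1) k%:R *: a k (exp_coef a (m - k) v).
Proof.
have -> : \sum_(1 <= k < m.+1) k%:R *: a k (exp_coef a (m - k) v) =
  \sum_(1 <= k < m.+1) k%:R *:
    \sum_(r < m) (r`!%:R)^-1 *: a k (pow_coef a r (m - k) v).
  apply: eq_big_nat => k /andP[k0 km]; rewrite (exp_coef_widen (N := m)); last lia.
  by rewrite a_sum; apply: eq_scale; [exact: erefl|]; apply: eq_bigr => r _; rewrite aZ.
under [RHS]eq_bigr do rewrite scaler_sumr.
rewrite [RHS]exchange_big /exp_coef big_ord_recl scalerDr.
rewrite [X in _ + X]scaler_sumr.
rewrite [X in X + _](_ : _ = 0); last first.
  rewrite [pow_coef _ _ _ _](_ : _ = if m == 0%N then v else 0); last by [].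
  by case: eqP => [->|_]; [exact: scale0r | rewrite !scaler0].
rewrite add0r; apply: eq_bigr => r _; rewrite [lift _ _ : nat]/= [bump 0 r]add1n.
rewrite scalerA mulrC -scalerA.
rewrite pow_coef_deriv.
rewrite [LHS]scalerA.
have -> : (r.+1`!%:R)^-1 * r.+1%:R = (r`!%:R)^-1 :> K.
  by rewrite factS natrM invfM mulrAC mulVf ?mul1r // pnatr_eq0.
rewrite [LHS]scaler_sumr; apply: eq_bigr => k _.
by rewrite [LHS]scalerA [RHS]scalerA mulrC.
Qed.

Lemma exp_coef_linear m : linear (exp_coef a m).
Proof.
move=> c u v; rewrite /exp_coef scaler_sumr -big_split; apply: eq_bigr => r _.
by rewrite pow_coef_linear scalerDr !scalerA mulrC.
Qed.
End Exp.

(** * Linear identities in a module *)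

Section Lincomb.
Variables (K : comNzRingType) (V : lmodType K).

(** ring decides identities in a ring only. A linear identity in a module is
    reflected here into one ring identity for each atom, its coefficient. *)
Inductive lincomb :=
  | LAtom of nat | LZero | LAdd of lincomb & lincomb | LOpp of lincomb
  | LScale of K & lincomb.

Fixpoint lineval (e : seq V) t : V :=
  match t with
  | LAtom i => nth 0 e i
  | LZero => 0
  | LAdd t u => lineval e t + lineval e u
  | LOpp t => - lineval e t
  | LScale c t => c *: lineval e t
  end.

Fixpoint lincoef t (i : nat) : K :=
  match t with
  | LAtom j => if eqn i j then 1 else 0
  | LZero => 0
  | LAdd t u => lincoef t i + lincoef u i
  | LOpp t => - lincoef t i
  | LScale c t => c * lincoef t i
  end.

Fixpoint lincoef_eq t u n : Prop :=
  if n is n'.+1 then lincoef t n' = lincoef u n' /\ lincoef_eq t u n' else True.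

Lemma linevalE e t : lineval e t = \sum_(i < size e) lincoef t i *: e`_i.
Proof.
elim: t => [j||t IHt u IHu|t IH|c t IH] /=.
- have [je|ej] := ltnP j (size e); last first.
    rewrite nth_default // big1 // => i _; case: eqnP => [ij|]; rewrite ?scale0r //.
    by have := ltn_ord i; rewrite ij ltnNge ej.
  rewrite (bigD1 (Ordinal je)) //= big1 => [|i ij].
    by rewrite addr0; case: eqnP => // _; rewrite scale1r.
  by case: eqnP => [ji|]; rewrite ?scale0r //; case/eqP: ij; apply: val_inj.
- by rewrite big1 // => i _; rewrite scale0r.
- by rewrite IHt IHu -big_split; apply: eq_bigr => i _; rewrite scalerDl.
- by rewrite IH -sumrN; apply: eq_bigr => i _; rewrite scaleNr.
- by rewrite IH scaler_sumr; apply: eq_bigr => i _; rewrite scalerA.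
Qed.

Lemma lineval_eq e t u : lincoef_eq t u (size e) -> lineval e t = lineval e u.
Proof.
rewrite !linevalE; elim: (size e) => [|n IH] /=; first by rewrite !big_ord0.
by move=> [tu /IH]; rewrite !big_ord_recr /= tu => ->.
Qed.
End Lincomb.

Ltac lin_index x e :=
  match e with
  | ?y :: _ => let _ := match goal with _ => unify x y end in constr:(0%N)
  | _ :: ?e' => let i := lin_index x e' in constr:(S i)
  end.
Ltac lin_atoms e v :=
  lazymatch v with
  | (?a + ?b)%R => let e1 := lin_atoms e a in lin_atoms e1 b
  | (- ?a)%R => lin_atoms e a
  | (_ *: ?a)%R => lin_atoms e a
  | 0%R => e
  | _ => match goal with
         | _ => let _ := lin_index v e in e
         | _ => constr:(v :: e)
         end
  end.
Ltac lin_reify K e v :=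
  lazymatch v with
  | (?a + ?b)%R => let x := lin_reify K e a in
      let y := lin_reify K e b in constr:(LAdd x y)
  | (- ?a)%R => let x := lin_reify K e a in constr:(LOpp x)
  | (?c *: ?a)%R => let x := lin_reify K e a in constr:(LScale c x)
  | 0%R => constr:(LZero K)
  | _ => let i := lin_index v e in constr:(LAtom K i)
  end.
(** Scalar identities that ring does not prove, such as those with a division, are
    left as goals. *)
Ltac lincomb K V :=
  lazymatch goal with
  | |- ?u = ?v =>
    let e0 := lin_atoms (@nil (V : Type)) u in
    let e := lin_atoms e0 v in
    let t := lin_reify (K : comNzRingType) e u in
    let s := lin_reify (K : comNzRingType) e v in
    refine (@lineval_eq _ V e t s _ : u = v);
    cbn [size lincoef_eq lincoef eqn]; repeat split; try ring
  end.

(** * Series of operators and their commutators *)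

(** The sums defining fields are locally finite. Each one is replaced by its first
    N terms for every large N, which allows several sums to be truncated at a
    common place. *)
Definition eventually (P : nat -> Prop) := exists N0, forall N, (N0 <= N)%N -> P N.

Lemma eventually_and P Q :
  eventually P -> eventually Q -> eventually (fun N => P N /\ Q N).
Proof.
move=> [M HM] [N HN]; exists (maxn M N) => n; rewrite geq_max => /andP[Mn Nn].
by split; [apply: HM | apply: HN].
Qed.
Lemma eventually_mono (P Q : nat -> Prop) :
  (forall N, P N -> Q N) -> eventually P -> eventually Q.
Proof. by move=> PQ [M HM]; exists M => N /HM /PQ. Qed.
Lemma eventually_ge M : eventually (fun N => M <= N)%N.
Proof. by exists M. Qed.

Lemma eventually_forall (T : finType) (P : T -> nat -> Prop) :
  (forall i, eventually (P i)) -> eventually (fun N => forall i, P i N).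
Proof.
move=> /choice[f Hf]; exists (\max_i f i) => N fN i.
by apply: Hf; apply: leq_trans fN; exact: leq_bigmax.
Qed.

(** Indexing by all integers spares the case distinctions on the sign of
    exponents such as - n - 1 - (b, g). *)
Definition coef_int (V : nmodType) (T : nat -> V -> V) (z : int) (v : V) : V :=
  if z is Posz p then T p v else 0.

Section Exponential.
Variables (K : numFieldType) (V : lmodType K) (T a : nat -> V -> V) (e : K).
Hypotheses (alin : forall k, linear (a k)) (T0 : forall v, T 0%N v = v).
Hypothesis Trec : forall m v,
  m%:R *: T m v = e *: \sum_(1 <= k < m.+1) a k (T (m - k)%N v).

Let al k : {linear V -> V} :=
  HB.pack (a k) (GRing.isLinear.Build K _ _ _ (a k) (alin k)).
Let aD k u v : a k (u + v) = a k u + a k v. Proof. exact: (linearD (al k)). Qed.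
Let aZ k c v : a k (c *: v) = c *: a k v. Proof. exact: (linearZZ (al k)). Qed.
Let a0 k : a k 0 = 0. Proof. exact: (linear0 (al k)). Qed.

Lemma coef_int_lt0 z v : (z < 0)%R -> coef_int T z v = 0.
Proof. by case: z. Qed.

Lemma coef_int_rec N z v : (z <= N%:Z)%R ->
  z%:~R *: coef_int T z v = e *: \sum_(1 <= k < N.+1) a k (coef_int T (z - k%:Z) v).
Proof.
case: z => [m|m]; last first.
  rewrite scaler0 big_nat big1 ?scaler0 // => k /andP[k0 _].
  rewrite coef_int_lt0; first exact: a0.
  lia.
rewrite lez_nat => mN; rewrite [LHS]Trec; apply: eq_scale => //.
rewrite [RHS](big_cat_nat (n := m.+1)) //= [X in _ = _ + X]big_nat.
rewrite [X in _ = _ + X]big1 ?addr0 => [|k /andP[mk _]]; last first.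
  by rewrite coef_int_lt0 ?a0 //; lia.
apply: eq_big_nat => k /andP[_ km]; rewrite -[(m - k)%N]/(`|(m - k)%N|)%N.
by rewrite (_ : m%:Z - k%:Z = (m - k)%N) //; lia.
Qed.

(** If [X, a_k] is scalar, nonzero only for k = k0, then X acts as a derivation
    multiplying the exponential by a multiple of t^k0. *)
Lemma exponential_comm (X : V -> V) (k0 : nat) (c : K) :
  linear X -> (0 < k0)%N ->
  (forall k v, (0 < k)%N -> X (a k v) = a k (X v) + (k0%:R * c *+ (k == k0)) *: v) ->
  forall z v, X (coef_int T z v) =
    coef_int T z (X v) + (e * c) *: coef_int T (z - k0%:Z) v.
Proof.
move=> Xlin k0_gt0 Xa.
pose XL : {linear V -> V} :=
  HB.pack X (GRing.isLinear.Build K _ _ _ X Xlin).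
have X0 : X 0 = 0 by exact: (linear0 XL).
have XZ d v : X (d *: v) = d *: X v by exact: (linearZZ XL).
have XS I r (P : pred I) (F : I -> V) :
    X (\sum_(i <- r | P i) F i) = \sum_(i <- r | P i) X (F i).
  exact: (linear_sum XL).
move=> z v; case: z => [p|p]; last first.
  rewrite [coef_int T (_ - _) _]coef_int_lt0; last by lia.
  by rewrite /= X0 scaler0 addr0.
elim/ltn_ind: p => p IH; have [->|p0] := posnP p.
  rewrite /= !T0; case: k0 k0_gt0 {Xa IH} => // k _.
  by rewrite sub0r scaler0 addr0.
have pn0 : p%:R != 0 :> K by rewrite pnatr_eq0 -lt0n.
apply: (scalerI pn0); rewrite -XZ scalerDr scalerA mulrC -scalerA.
rewrite [in LHS]/coef_int Trec XZ XS.
have -> : \sum_(1 <= k < p.+1) X (a k (T (p - k)%N v)) =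
   \sum_(1 <= k < p.+1) a k (T (p - k)%N (X v)) +
   ((e * c) *: (\sum_(1 <= k < p.+1) a k (coef_int T ((p%:Z - k0%:Z) - k%:Z) v)) +
   (k0%:R * c) *: coef_int T (p%:Z - k0%:Z) v).
  have -> : coef_int T (p%:Z - k0%:Z) v =
     \sum_(1 <= k < p.+1) ((k == k0)%:R *: T (p - k)%N v).
    have [k0p|pk0] := leqP k0 p.
      rewrite (bigD1_seq k0) ?mem_index_iota ?iota_uniq ?k0_gt0 //= eqxx scale1r.
      rewrite big1 ?addr0 => [|k /negPf->]; last by rewrite scale0r.
      by rewrite (_ : p%:Z - k0%:Z = (p - k0)%N) //; lia.
    rewrite coef_int_lt0; last by lia.
    rewrite big_nat big1 // => k /andP[_ kp]; rewrite (_ : k == k0 = false) ?scale0r //.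
    by apply/eqP; lia.
  rewrite !scaler_sumr -!big_split; apply: eq_big_nat => k /andP[k1 kp] /=.
  have := IH (p - k)%N ltac:(lia); rewrite /= => IHk.
  rewrite Xa // IHk aD aZ -addrA; congr (_ + (_ *: a k (coef_int T _ v) + _)).
    by lia.
  by rewrite scalerA mulr_natr.
rewrite scalerDr -Trec scalerDr; congr (_ + _).
have := @coef_int_rec p (p%:Z - k0%:Z) v ltac:(lia).
set S := \sum_(_ <= _ < _) _ => H.
have -> : e *: ((e * c) *: S) = (e * c) *: (e *: S) by lincomb K V.
rewrite -H; lincomb K V.
Qed.
End Exponential.

(** * Vertex operators on a module over the Heisenberg algebra *)

Section HeisenbergModule.
Variables (K : numFieldType) (V : lmodType K).
Variables (h : 'rV[K]_3 -> int -> V -> V) (E : lattice -> V).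
Hypothesis h_lin : forall a k, linear (h a k).
Hypothesis h_comm : forall a b k l v, h a k (h b l v) =
  h b l (h a k v) + (k%:~R * formK a b *+ (k + l == 0)) *: v.
Hypothesis h_addl : forall a b k v, h (a + b) k v = h a k v + h b k v.
Hypothesis h_E_gt0 : forall a k g, (0 < k)%R -> h a k (E g) = 0.
Hypothesis h_E0 : forall a g, h a 0 (E g) = formK a (to_K K g) *: E g.
Hypothesis V_ind : forall P : V -> Prop,
  P 0 -> (forall c u v, P u -> P v -> P (c *: u + v)) -> (forall g, P (E g)) ->
  (forall i m v, P v -> P (h (to_K K (alpha i)) (Negz m) v)) -> forall v, P v.

Let hl a k : {linear V -> V} :=
  HB.pack (h a k) (GRing.isLinear.Build K _ _ _ (h a k) (h_lin a k)).
Let hD a k u v : h a k (u + v) = h a k u + h a k v.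
Proof. exact: (linearD (hl a k)). Qed.
Let hZ a k c v : h a k (c *: v) = c *: h a k v.
Proof. exact: (linearZZ (hl a k)). Qed.
Let hN a k v : h a k (- v) = - h a k v.
Proof. exact: (linearN (hl a k)). Qed.
Let h0 a k : h a k 0 = 0.
Proof. exact: (linear0 (hl a k)). Qed.
Let hS a k I r (P : pred I) (F : I -> V) :
  h a k (\sum_(i <- r | P i) F i) = \sum_(i <- r | P i) h a k (F i).
Proof. exact: (linear_sum (hl a k)). Qed.

(** Every annihilation operator of high enough mode kills a given vector; the
    bound does not depend on the direction a. *)
Lemma heis_nilpotent v : eventually (fun N => forall a, h a N%:Z v = 0).
Proof.
move: v; apply: V_ind => [|c u v Pu Pv|g|i m v Pv].
- by exists 0%N => N _ a; rewrite h0.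
- apply: eventually_mono (eventually_and Pu Pv) => N [hu hv] a.
  by rewrite h_lin hu hv scaler0 addr0.
- by exists 1%N => N N1 a; rewrite h_E_gt0.
- apply: eventually_mono (eventually_and (eventually_ge m.+2) Pv) => N [mN hv] a.
  rewrite h_comm hv h0 add0r (_ : (_ == 0) = false) ?mulr0n ?scale0r //.
  by apply/eqP; lia.
Qed.

Section Creation.
Variables (b : lattice) (C : nat -> V -> V).
Let bK := to_K K b.
Hypothesis C_lin : forall m, linear (C m).
Hypothesis C0 : forall v, C 0%N v = v.
Hypothesis C_rec : forall m v,
  m%:R *: C m v = 1 *: \sum_(1 <= k < m.+1) h bK (- k%:Z) (C (m - k)%N v).
Local Notation Ci := (coef_int C).

Let C_0 z : Ci z 0 = 0.
Proof.
case: z => // m; pose Cl : {linear V -> V} :=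
  HB.pack (C m) (GRing.isLinear.Build K _ _ _ (C m) (C_lin m)).
exact: (linear0 Cl).
Qed.
Let CZ z c v : Ci z (c *: v) = c *: Ci z v.
Proof.
case: z => [m|m]; last by rewrite /= scaler0.
pose Cl : {linear V -> V} :=
  HB.pack (C m) (GRing.isLinear.Build K _ _ _ (C m) (C_lin m)).
exact: (linearZZ Cl).
Qed.

Lemma creation_comm a (k : nat) z v : (0 < k)%N ->
  h a k (Ci z v) = Ci z (h a k v) + formK a bK *: Ci (z - k%:Z) v.
Proof.
move=> k0; rewrite -[formK a bK]mul1r.
apply: (exponential_comm (a := fun j => h bK (- j%:Z))) => // j u j0.
rewrite h_comm; congr (_ + (_ *+ (_ : bool)) *: _); apply/eqP/eqP; lia.
Qed.

Lemma creation_comm_le0 a k z v : (k <= 0)%R -> h a k (Ci z v) = Ci z (h a k v).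
Proof.
move=> k_le0.
rewrite (@exponential_comm _ _ C (fun j => h bK (- j%:Z)) 1 _ C0 C_rec _ 1%N 0) //.
  by rewrite mulr0 scale0r addr0.
move=> j u j0; rewrite h_comm mulr0 mul0rn (_ : (_ == 0) = false) ?mulr0n //.
by apply/eqP; lia.
Qed.

Lemma creation_rec N z v : (z <= N%:Z)%R -> z%:~R *: Ci z v =
  \sum_(1 <= k < N.+1) h bK (- k%:Z) (Ci (z - k%:Z) v).
Proof.
move=> zN; rewrite (coef_int_rec (a := fun j => h bK (- j%:Z)) _ C_rec v zN) //.
by rewrite scale1r.
Qed.

Section Annihilation.
Variable A : nat -> V -> V.
Hypothesis A_lin : forall m, linear (A m).
Hypothesis A0 : forall v, A 0%N v = v.
Hypothesis A_rec : forall m v,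
  m%:R *: A m v = - 1 *: \sum_(1 <= k < m.+1) h bK k%:Z (A (m - k)%N v).
Local Notation Ai := (coef_int A).

Lemma annihilation_comm a (k : nat) z v : (0 < k)%N ->
  h a (- k%:Z) (Ai z v) = Ai z (h a (- k%:Z) v) + formK a bK *: Ai (z - k%:Z) v.
Proof.
move=> k0; rewrite [X in X *: _](_ : _ = -1 * - formK a bK); last by rewrite mulrNN mul1r.
apply: (exponential_comm (a := fun j => h bK j%:Z)) => // j u j0.
rewrite h_comm rmorphN mulrN mulNr; congr (_ + (_ *+ (_ : bool)) *: _).
by apply/eqP/eqP; lia.
Qed.

Lemma annihilation_comm_ge0 a k z v : (0 <= k)%R -> h a k (Ai z v) = Ai z (h a k v).
Proof.
move=> k_ge0.
rewrite (@exponential_comm _ _ A (fun j => h bK j%:Z) (-1) _ A0 A_rec _ 1%N 0) //.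
  by rewrite mulr0 scale0r addr0.
move=> j u j0; rewrite h_comm mulr0 mul0rn (_ : (_ == 0) = false) ?mulr0n //.
by apply/eqP; lia.
Qed.

Lemma annihilation_E q g : (0 < q)%N -> A q (E g) = 0.
Proof.
elim/ltn_ind: q => q IH q0; have qn0 : q%:R != 0 :> K by rewrite pnatr_eq0 -lt0n.
apply: (scalerI qn0); rewrite A_rec big_nat big1 ?scaler0 // => k /andP[k1 kq].
have [->|qk] := posnP (q - k)%N; first by rewrite A0 h_E_gt0.
by rewrite IH ?h0 //; lia.
Qed.

Lemma annihilation_nilpotent v : eventually (fun N => A N v = 0).
Proof.
have AL q c u w : A q (c *: u + w) = c *: A q u + A q w by exact: A_lin.
have A_0 q : A q 0 = 0 by have := AL q (-1) 0 0; rewrite !scaler0 addr0 scaleN1r addNr.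
move: v; apply: V_ind => [|c u v Pu Pv|g|i m v Pv].
- by exists 0%N.
- apply: eventually_mono (eventually_and Pu Pv) => N [hu hv].
  by rewrite AL hu hv scaler0 addr0.
- by exists 1%N => N N1; rewrite annihilation_E.
- case: Pv => M HM; exists (M + m.+1)%N => N MN.
  have := @annihilation_comm (to_K K (alpha i)) m.+1 N v isT.
  rewrite (_ : N%:Z - m.+1%:Z = (N - m.+1)%N); last lia.
  rewrite /= !HM ?h0 ?scaler0 ?addr0; [exact: esym | lia | lia].
Qed.

(** The coefficient of t^z in the product of the creation exponential C and the
    annihilation exponential A, with A truncated after M terms. *)
Definition vertex_sum (z : int) (M : nat) (v : V) : V :=
  \sum_(q < M) Ci (z + q%:Z) (A q v).

Let CD z u v : Ci z (u + v) = Ci z u + Ci z v.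
Proof.
case: z => [m|m]; last by rewrite /= addr0.
pose Cl : {linear V -> V} :=
  HB.pack (C m) (GRing.isLinear.Build K _ _ _ (C m) (C_lin m)).
exact: (linearD Cl).
Qed.

Lemma vertex_sum_linear z M : linear (vertex_sum z M).
Proof.
move=> c u v; rewrite /vertex_sum scaler_sumr -big_split.
by apply: eq_bigr => q _ /=; rewrite A_lin CD CZ.
Qed.

Lemma vertex_sum_E z M g : vertex_sum z M.+1 (E g) = Ci z (E g).
Proof.
rewrite /vertex_sum big_ord_recl big1 => [|i _]; last by rewrite annihilation_E ?C_0.
by rewrite !addr0 A0.
Qed.

Lemma vertex_sum_comm_gt0 a (k : nat) z M v : (0 < k)%N ->
  h a k (vertex_sum z M v) =
  vertex_sum z M (h a k v) + formK a bK *: vertex_sum (z - k%:Z) M v.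
Proof.
move=> k0; rewrite /vertex_sum hS scaler_sumr -big_split; apply: eq_bigr => q _ /=.
rewrite creation_comm // -[A q v]/(Ai q v) annihilation_comm_ge0 //.
by rewrite (_ : z + q%:Z - k%:Z = z - k%:Z + q%:Z) //; lia.
Qed.

Lemma vertex_sum_comm0 a z M v :
  h a 0 (vertex_sum z M v) = vertex_sum z M (h a 0 v).
Proof.
rewrite /vertex_sum hS; apply: eq_bigr => q _.
by rewrite creation_comm_le0 // -[A q v]/(Ai q v) annihilation_comm_ge0.
Qed.

Lemma vertex_sum_comm_lt0 a (k : nat) z M v : (0 < k)%N ->
  h a (- k%:Z) (vertex_sum z (M + k) v) =
  vertex_sum z (M + k) (h a (- k%:Z) v) + formK a bK *: vertex_sum (z + k%:Z) M v.
Proof.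
move=> k0; have -> : vertex_sum (z + k%:Z) M v =
    \sum_(q < M + k) Ci (z + q%:Z) (Ai (q%:Z - k%:Z) v).
  rewrite /vertex_sum addnC big_split_ord big1 /= => [|i _]; last first.
    by rewrite [X in Ci _ X]coef_int_lt0 ?C_0 //; have := ltn_ord i; lia.
  rewrite add0r; apply: eq_bigr => i _.
  rewrite (_ : (k + i)%N%:Z - k%:Z = i); last lia.
  by rewrite (_ : z + (k + i)%N%:Z = z + k%:Z + i%:Z) //; lia.
rewrite /vertex_sum hS scaler_sumr -big_split; apply: eq_bigr => q _ /=.
rewrite creation_comm_le0; last by lia.
by rewrite -[A q v]/(Ai q v) annihilation_comm // CD CZ.
Qed.
End Annihilation.

Section Field.
Variables (Y : int -> V -> V) (s : lattice -> K).
Hypothesis Y_lin : forall n, linear (Y n).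
Hypothesis Y_E : forall n g, Y n (E g) =
  s g *: Ci (- n - 1 - form b g) (E (b + g)).
Hypothesis Y_comm : forall a k n v,
  h a k (Y n v) = Y n (h a k v) + formK a bK *: Y (n + k) v.

Let Yl m : {linear V -> V} :=
  HB.pack (Y m) (GRing.isLinear.Build K _ _ _ (Y m) (Y_lin m)).
Let YD m u v : Y m (u + v) = Y m u + Y m v.
Proof. exact: (linearD (Yl m)). Qed.
Let YZ m c v : Y m (c *: v) = c *: Y m v.
Proof. exact: (linearZZ (Yl m)). Qed.
Let YN m v : Y m (- v) = - Y m v.
Proof. exact: (linearN (Yl m)). Qed.
Let Y0 m : Y m 0 = 0.
Proof. exact: (linear0 (Yl m)). Qed.
Let Y_h n a k v : Y n (h a k v) = h a k (Y n v) - formK a bK *: Y (n + k) v.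
Proof. by rewrite Y_comm addrK. Qed.

Lemma formDl (g g' c : lattice) : form (g + g') c = form g c + form g' c.
Proof. by rewrite /form !mulmxDl mxE. Qed.
Lemma formDr (g g' c : lattice) : form c (g + g') = form c g + form c g'.
Proof. by rewrite /form linearD /= mulmxDr mxE. Qed.

Lemma formC g g' : form g g' = form g' g.
Proof. by apply: (@intr_inj rat); rewrite -!formK_int formKC. Qed.

(** The derivative of Y(e^b, z) is the normally ordered product of b(z) and
    Y(e^b, z). On e^g it is the recurrence of the creation exponential, and both
    sides have the same commutators with the alpha_i(-m). *)
Lemma vertex_derivative n v : eventually (fun N =>
  \sum_(i < N) h bK (- i.+1%:Z) (Y (n + i%:Z) v)
  + \sum_(i < N) Y (n - i.+1%:Z) (h bK i%:Z v) = - n%:~R *: Y (n - 1) v).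
Proof.
move: v n; apply: V_ind => [|c u v Pu Pv|g|i j v Pv] n.
- exists 0%N => N _; rewrite Y0 scaler0.
  by rewrite !big1 ?addr0 // => i _; rewrite ?Y0 h0 ?Y0.
- apply: eventually_mono (eventually_and (Pu n) (Pv n)) => N [HU HV].
  rewrite YD YZ scalerDr scalerA mulrC -scalerA -HU -HV.
  rewrite scalerDr !scaler_sumr addrACA -!big_split.
  apply: eq_bigr => i _ /=; rewrite !(YD, hD, YZ, hZ); lincomb K V.
- set z := - n - 1 - form b g.
  apply: eventually_mono (eventually_ge (absz (z + 1)).+1) => N Nz.
  have -> : \sum_(i < N) h bK (- i.+1%:Z) (Y (n + i%:Z) (E g)) =
      s g *: ((z + 1)%:~R *: Ci (z + 1) (E (b + g))).
    rewrite (@creation_rec N); last lia.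
    rewrite big_add1 big_mkord scaler_sumr; apply: eq_bigr => i _.
    rewrite Y_E hZ; congr (_ *: h _ _ (Ci _ _)); rewrite /z -addn1 PoszD; ring.
  case: N Nz => // N _; rewrite big_ord_recl big1 => [|i _]; last first.
    by rewrite h_E_gt0 ?Y0.
  rewrite addr0 h_E0 YZ !Y_E formK_int.
  rewrite (_ : - (n - 1%:Z) - 1 - form b g = z + 1); last by rewrite /z; lia.
  have -> : n%:~R = - (z + 1 + form b g)%:~R :> K by rewrite -rmorphN; congr _%:~R; lia.
  lincomb K V.
set a := to_K K (alpha i); set l := Negz j.
apply: eventually_mono (eventually_and (eventually_ge j.+2)
  (eventually_and (Pv n) (Pv (n + l)))) => N [Nj [H1 H2]].
have -> : \sum_(i0 < N) h bK (- i0.+1%:Z) (Y (n + i0%:Z) (h a l v)) =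
  h a l (\sum_(i0 < N) h bK (- i0.+1%:Z) (Y (n + i0%:Z) v)) -
  formK a bK *: \sum_(i0 < N) h bK (- i0.+1%:Z) (Y (n + l + i0%:Z) v).
  rewrite hS scaler_sumr -sumrB; apply: eq_bigr => i0 _.
  rewrite Y_h hD hN hZ h_comm mulr0n scale0r addr0.
  by rewrite addrAC.
have -> : \sum_(i0 < N) Y (n - i0.+1%:Z) (h bK i0%:Z (h a l v)) =
  h a l (\sum_(i0 < N) Y (n - i0.+1%:Z) (h bK i0%:Z v)) -
  formK a bK *: \sum_(i0 < N) Y (n + l - i0.+1%:Z) (h bK i0%:Z v)
  - (l%:~R * formK a bK) *: Y (n + l - 1) v.
  have -> : - ((l%:~R * formK a bK) *: Y (n + l - 1) v) =
     \sum_(i0 < N) (i0 == j.+1 :> nat)%:R *: - ((l%:~R * formK a bK) *: Y (n + l - 1) v).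
    rewrite (bigD1 (Ordinal Nj)) //= eqxx scale1r big1 ?addr0 // => i0 ij.
    rewrite (_ : (i0 == j.+1 :> nat) = false) ?scale0r //.
    by apply: contraNF ij => /eqP ij; apply/eqP/val_inj.
  rewrite hS scaler_sumr -sumrB -big_split; apply: eq_bigr => i0 _ /=.
  rewrite h_comm YD Y_h YZ formKC.
  rewrite (_ : n - i0.+1%:Z + l = n + l - i0.+1%:Z); last lia.
  rewrite (_ : (i0%:Z + l == 0) = (i0 == j.+1 :> nat)); last by apply/eqP/eqP; lia.
  case: eqP => [->|_]; last by rewrite mulr0n [false%:R]mulr0n; lincomb K V.
  rewrite (_ : n - j.+2%:Z = n + l - 1); last lia.
  have -> : l%:~R = - j.+1%:R :> K by rewrite /l NegzE rmorphN.
  rewrite mulr1n [true%:R]mulr1n; lincomb K V.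
rewrite Y_h.
move: (congr1 (h a l) H1); rewrite hD hZ => H1'.
rewrite (_ : n - 1 + l = n + l - 1); last lia.
transitivity (- n%:~R *: h a l (Y (n - 1) v)
   - formK a bK *: (- (n + l)%:~R *: Y (n + l - 1) v)
   - (l%:~R * formK a bK) *: Y (n + l - 1) v); last by lincomb K V.
by rewrite -H1' -H2; lincomb K V.
Qed.

Section Virasoro.
Variable L : int -> V -> V.
Hypothesis L_lin : forall m, linear (L m).
Hypothesis L_comm : forall a l n v,
  h a l (L n v) = L n (h a l v) + l%:~R *: h a (n + l) v.
Hypothesis L_E_gt0 : forall m g, (0 < m)%R -> L m (E g) = 0.
Hypothesis L_E0 : forall g, L 0 (E g) = ((form g g)%:~R / 2) *: E g.
Hypothesis L_EN1 : forall g, L (-1) (E g) = h (to_K K g) (-1) (E g).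
Hypothesis b_norm : form b b = 2.

Let Ll m : {linear V -> V} :=
  HB.pack (L m) (GRing.isLinear.Build K _ _ _ (L m) (L_lin m)).
Let LD m u v : L m (u + v) = L m u + L m v.
Proof. exact: (linearD (Ll m)). Qed.
Let LZ m c v : L m (c *: v) = c *: L m v.
Proof. exact: (linearZZ (Ll m)). Qed.
Let LN m v : L m (- v) = - L m v.
Proof. exact: (linearN (Ll m)). Qed.
Let L0 m : L m 0 = 0.
Proof. exact: (linear0 (Ll m)). Qed.
Let LS m I r (P : pred I) (F : I -> V) :
  L m (\sum_(i <- r | P i) F i) = \sum_(i <- r | P i) L m (F i).
Proof. exact: (linear_sum (Ll m)). Qed.

Let L_h m a l v : L m (h a l v) = h a l (L m v) - l%:~R *: h a (m + l) v.
Proof. by rewrite L_comm addrK. Qed.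

(** The three families L_0, L_m with m > 0 and L_(-1) are needed on the vectors
    Ci z (E c), as these are the values of Y on the e^g. Each formula is proved
    by induction on the exponent, using the recurrence of C. *)
Lemma L0_creation z c :
  L 0 (Ci z (E c)) = (z%:~R + (form c c)%:~R / 2) *: Ci z (E c).
Proof.
case: z => [p|p]; last by rewrite /= L0 scaler0.
elim/ltn_ind: p => p IH; have [->|p0] := posnP p.
  by rewrite /= !C0 L_E0 add0r.
have pn0 : p%:R != 0 :> K by rewrite pnatr_eq0 -lt0n.
apply: (scalerI pn0); rewrite -LZ [p%:R *: Ci _ _](C_rec p) scale1r LS.
rewrite scalerA mulrC -scalerA [p%:R *: Ci _ _](C_rec p) scale1r scaler_sumr.
apply: eq_big_nat => k /andP[k1 kp]; rewrite L_h.
have := IH (p - k)%N ltac:(lia); rewrite /= => ->.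
have -> : (p - k)%N%:~R = p%:R - k%:R :> K by rewrite -pmulrn natrB //; lia.
rewrite hZ add0r rmorphN /= -!pmulrn; lincomb K V.
Qed.

(** The commutator terms b(m - k) with k < m annihilate e^c but not the creation
    exponential: each contributes (b, b) = 2 times k times the same vector, whence
    the term m (m - 1). *)
Lemma L_creation_gt0 (m : nat) z c : (0 < m)%N ->
  L m (Ci z (E c)) = (z - 1 + form b c)%:~R *: Ci (z - m%:Z) (E c).
Proof.
move=> m0; case: z => [p|p]; last first.
  by rewrite /= L0 coef_int_lt0 ?scaler0 //; lia.
elim/ltn_ind: p => p IH; have [->|p0] := posnP p.
  by rewrite /= C0 L_E_gt0 // coef_int_lt0 ?scaler0 //; lia.
have pn0 : p%:R != 0 :> K by rewrite pnatr_eq0 -lt0n.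
apply: (scalerI pn0); rewrite -LZ [p%:R *: Ci p _](C_rec p) scale1r LS.
set X := Ci (p%:Z - m%:Z) (E c).
pose G k := h bK (- k%:Z) (Ci (p%:Z - m%:Z - k%:Z) (E c)).
have -> : \sum_(1 <= k < p.+1) L m (h bK (- k%:Z) (C (p - k)%N (E c))) =
    \sum_(1 <= k < p.+1) (p%:Z - k%:Z - 1 + form b c)%:~R *: G k
    + \sum_(1 <= k < p.+1) k%:R *: h bK (m%:Z - k%:Z) (Ci (p%:Z - k%:Z) (E c)).
  rewrite -big_split; apply: eq_big_nat => k /andP[k1 kp] /=; rewrite L_h.
  have := IH (p - k)%N ltac:(lia); rewrite [Ci _ _]/= => ->.
  rewrite hZ rmorphN scaleNr opprK.
  rewrite (_ : p%:Z - k%:Z = (p - k)%N); last lia.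
  by rewrite /G (_ : p%:Z - m%:Z - k%:Z = (p - k)%N%:Z - m%:Z) //; lia.
have -> : \sum_(1 <= k < p.+1) k%:R *: h bK (m%:Z - k%:Z) (Ci (p%:Z - k%:Z) (E c))
   = (m%:R * (m%:R - 1 + (form b c)%:~R)) *: X
     + \sum_(1 <= k < p.+1) (k%:R + m%:R) *: G k.
  have -> : \sum_(1 <= k < p.+1) k%:R *: h bK (m%:Z - k%:Z) (Ci (p%:Z - k%:Z) (E c))
     = \sum_(1 <= k < (p + m).+1) k%:R *: h bK (m%:Z - k%:Z) (Ci (p%:Z - k%:Z) (E c)).
    rewrite [RHS](big_cat_nat (n := p.+1)) //=; last lia.
    rewrite [X in _ = _ + X]big_nat [X in _ = _ + X]big1 ?addr0 // => k /andP[pk _].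
    rewrite coef_int_lt0; first by rewrite h0 scaler0.
    by lia.
  rewrite [LHS](big_cat_nat (n := m)) //; last by lia.
  rewrite [X in _ + X = _](big_cat_nat (n := m.+1)) //=; last by lia.
  rewrite big_nat1 subrr creation_comm_le0 // h_E0.
  have -> : \sum_(1 <= k < m) k%:R *: h bK (m%:Z - k%:Z) (Ci (p%:Z - k%:Z) (E c)) =
      (m%:R * (m%:R - 1)) *: X.
    have -> : \sum_(1 <= k < m) k%:R *: h bK (m%:Z - k%:Z) (Ci (p%:Z - k%:Z) (E c)) =
        \sum_(1 <= k < m) k%:R *: (2 *: X).
      apply: eq_big_nat => k /andP[k1 km].
      rewrite (_ : m%:Z - k%:Z = (m - k)%N); last lia.
      rewrite creation_comm; last lia.
      rewrite h_E_gt0; last lia.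
      rewrite (_ : p%:Z - k%:Z - _ = p%:Z - m%:Z); last lia.
      rewrite C_0 add0r.
      by rewrite formK_int b_norm.
    elim: (m) m0 => // n IHn _; have [->|n0] := posnP n.
      by rewrite big_geq // subrr mulr0 scale0r.
    rewrite big_nat_recr //= IHn // -natr1; lincomb K V.
  have -> : \sum_(m.+1 <= k < (p + m).+1)
       k%:R *: h bK (m%:Z - k%:Z) (Ci (p%:Z - k%:Z) (E c)) =
      \sum_(1 <= k < p.+1) (k%:R + m%:R) *: G k.
    rewrite -{1}[m.+1]add1n big_addn (_ : ((p + m).+1 - m = p.+1)%N); last lia.
    apply: eq_bigr => k _; rewrite natrD /G.
    congr (_ *: h _ _ (Ci _ _)); lia.
  rewrite CZ formK_int -/X addrA; congr (_ + _); lincomb K V.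
rewrite addrCA [X in _ + X = _](_ : _ =
    (p%:R + m%:R - 1 + (form b c)%:~R) *: \sum_(1 <= k < p.+1) G k); last first.
  rewrite scaler_sumr -big_split; apply: eq_bigr => k _ /=; lincomb K V.
rewrite -creation_rec; last lia.
rewrite -/X; lincomb K V.
Qed.

Let h_commN a d k l v : h a (- k.+1%:Z) (h d (- l.+1%:Z) v) =
  h d (- l.+1%:Z) (h a (- k.+1%:Z) v).
Proof. by rewrite h_comm mulr0n scale0r addr0. Qed.

Lemma LN1_creation z c :
  L (-1) (Ci z (E c)) = (z + 1)%:~R *: Ci (z + 1) (E c)
     - h bK (-1) (Ci z (E c)) + h (to_K K c) (-1) (Ci z (E c)).
Proof.
case: z => [p|[|p]]; last first.
- by rewrite /= !h0 L0 (_ : Negz p.+1 + 1 = Negz p) ?scaler0 ?subr0 ?addr0 //; lia.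
- by rewrite /= !h0 L0 scale0r subr0 addr0.
rewrite (_ : p%:Z + 1 = p.+1); last lia.
elim/ltn_ind: p => p IH; have [->|p0] := posnP p.
  rewrite [_ *: Ci 1 _](C_rec 1) big_nat1 scale1r subnn /= !C0 L_EN1.
  by symmetry; rewrite -[RHS]add0r; congr (_ + _); exact: subrr.
have pn0 : p%:R != 0 :> K by rewrite pnatr_eq0 -lt0n.
apply: (scalerI pn0); rewrite -LZ [p%:R *: Ci p _](C_rec p) scale1r LS.
pose G k := h bK (- k%:Z) (C (p.+1 - k)%N (E c)).
have -> : \sum_(1 <= k < p.+1) L (-1) (h bK (- k%:Z) (C (p - k)%N (E c))) =
    \sum_(1 <= k < p.+2) (p.+1%:R - k%:R) *: G k
    + \sum_(1 <= k < p.+2) (k%:R - 1) *: G k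
    + (h (to_K K c) (-1) (p%:R *: Ci p (E c)) - h bK (-1) (p%:R *: Ci p (E c))).
  rewrite [X in _ = X + _ + _]big_nat_recr //= subrr scale0r addr0.
  rewrite [X in _ = _ + X + _]big_nat_recl //= subrr scale0r add0r.
  rewrite (C_rec p) scale1r !hS -sumrN -!big_split.
  apply: eq_big_nat => k /andP[k1 kp] /=; rewrite L_h.
  have := IH (p - k)%N ltac:(lia); rewrite /= => ->.
  rewrite hD hD hN hZ /G.
  have Ek : k = k.-1.+1 by lia.
  have -> : ((p - k).+1 = p.+1 - k)%N by lia.
  rewrite subSS (_ : -1 + - k%:Z = - k.+1%:Z); last lia.
  rewrite [h bK (- k%:Z) (h bK _ _)](_ : _ = h bK (-1) (h bK (- k%:Z) (C (p - k) (E c))));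
    last by rewrite Ek; exact: (h_commN _ _ _ 0).
  rewrite [h bK (- k%:Z) (h (to_K K c) _ _)](_ : _ =
    h (to_K K c) (-1) (h bK (- k%:Z) (C (p - k) (E c))));
    last by rewrite Ek; exact: (h_commN _ _ _ 0).
  have -> : ((p.+1 - k)%N)%:~R = p.+1%:R - k%:R :> K by rewrite -pmulrn natrB //; lia.
  rewrite -natr1; lincomb K V.
rewrite [X in X + _ = _](_ : _ = p%:R *: \sum_(1 <= k < p.+2) G k); last first.
  rewrite scaler_sumr -big_split; apply: eq_bigr => k _ /=.
  rewrite -natr1; lincomb K V.
have -> : \sum_(1 <= k < p.+2) G k = p.+1%:R *: C p.+1 (E c).
  by rewrite C_rec scale1r.
rewrite !hZ /=; lincomb K V.
Qed.

(** When (b, b) = 2 the field Y is primary of weight one. On e^g this is the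
    comparison of the formulas for L_m on Ci z (E c); both sides have the same
    commutators with the alpha_i(-m), by Y_comm and L_comm. *)
Lemma vertex_primary m n v : (-1 <= m)%R ->
  L m (Y n v) = Y n (L m v) - n%:~R *: Y (m + n) v.
Proof.
move=> m1; move: v n; apply: V_ind => [|c u v Pu Pv|g|i j v Pv] n.
- by rewrite !(Y0, L0) scaler0 subr0.
- by rewrite !(YD, YZ, LD, LZ) Pu Pv; lincomb K V.
- rewrite !Y_E LZ; set z := - n - 1 - form b g.
  have zn : n%:~R = - (z + 1 + form b g)%:~R :> K by rewrite -rmorphN; congr _%:~R; lia.
  case: m m1 => [[|m]|[|//]] _.
  + rewrite L0_creation L_E0 YZ Y_E -/z !add0r -/z zn.
    have -> : form (b + g) (b + g) = 2 + form b g *+ 2 + form g g.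
      by rewrite !(formDl, formDr) b_norm [form g b]formC mulr2n -!addrA.
    lincomb K V; by field.
  + rewrite L_creation_gt0 // L_E_gt0 // Y0 sub0r zn formDr b_norm.
    rewrite (_ : - (m.+1%:Z + n) - 1 - form b g = z - m.+1%:Z); last by rewrite /z; lia.
    lincomb K V.
  + rewrite [Negz 0](_ : _ = -1) // LN1_creation L_EN1 Y_h !Y_E -/z zn.
    rewrite (_ : - (n + -1) - 1 - form b g = z + 1); last by rewrite /z; lia.
    rewrite (_ : - (-1 + n) - 1 - form b g = z + 1); last by rewrite /z; lia.
    rewrite (_ : to_K K (b + g) = bK + to_K K g); last first.
      by apply/matrixP => x y; rewrite !mxE rmorphD.
    rewrite h_addl !hZ formK_int [form g b]formC; lincomb K V.
set a := to_K K (alpha i); set l := Negz j.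
rewrite Y_h LD LN LZ L_h !Pv L_h YD YN YZ !Y_h.
rewrite hD hN hZ.
rewrite (_ : n + (m + l) = m + n + l); last lia.
rewrite (_ : m + (n + l) = m + n + l); last lia.
lincomb K V.
Qed.

End Virasoro.
End Field.
End Creation.
End HeisenbergModule.

(** * The vertex operator of e^b *)

Local Open Scope classical_set_scope.
Lemma fsbig_uniq_seq (V : nmodType) (T : choiceType) (S : set T) (r : seq T)
    (F : T -> V) :
  uniq r -> (forall x, x \in r -> S x) -> (forall x, S x -> x \notin r -> F x = 0) ->
  \sum_(x \in S) F x = \sum_(x <- r) F x.
Proof.
move=> ur rS SF; rewrite [RHS]fsbig_seq //; symmetry; apply: fsbig_widen.
  by move=> x /= /rS.
by move=> x [Sx /negP xr] /=; apply: SF.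
Qed.
Local Close Scope classical_set_scope.

Section VertexOperator.
Variable K : numFieldType.
Local Notation V := (VF K).
Variable b : lattice.

Lemma creation_step_comm j k (v : V) :
  j%:R^-1 *: heis (to_K K b) (- j%:Z) (k%:R^-1 *: heis (to_K K b) (- k%:Z) v) =
  k%:R^-1 *: heis (to_K K b) (- k%:Z) (j%:R^-1 *: heis (to_K K b) (- j%:Z) v).
Proof.
rewrite !heisLZ heis_comm [X in _ + X *: _](_ : _ = 0).
  by rewrite scale0r addr0 [LHS]scalerA [RHS]scalerA mulrC.
by case: eqP => // jk; rewrite (_ : j = 0%N) ?mul0r ?mul0rn //; lia.
Qed.

Lemma annihilation_step_comm j k (v : V) :
  - j%:R^-1 *: heis (to_K K b) j%:Z (- k%:R^-1 *: heis (to_K K b) k%:Z v) =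
  - k%:R^-1 *: heis (to_K K b) k%:Z (- j%:R^-1 *: heis (to_K K b) j%:Z v).
Proof.
rewrite !heisLZ heis_comm [X in _ + X *: _](_ : _ = 0).
  by rewrite scale0r addr0 [LHS]scalerA [RHS]scalerA mulrC.
by case: eqP => // jk; rewrite (_ : j = 0%N) ?mul0r ?mul0rn //; lia.
Qed.

Lemma creation_step_linear (k : nat) :
  linear (fun v : V => k%:R^-1 *: heis (to_K K b) (- k%:Z) v).
Proof.
move=> c u v; rewrite heisLD heisLZ scalerDr; apply: eq_add; last exact: erefl.
exact: scale_swap.
Qed.

Lemma annihilation_step_linear (k : nat) :
  linear (fun v : V => - k%:R^-1 *: heis (to_K K b) k%:Z v).
Proof.
move=> c u v; rewrite heisLD heisLZ scalerDr; apply: eq_add; last exact: erefl.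
exact: scale_swap.
Qed.

Lemma creation_linear m : linear (creation (K := K) b m).
Proof. exact: (exp_coef_linear creation_step_linear). Qed.
Lemma annihilation_linear m : linear (annihilation (K := K) b m).
Proof. exact: (exp_coef_linear annihilation_step_linear). Qed.
Lemma creation0 (v : V) : creation b 0 v = v.
Proof. exact: exp_coef0. Qed.
Lemma annihilation0 (v : V) : annihilation b 0 v = v.
Proof. exact: exp_coef0. Qed.

Lemma creation_recurrence m (v : V) : m%:R *: creation b m v =
  1 *: \sum_(1 <= k < m.+1) heis (to_K K b) (- k%:Z) (creation b (m - k)%N v).
Proof.
rewrite [RHS]scale1r.
apply: etrans (exp_coef_rec creation_step_linear creation_step_comm m v) _.
apply: eq_big_nat => k /andP[k1 _].
by rewrite [LHS]scalerA divff ?scale1r // pnatr_eq0 -lt0n.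
Qed.

Lemma annihilation_recurrence m (v : V) : m%:R *: annihilation b m v =
  -1 *: \sum_(1 <= k < m.+1) heis (to_K K b) k%:Z (annihilation b (m - k)%N v).
Proof.
rewrite [RHS]scaler_sumr.
apply: etrans (exp_coef_rec annihilation_step_linear annihilation_step_comm m v) _.
apply: eq_big_nat => k /andP[k1 _].
by rewrite [LHS]scalerA mulrN divff // pnatr_eq0 -lt0n.
Qed.

Local Notation S := (vertex_sum (creation b) (annihilation b)).

Lemma VF_annihilation_nilpotent (v : V) : eventually (fun N => annihilation b N v = 0).
Proof.
exact: (annihilation_nilpotent (@heis_lin K) (@heis_comm K) (@heis_expQ_gt0 K) (@VF_ind K)
  annihilation_linear annihilation0 annihilation_recurrence).
Qed.

Lemma creation_L0 m : creation (K := K) b m 0 = 0.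
Proof.
have := creation_linear m (-1) 0 0; rewrite scaler0 addr0 => ->.
by rewrite scaleN1r addNr.
Qed.

Local Open Scope classical_set_scope.
Lemma fsbig_vertex_sum (f n : int) M (u : V) : (forall q, (M <= q)%N -> annihilation b q u = 0) ->
  \sum_(pq \in [set pq : nat * nat | pq.1%:Z - pq.2%:Z + f = - n - 1])
     creation b pq.1 (annihilation b pq.2 u) = S (- n - 1 - f) M u.
Proof.
move=> Mq; pose z := - n - 1 - f.
pose r := [seq (absz (z + q%:Z), q) | q <- [seq q <- iota 0 M | 0 <= z + q%:Z]].
rewrite (@fsbig_uniq_seq _ _ _ r).
- rewrite big_map big_filter.
  rewrite /vertex_sum -(big_mkord xpredT (fun q => coef_int (creation b) (z + q%:Z)
     (annihilation b q u))) /index_iota subn0 big_mkcond.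
  by apply: eq_bigr => q _ /=; case: (z + q%:Z).
- rewrite map_inj_uniq ?filter_uniq ?iota_uniq //.
  by move=> q q' [].
- move=> x /mapP[q]; rewrite mem_filter => /andP[zq _] -> /=.
  by rewrite /z in zq *; lia.
- move=> [p q] /= pq nr; rewrite Mq ?creation_L0 // leqNgt; apply: contra nr => qM.
  apply/mapP; exists q; last by congr (_, _); rewrite /z; lia.
  by rewrite mem_filter mem_iota /= add0n qM andbT /z; lia.
Qed.

Lemma Yexp_ketE n s g : Yexp b n (ket K s g) = (eps b g)%:~R *:
  \sum_(pq \in [set pq : nat * nat | pq.1%:Z - pq.2%:Z + form b g = - n - 1])
     creation b pq.1 (annihilation b pq.2 (ket K s (b + g))).
Proof. by rewrite /Yexp /ket linextU. Qed.
Local Close Scope classical_set_scope.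

Lemma Yexp_linear n : linear (Yexp (K := K) b n).
Proof. exact: linearP. Qed.

Lemma Yexp_Z n c (v : V) : Yexp b n (c *: v) = c *: Yexp b n v.
Proof. exact: linearZZ. Qed.

(** On degree g the vertex operator is the shift e^g |-> e^(b+g) followed by a
    vertex_sum. As the shift commutes with heis a k for k != 0 only, it is not made
    an operator: this relation says that u can stand for the shift of v, where v
    is of degree g. *)
Definition vertex_rep g (v u : V) := forall n, eventually (fun M =>
  Yexp b n v = (eps b g)%:~R *: S (- n - 1 - form b g) M u).

Lemma vertex_rep_ket s g : vertex_rep g (ket K s g) (ket K s (b + g)).
Proof.
move=> n; have [N HN] := VF_annihilation_nilpotent (ket K s (b + g)).
exists N => M NM; rewrite Yexp_ketE (@fsbig_vertex_sum _ _ M) // => q Mq.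
by apply: HN; apply: leq_trans Mq.
Qed.

Lemma vertex_sum_lin z M c (u v : V) : S z M (c *: u + v) = c *: S z M u + S z M v.
Proof. exact: (vertex_sum_linear creation_linear annihilation_linear). Qed.

Lemma vertex_sumZ z M c (u : V) : S z M (c *: u) = c *: S z M u.
Proof.
pose Sl : {linear V -> V} := HB.pack (S z M) (GRing.isLinear.Build K _ _ _ _
  (vertex_sum_linear creation_linear annihilation_linear z M)).
exact: (linearZZ Sl).
Qed.

Lemma vertex_rep0 g : vertex_rep g 0 0.
Proof.
move=> n; exists 0%N => M _; rewrite [LHS]linear0.
by rewrite /vertex_sum [X in _ *: X]big1 ?scaler0 // => q _;
  have := annihilation_linear q (-1) 0 0; rewrite scaler0 addr0 scaleN1r addNr => ->;
  case: (_ + _) => // p; rewrite /= creation_L0.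
Qed.

Lemma vertex_rep_lin g c v u v' u' : vertex_rep g v u -> vertex_rep g v' u' ->
  vertex_rep g (c *: v + v') (c *: u + u').
Proof.
move=> H H' n; apply: eventually_mono (eventually_and (H n) (H' n)) => M [E E'].
rewrite Yexp_linear E E' vertex_sum_lin [RHS]scalerDr; apply: eq_add; last exact: erefl.
exact: scale_swap.
Qed.

Lemma vertex_rep_heis a k s g : k != 0 ->
  vertex_rep g (heis a k (ket K s g)) (heis a k (ket K s (b + g))).
Proof.
have RS I (r : seq I) (c : I -> K) (F : I -> V) F' :
    (forall i, vertex_rep g (F i) (F' i)) ->
  vertex_rep g (\sum_(i <- r) c i *: F i) (\sum_(i <- r) c i *: F' i).
  move=> HF; apply: (big_ind2 (vertex_rep g)); first exact: vertex_rep0.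
    move=> u u' w w' Hu Hw; rewrite -[u]scale1r -[u']scale1r.
    exact: vertex_rep_lin.
  move=> i _; rewrite -[_ *: F i]addr0 -[_ *: F' i]addr0.
  apply: vertex_rep_lin; [exact: HF | exact: vertex_rep0].
case: k => [[|k]|k] // _.
- rewrite [X in vertex_rep g X]heis_ketP [X in vertex_rep g _ X]heis_ketP.
  by apply: RS => i; exact: vertex_rep_ket.
- rewrite [X in vertex_rep g X]heis_ketN [X in vertex_rep g _ X]heis_ketN.
  by apply: RS => i; exact: vertex_rep_ket.
Qed.

Lemma Yexp_expQ n g : Yexp b n (expQ K g) =
  (eps b g)%:~R *: coef_int (creation b) (- n - 1 - form b g) (expQ K (b + g)).
Proof.
have [N HN] := vertex_rep_ket (onecm _) g n; rewrite -/(expQ K g) -/(expQ K (b + g)) in HN.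
rewrite (HN N.+1 (leqnSn N)); apply: eq_scale; first exact: erefl.
exact: (vertex_sum_E (@heis_lin K) (@heis_expQ_gt0 K) creation_linear annihilation0
   annihilation_recurrence).
Qed.

(** For k != 0 the shift commutes with heis a k, and the extra term comes from
    one of the two exponentials. For k = 0 the exponentials commute with heis a 0
    and the extra term comes from the shift of the degree. *)
Lemma Yexp_comm a k n (v : V) : heis a k (Yexp b n v) =
  Yexp b n (heis a k v) + formK a (to_K K b) *: Yexp b (n + k) v.
Proof.
move: v; apply: ket_ext => [c u v|c u v|s g].
- by rewrite Yexp_linear heisLD heisLZ.
- rewrite heisLD heisLZ !Yexp_linear [in LHS]scalerDr addrACA; apply: eq_add; last exact: erefl.
  rewrite [RHS]scalerDr; apply: eq_add; first exact: erefl.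
  exact: scale_swap.
have Hv := vertex_rep_ket s g.
have [k0|[->|k0]] : (0 < k)%R \/ k = 0 \/ (k < 0)%R by lia.
- have Hk := vertex_rep_heis a s g (lt0r_neq0 k0).
  have [N H] := eventually_and (Hv n) (eventually_and (Hv (n + k)) (Hk n)).
  have [-> [-> ->]] := H N (leqnn N).
  rewrite heisLZ; case: k k0 {Hk H} => [k|//] k0.
  rewrite (vertex_sum_comm_gt0 (@heis_lin K) (@heis_comm K)
    creation0 creation_recurrence annihilation0 annihilation_recurrence _ _ _ _ k0).
  rewrite (_ : - (n + k%:Z) - 1 - form b g = - n - 1 - form b g - k%:Z); last lia.
  rewrite [LHS]scalerDr; apply: eq_add; first exact: erefl.
  exact: scale_swap.
- have [N H] := Hv n; rewrite addr0 heis_ket0 Yexp_Z (H N (leqnn N)) heisLZ.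
  rewrite (vertex_sum_comm0 (@heis_lin K) (@heis_comm K)
    creation0 creation_recurrence annihilation0 annihilation_recurrence).
  rewrite heis_ket0 [to_K K (b + g)](_ : _ = to_K K b + to_K K g); last first.
    by apply/matrixP => x y; rewrite !mxE rmorphD.
  rewrite formKDr vertex_sumZ; move: (S _ _ _) => w.
  lincomb K (VF K).
- have [k' kk' k'0] : exists2 k' : nat, k = - k'%:Z & (0 < k')%N.
    by case: k k0 => // k' _; exists k'.+1.
  rewrite {k k0}kk'.
  have k'n : - k'%:Z != 0 by lia.
  have [N H] := eventually_and (Hv n)
    (eventually_and (Hv (n - k'%:Z)) (vertex_rep_heis a s g k'n n)).
  have [-> [_ ->]] := H (N + k')%N (leq_addr _ _).
  have [_ [-> _]] := H N (leqnn N).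
  rewrite heisLZ.
  rewrite (vertex_sum_comm_lt0 (@heis_lin K) (@heis_comm K) creation_linear
    creation0 creation_recurrence annihilation0 annihilation_recurrence _ _ _ _ k'0).
  rewrite (_ : - (n - k'%:Z) - 1 - form b g = - n - 1 - form b g + k'%:Z); last lia.
  rewrite [LHS]scalerDr; apply: eq_add; first exact: erefl.
  exact: scale_swap.
Qed.
End VertexOperator.

(** * Normally ordered products *)

Section NormalOrder.
Variables (K : numFieldType) (V : lmodType K).
Variables (h : 'rV[K]_3 -> int -> V -> V) (d : nat -> int -> K).
Hypothesis h_lin : forall a k, linear (h a k).
Hypothesis h_comm : forall a b k l v, h a k (h b l v) =
  h b l (h a k v) + (k%:~R * formK a b *+ (k + l == 0)) *: v.
Hypothesis h_nilp : forall v, eventually (fun N => forall a, h a N%:Z v = 0).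

Let hl a k : {linear V -> V} :=
  HB.pack (h a k) (GRing.isLinear.Build K _ _ _ (h a k) (h_lin a k)).
Let hZ a k c v : h a k (c *: v) = c *: h a k v.
Proof. exact: (linearZZ (hl a k)). Qed.
Let hD a k u v : h a k (u + v) = h a k u + h a k v.
Proof. exact: (linearD (hl a k)). Qed.
Let h0 a k : h a k 0 = 0.
Proof. exact: (linear0 (hl a k)). Qed.
Let hS a k I r (P : pred I) (F : I -> V) :
  h a k (\sum_(i <- r | P i) F i) = \sum_(i <- r | P i) h a k (F i).
Proof. exact: (linear_sum (hl a k)). Qed.

Implicit Types B : int -> V -> V.

(** The second condition makes B(z) v a Laurent series in z. *)
Definition is_field B := (forall n, linear (B n)) /\
  (forall v, exists N : int, forall n, (N <= n)%R -> B n v = 0).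

(** The n-th mode of the normally ordered product of a^(m)(z) and B(z), with the
    first M terms of each of its two halves; d m k is the coefficient of a(k) in
    a^(m)(z). *)
Definition normal_sum a (m M : nat) B n v : V :=
  \sum_(j < M) d m (- j.+1%:Z) *: h a (- j.+1%:Z) (B (n + j%:Z - m%:Z) v)
  + \sum_(j < M) d m j%:Z *: B (n - j%:Z - m%:Z - 1) (h a j%:Z v).

Definition is_normal_product a m B B' :=
  forall n v, eventually (fun M => B' n v = normal_sum a m M B n v).

Lemma normal_sum_linear a m M B n : (forall n, linear (B n)) ->
  linear (normal_sum a m M B n).
Proof.
move=> Blin c u v; rewrite /normal_sum scalerDr addrACA !scaler_sumr -!big_split.
apply: eq_bigr => j _ /=; rewrite (h_lin _ _ c) !Blin hD hZ; lincomb K V.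
Qed.

(** An explicit bound from which the truncation is exact: both halves stop when
    the a(j) and the modes of B have run out on v. *)
Lemma normal_product_exact a m B B' M n v : is_normal_product a m B B' ->
  (forall n, linear (B n)) ->
  (forall j : nat, (M <= j)%N -> h a j v = 0) ->
  (forall r, (n + M%:Z - m%:Z <= r)%R -> B r v = 0) ->
  B' n v = normal_sum a m M B n v.
Proof.
move=> H Blin hv Bv; have [N HN] := H n v.
have B0 r : B r 0 = 0.
  by have := Blin r (-1) 0 0; rewrite scaler0 addr0 scaleN1r addNr.
rewrite (HN (M + N)%N (leq_addl _ _)) /normal_sum !big_split_ord /=.
congr (_ + _).
  rewrite [X in _ + X]big1 ?addr0 // => j _.
  by rewrite Bv ?h0 ?scaler0 //; lia.
rewrite [X in _ + X]big1 ?addr0 // => j _.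
by rewrite hv ?B0 ?scaler0 //; lia.
Qed.

Let lin0 (f : V -> V) : linear f -> f 0 = 0.
Proof.
move=> flin; have := flin (-1) 0 0.
by rewrite scaler0 addr0 scaleN1r addNr.
Qed.

Lemma field_heis_bound B a v : is_field B ->
  exists N : int, forall r (j : nat), (N <= r)%R -> B r (h a j%:Z v) = 0.
Proof.
move=> [Blin Bv]; have [n hn] := h_nilp v.
suff [N HN] : exists N : int, forall r (j : nat), (j < n)%N -> (N <= r)%R ->
    B r (h a j%:Z v) = 0.
  exists N => r j Nr; have [jn|nj] := ltnP j n; first exact: HN.
  by rewrite hn // lin0.
elim: n {hn} => [|n [N HN]]; first by exists 0.
have [N' HN'] := Bv (h a n%:Z v).
exists (Num.max N N') => r j; rewrite ltnS leq_eqVlt ge_max => /orP[/eqP->|jn] /andP[Nr N'r].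
  exact: HN'.
exact: HN.
Qed.

Lemma normal_product_field a m B B' : is_field B -> (forall n, linear (B' n)) ->
  is_normal_product a m B B' -> is_field B'.
Proof.
move=> FB B'lin H; split=> // v; have [Blin Bv] := FB.
have [n0 hn] := h_nilp v; have [N1 HN1] := Bv v.
have [N2 HN2] := field_heis_bound a v FB.
exists (Num.max (N1 + m%:Z) (N2 + m%:Z + n0%:Z + 1)) => n; rewrite ge_max => /andP[n1 n2].
rewrite (normal_product_exact (M := n0) H) //; first last.
- by move=> r nr; apply: HN1; lia.
- by move=> j nj; apply: hn.
rewrite /normal_sum !big1 ?addr0 // => j _.
  by rewrite HN2 ?scaler0 //; have := ltn_ord j; lia.
by rewrite HN1 ?h0 ?scaler0 //; lia.
Qed.

(** Expanding an iterated normally ordered product gives four double sums, by the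
    sides on which the modes of the two factors stand; this form is symmetric up
    to the commutation of modes of the same sign. *)
Definition normal_sum2 a' m' a m M B n v : V :=
  \sum_(j < M) \sum_(l < M) (d m' (- j.+1%:Z) * d m (- l.+1%:Z)) *:
     h a' (- j.+1%:Z) (h a (- l.+1%:Z) (B (n + j%:Z + l%:Z - m%:Z - m'%:Z) v))
  + \sum_(j < M) \sum_(l < M) (d m' (- j.+1%:Z) * d m l%:Z) *:
     h a' (- j.+1%:Z) (B (n + j%:Z - l%:Z - m%:Z - m'%:Z - 1) (h a l%:Z v))
  + (\sum_(j < M) \sum_(l < M) (d m' j%:Z * d m (- l.+1%:Z)) *:
     h a (- l.+1%:Z) (B (n - j%:Z + l%:Z - m%:Z - m'%:Z - 1) (h a' j%:Z v))
  + \sum_(j < M) \sum_(l < M) (d m' j%:Z * d m l%:Z) *: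
     B (n - j%:Z - l%:Z - m%:Z - m'%:Z - 2) (h a l%:Z (h a' j%:Z v))).

Let h_commN a b (j l : nat) v : h a (- j.+1%:Z) (h b (- l.+1%:Z) v) =
  h b (- l.+1%:Z) (h a (- j.+1%:Z) v).
Proof. by rewrite h_comm mulr0n scale0r addr0. Qed.

Let h_commP a b (j l : nat) v : h a j%:Z (h b l%:Z v) = h b l%:Z (h a j%:Z v).
Proof.
rewrite h_comm; case: eqP => [jl|_]; last by rewrite mulr0n scale0r addr0.
by rewrite (_ : j = 0%N) ?mul0r ?mul0rn ?scale0r ?addr0 //; lia.
Qed.

Lemma normal_sum2C a' m' a m M B n v :
  normal_sum2 a' m' a m M B n v = normal_sum2 a m a' m' M B n v.
Proof.
rewrite /normal_sum2.
have addr4 (x1 x2 x3 x4 y1 y2 y3 y4 : V) : x1 = y1 -> x2 = y3 -> x3 = y2 -> x4 = y4 ->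
    x1 + x2 + (x3 + x4) = y1 + y2 + (y3 + y4).
  by move=> -> -> -> ->; rewrite addrACA.
apply: addr4; rewrite [LHS]exchange_big; apply: eq_bigr => j _; apply: eq_bigr => l _.
- by rewrite mulrC h_commN; congr (_ *: h _ _ (h _ _ (B _ _))); lia.
- by rewrite mulrC; congr (_ *: h _ _ (B _ _)); lia.
- by rewrite mulrC; congr (_ *: h _ _ (B _ _)); lia.
- by rewrite mulrC h_commP; congr (_ *: B _ _); lia.
Qed.

Lemma normal_product2 a' m' a m B B1 C : is_field B -> (forall n, linear (B1 n)) ->
  is_normal_product a m B B1 -> is_normal_product a' m' B1 C ->
  forall n v, eventually (fun M => C n v = normal_sum2 a' m' a m M B n v).
Proof.
move=> FB B1lin H1 HC n v; have [Blin Bv] := FB.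
have [n0 hn] := h_nilp v; have [N1 HN1] := Bv v.
have [N2 HN2] := field_heis_bound a v FB.
have [N3 HN3] := field_heis_bound a' v FB.
pose N := Num.max N1 (Num.max N2 N3).
have [NN1 NN2 NN3] : [/\ N1 <= N, N2 <= N & N3 <= N].
  by rewrite /N !le_max !lexx !orbT.
exists (n0 + absz N + absz n + m + m' + n0 + 4)%N => M HM.
have HMn : (n0 <= M)%N by lia.
have HMN : (N <= n + M%:Z - n0%:Z - m%:Z - m'%:Z - 2)%R by lia.
have E1 r : (n - m'%:Z <= r)%R -> B1 r v = normal_sum a m M B r v.
  move=> nr; apply: normal_product_exact => // [j Mj|s rs].
    by apply: hn; lia.
  by apply: HN1; lia.
have E2 r (j : nat) : (n - n0%:Z - m'%:Z - 1 <= r)%R ->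
   B1 r (h a' j%:Z v) = normal_sum a m M B r (h a' j%:Z v).
  move=> nr; apply: normal_product_exact => // [l Ml|s rs].
    rewrite h_comm hn ?h0 ?add0r; last lia.
    case: eqP => [|_]; last by rewrite mulr0n scale0r.
    by move=> lj; rewrite (_ : l = 0%N) ?mul0r ?mul0rn ?scale0r //; lia.
  by apply: HN3; lia.
rewrite (normal_product_exact (M := M) HC) //; first last.
- move=> r nr; rewrite E1; last lia.
  rewrite /normal_sum !big1 ?addr0 // => j _.
    have [jn|nj] := ltnP j n0; last by rewrite hn // lin0 ?scaler0.
    by rewrite HN2 ?scaler0 //; lia.
  by rewrite HN1 ?h0 ?scaler0 //; lia.
- by move=> j Mj; apply: hn; lia.
rewrite /normal_sum /normal_sum2; congr (_ + _).
  rewrite -big_split; apply: eq_bigr => j _.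
  rewrite E1; last lia.
  rewrite /normal_sum hD !hS scalerDr !scaler_sumr; congr (_ + _); apply: eq_bigr => l _.
    rewrite hZ scalerA; congr (_ *: h _ _ (h _ _ (B _ _))); lia.
  rewrite hZ scalerA; congr (_ *: h _ _ (B _ _)); lia.
rewrite -big_split; apply: eq_bigr => j _.
have [jn|nj] := ltnP j n0; last first.
  have hj : h a' j%:Z v = 0 by apply: hn.
  rewrite hj lin0 // scaler0 !big1 /= ?addr0 // => l _; first by rewrite h0 lin0 ?scaler0.
  by rewrite lin0 // h0 scaler0.
rewrite E2; last lia.
rewrite /normal_sum scalerDr !scaler_sumr; congr (_ + _); apply: eq_bigr => l _.
  rewrite scalerA; congr (_ *: h _ _ (B _ _)); lia.
rewrite scalerA; congr (_ *: B _ _); lia.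
Qed.

(** Normally ordered products do not depend on the order of the factors, by the
    symmetry of their double expansion. *)
Lemma normal_productC a' m' a m B B1 B2 C D : is_field B ->
  (forall n, linear (B1 n)) -> (forall n, linear (B2 n)) ->
  is_normal_product a m B B1 -> is_normal_product a' m' B1 C ->
  is_normal_product a' m' B B2 -> is_normal_product a m B2 D ->
  forall n v, C n v = D n v.
Proof.
move=> FB L1 L2 H1 HC H2 HD n v.
have [M HM] := eventually_and (normal_product2 FB L1 H1 HC n v)
  (normal_product2 FB L2 H2 HD n v).
by have [-> ->] := HM M (leqnn M); rewrite normal_sum2C.
Qed.

Lemma normal_product_lin a m c B B' C C' :
  is_normal_product a m B B' -> is_normal_product a m C C' ->
  is_normal_product a m (fun n v => c *: B n v + C n v)
    (fun n v => c *: B' n v + C' n v).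
Proof.
move=> HB HC n v; apply: eventually_mono (eventually_and (HB n v) (HC n v)).
move=> M [-> ->]; rewrite /normal_sum scalerDr addrACA !scaler_sumr -!big_split.
by apply: eq_bigr => j _ /=; rewrite hD hZ; lincomb K V.
Qed.

(** The vacuum field has a single nonzero mode, which selects the term a(n) in one
    of the two halves. *)
Lemma normal_product_id a B' : (forall k, d 0 k = 1) ->
  is_normal_product a 0 (fun n v => (n == -1)%:R *: v) B' ->
  forall n v, B' n v = h a n v.
Proof.
move=> d0 H n v; have [M HM] := H n v.
rewrite (HM (M + (absz n).+1)%N (leq_addr _ _)) /normal_sum.
set N := (M + (absz n).+1)%N; have [n0|n0] := leP 0 n.
  have [p np] : exists p : nat, n = p by exists (absz n); lia.
  have pN : (p < N)%N by lia.
  rewrite [X in X + _]big1 ?add0r => [|j _]; last first.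
    by rewrite (_ : (_ == _) = false) ?scale0r ?h0 ?scaler0 //; apply/eqP; lia.
  rewrite (bigD1 (Ordinal pN)) // big1 => [|j jp].
    rewrite [nat_of_ord _]/= np d0 (_ : (_ == _) = true) ?scale1r; last by apply/eqP; lia.
    exact: addr0.
  rewrite (_ : (_ == _) = false) ?scale0r ?scaler0 //.
  apply/eqP => nj; case/eqP: jp; apply: val_inj => /=; lia.
have [p np] : exists p : nat, n = - p.+1%:Z by exists (absz n).-1; lia.
have pN : (p < N)%N by lia.
rewrite [X in _ + X]big1 ?addr0 => [|j _]; last first.
  by rewrite (_ : (_ == _) = false) ?scale0r ?scaler0 //; apply/eqP; lia.
rewrite (bigD1 (Ordinal pN)) // big1 => [|j jp].
  rewrite [nat_of_ord _]/= np d0 (_ : (_ == _) = true) ?scale1r; last by apply/eqP; lia.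
  exact: addr0.
rewrite (_ : (_ == _) = false) ?scale0r ?h0 ?scaler0 //.
apply/eqP => nj; case/eqP: jp; apply: val_inj => /=; lia.
Qed.

Lemma normal_sum_linl a b c m M B n v : (forall n, linear (B n)) ->
  (forall k v, h (c *: a + b) k v = c *: h a k v + h b k v) ->
  normal_sum (c *: a + b) m M B n v =
  c *: normal_sum a m M B n v + normal_sum b m M B n v.
Proof.
move=> Blin hab; rewrite /normal_sum scalerDr addrACA !scaler_sumr -!big_split.
by apply: eq_bigr => j _ /=; rewrite !hab Blin; lincomb K V.
Qed.

Lemma normal_sum_weight1 a M B n v : (forall k, d 0 k = 1) ->
  normal_sum a 0 M B n v = \sum_(j < M)
    (h a (- j.+1%:Z) (B (n + j%:Z) v) + B (n - j.+1%:Z) (h a j%:Z v)).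
Proof.
move=> d0; rewrite /normal_sum -big_split; apply: eq_bigr => j _ /=.
rewrite !d0 !scale1r subr0; congr (_ + B _ _); lia.
Qed.

Definition translate B : int -> V -> V := fun n v => - n%:~R *: B (n - 1) v.

(** Leibniz rule for d/dz on a normally ordered product: the derivative of
    a^(m)(z) is (m + 1) a^(m+1)(z). *)
Lemma normal_product_translate a m B B' X Z :
  (forall k, m.+1%:R * d m.+1 k = (- k - 1 - m%:Z)%:~R * d m k) ->
  is_normal_product a m B B' -> is_normal_product a m (translate B) X ->
  is_normal_product a m.+1 B Z ->
  forall n v, X n v + m.+1%:R *: Z n v = translate B' n v.
Proof.
move=> dS HB HX HZ n v.
have [M HM] := eventually_and (HB (n - 1) v) (eventually_and (HX n v) (HZ n v)).
rewrite /translate; have [-> [-> ->]] := HM M (leqnn M).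
rewrite /normal_sum !scalerDr addrACA !scaler_sumr -!big_split.
apply: eq_bigr => j _; rewrite /translate /= !scalerA !dS hZ.
rewrite (_ : n + j%:Z - m.+1%:Z = n - 1 + j%:Z - m%:Z); last lia.
rewrite (_ : n + j%:Z - m%:Z - 1 = n - 1 + j%:Z - m%:Z); last lia.
rewrite (_ : n - j%:Z - m.+1%:Z - 1 = n - 1 - j%:Z - m%:Z - 1); last lia.
rewrite (_ : n - j%:Z - m%:Z - 1 - 1 = n - 1 - j%:Z - m%:Z - 1); last lia.
lincomb K V.
Qed.
End NormalOrder.

(** * The fields of the states *)

Section StateField.
Variable K : numFieldType.
Local Notation V := (VF K).
Implicit Types (B : modes K) (x : 'I_3 * nat).

Lemma dcoef0 k : dcoef K 0 k = 1.
Proof. by rewrite /dcoef big_ord0 fact0 divr1. Qed.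

Lemma dcoefS m k :
  m.+1%:R * dcoef K m.+1 k = (- k - 1 - m%:Z)%:~R * dcoef K m k.
Proof.
rewrite /dcoef big_ord_recr /= rmorphM /= factS natrM invfM.
have m1 : m.+1%:R != 0 :> K by rewrite pnatr_eq0.
have fm : m`!%:R != 0 :> K by rewrite pnatr_eq0 -lt0n fact_gt0.
by field; rewrite fm nat1r m1.
Qed.

Lemma linear_at0 (W : lmodType K) (f : W -> W) : linear f -> f 0 = 0.
Proof.
move=> flin; have := flin (-1) 0 0.
by rewrite scaler0 addr0 scaleN1r addNr.
Qed.

Lemma VF_nilpotent (v : V) : eventually (fun N => forall a, heis a N%:Z v = 0).
Proof.
exact: (heis_nilpotent (@heis_lin K) (@heis_comm K) (@heis_expQ_gt0 K) (@VF_ind K)).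
Qed.

Lemma ket_ind (P : V -> Prop) : P 0 ->
  (forall c u v, P u -> P v -> P (c *: u + v)) ->
  (forall s g, P (ket K s g)) -> forall v, P v.
Proof.
move=> P0 PL PK v; rewrite [v]ketE; elim/big_ind: _ => // [u w Pu Pw|[s g] _].
  by rewrite -[u]scale1r; apply: PL.
by rewrite -[X in P X]addr0; apply: PL.
Qed.

Local Open Scope classical_set_scope.
Lemma normord_ketE x B n s g : normord x B n (ket K s g) =
    \sum_(k \in [set k : int | (k < 0)%R])
      dcoef K x.2 k *: heis (to_K K (alpha x.1)) k (B (n - k - x.2%:Z - 1) (ket K s g))
    + \sum_(k \in [set k : int | (0 <= k)%R])
      dcoef K x.2 k *: B (n - k - x.2%:Z - 1) (heis (to_K K (alpha x.1)) k (ket K s g)).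
Proof. by rewrite /normord /ket linextU. Qed.
Local Close Scope classical_set_scope.

Local Notation normal_product x :=
  (is_normal_product (@heis K) (dcoef K) (to_K K (alpha x.1)) x.2).

Lemma normord_linear x B n : linear (normord x B n).
Proof. exact: linearP. Qed.

(** Links the infinite sums in normord with their truncations. *)
Lemma normord_product x B : is_field B -> normal_product x B (normord x B).
Proof.
move=> [Blin Bv] n v; move: v; apply: ket_ind => [|c u v [M HM] [N HN]|s g].
- exists 0%N => M _; rewrite (linear_at0 (normord_linear x B n)); symmetry.
  exact: linear_at0 (normal_sum_linear (dcoef K) (@heis_lin K) _ _ _ _ Blin).
- exists (maxn M N) => P; rewrite geq_max => /andP[MP NP].
  rewrite normord_linear (HM P MP) (HN P NP); symmetry.
  exact: (normal_sum_linear (dcoef K) (@heis_lin K) _ _ _ _ Blin).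
have [N HN] := VF_nilpotent (ket K s g); have [N1 HN1] := Bv (ket K s g).
exists (N + absz (N1 - n + x.2%:Z)%R)%N => M NM.
rewrite normord_ketE /normal_sum; apply: eq_add.
  rewrite (@fsbig_uniq_seq _ _ _ [seq Negz j | j <- iota 0 M]).
  - rewrite big_map -(big_mkord xpredT (fun j => dcoef K x.2 (- j.+1%:Z) *:
       heis (to_K K (alpha x.1)) (- j.+1%:Z) (B (n + j%:Z - x.2%:Z) (ket K s g)))).
    rewrite /index_iota subn0; apply: eq_bigr => j _.
    rewrite (_ : n - Negz j - x.2%:Z - 1 = n + j%:Z - x.2%:Z); last lia.
    exact: erefl.
  - by rewrite map_inj_uniq ?iota_uniq // => i j [].
  - by move=> k /mapP[j _ ->].
  - move=> k /= k0 kM; rewrite HN1 ?heisL0 ?scaler0 //.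
    case: k k0 kM => // k _ kM; have {kM} : (M <= k)%N.
      rewrite leqNgt; apply: contra kM => kM; apply/mapP; exists k => //.
      by rewrite mem_iota.
    lia.
rewrite (@fsbig_uniq_seq _ _ _ [seq Posz j | j <- iota 0 M]).
- rewrite big_map -(big_mkord xpredT (fun j => dcoef K x.2 j%:Z *:
     B (n - j%:Z - x.2%:Z - 1) (heis (to_K K (alpha x.1)) j%:Z (ket K s g)))).
  rewrite /index_iota subn0; exact: erefl.
- by rewrite map_inj_uniq ?iota_uniq // => i j [].
- by move=> k /mapP[j _ ->].
- move=> k /= k0 kM; case: k k0 kM => // k _ kM; rewrite HN.
    by rewrite (linear_at0 (Blin _)) scaler0.
  have {kM} : (M <= k)%N.
    rewrite leqNgt; apply: contra kM => kM; apply/mapP; exists k => //.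
    by rewrite mem_iota.
  lia.
Qed.

Lemma normord_field x B : is_field B -> is_field (normord x B).
Proof.
move=> FB; apply: (normal_product_field (@heis_lin K) VF_nilpotent FB (normord_linear x B)).
exact: normord_product.
Qed.

Lemma normordC x y B : is_field B ->
  normord x (normord y B) = normord y (normord x B).
Proof.
move=> FB; apply/funext => n; apply/funext => v.
apply: (normal_productC (@heis_lin K) (@heis_comm K) VF_nilpotent FB
  (normord_linear y B) (normord_linear x B)); apply: normord_product => //;
  exact: normord_field.
Qed.

Lemma Yexp_field b : is_field (Yexp (K := K) b).
Proof.
split; first exact: Yexp_linear.
apply: VF_ind => [|c u v [M HM] [N HN]|g|i m v [N HN]].
- by exists 0 => n _; rewrite (linear_at0 (Yexp_linear b n)).
- exists (Num.max M N) => n; rewrite ge_max => /andP[Mn Nn].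
  by rewrite Yexp_linear HM // HN // scaler0 addr0.
- exists (- form b g) => n bn; rewrite Yexp_expQ coef_int_lt0 ?scaler0 //; lia.
- exists (N + m.+1%:Z) => n Nn.
  have := Yexp_comm b (to_K K (alpha i)) (Negz m) n v.
  rewrite !HN ?heisL0 ?scaler0 ?addr0; [exact: esym | lia | lia].
Qed.

Definition normord_seq b l : modes K := foldr (@normord K) (Yexp b) l.

Lemma normord_seq_field b l : is_field (normord_seq b l).
Proof. by elim: l => [|x l IH]; [exact: Yexp_field | exact: normord_field]. Qed.

Lemma normord_seq_perm b l l' : perm_eq l l' -> normord_seq b l = normord_seq b l'.
Proof.
elim: l l' => [|x l IH] l' ll'.
  by move: ll'; rewrite perm_sym => /perm_nilP ->.
have /splitPr xl : x \in l' by rewrite -(perm_mem ll') mem_head.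
case: xl ll' => p q ll'; have {ll'}/IH : perm_eq l (p ++ q).
  rewrite -(perm_cons x); apply: perm_trans ll' _.
  by rewrite -[x :: q]cat1s perm_catCA.
rewrite -[normord_seq b (x :: l)]/(normord x (normord_seq b l)) => ->.
elim: p => [|y p IHp]; first exact: erefl.
rewrite -[normord_seq b ((y :: p) ++ q)]/(normord y (normord_seq b (p ++ q))).
rewrite -[normord_seq b ((y :: p) ++ x :: q)]/(normord y (normord_seq b (p ++ x :: q))).
rewrite (normordC _ _ (normord_seq_field b (p ++ q))) IHp; exact: erefl.
Qed.

Lemma count_factors (s : mono) y : count_mem y (factors s) = s y.
Proof.
rewrite /factors count_flatten -map_comp sumnE big_map.
rewrite (eq_bigr (fun z => (z == y) * s z)%N) => [|z _]; last first.
  by rewrite /= count_nseq.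
have [ys|ys] := boolP (y \in finsupp s).
  rewrite (big_fsetD1 y) //= eqxx mul1n big1_fset ?addn0 // => z.
  by rewrite in_fsetD1 => /andP[/negPf->].
rewrite big_seq big1 => [|z zs].
  by apply/esym/eqP; rewrite cmE_eq0.
by case: eqP zs ys => // -> ->.
Qed.

Lemma perm_factors x (s : mono) : perm_eq (factors (mulcm (ucm x) s)) (x :: factors s).
Proof.
apply/allP => y _ /=; apply/eqP.
by rewrite !count_factors mulcmE ucmE.
Qed.

Lemma Ymode_ket s g n w : Ymode (ket K s g) n w = normord_seq g (factors s) n w.
Proof. by rewrite /Ymode /ket linextU. Qed.
End StateField.

(** * The Sugawara construction *)

Section Sugawara.
Variables (K : numFieldType) (V : lmodType K).
Variables (h : 'rV[K]_3 -> int -> V -> V) (E : lattice -> V).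
Hypothesis h_lin : forall a k, linear (h a k).
Hypothesis h_comm : forall a b k l v, h a k (h b l v) =
  h b l (h a k v) + (k%:~R * formK a b *+ (k + l == 0)) *: v.
Hypothesis h_addl : forall a b k v, h (a + b) k v = h a k v + h b k v.
Hypothesis h_scalel : forall c a k v, h (c *: a) k v = c *: h a k v.
Hypothesis h_E_gt0 : forall a k g, (0 < k)%R -> h a k (E g) = 0.
Hypothesis h_E0 : forall a g, h a 0 (E g) = formK a (to_K K g) *: E g.

Let hl a k : {linear V -> V} :=
  HB.pack (h a k) (GRing.isLinear.Build K _ _ _ (h a k) (h_lin a k)).
Let hZ a k c v : h a k (c *: v) = c *: h a k v.
Proof. exact: (linearZZ (hl a k)). Qed.
Let hD a k u v : h a k (u + v) = h a k u + h a k v.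
Proof. exact: (linearD (hl a k)). Qed.
Let h0 a k : h a k 0 = 0.
Proof. exact: (linear0 (hl a k)). Qed.
Let hS a k I r (P : pred I) (F : I -> V) :
  h a k (\sum_(i <- r | P i) F i) = \sum_(i <- r | P i) h a k (F i).
Proof. exact: (linear_sum (hl a k)). Qed.

Lemma delta_sum M (z : int) : (absz z < M)%N ->
  \sum_(j < M) ((z == - j.+1%:Z)%:R + (z == j%:Z)%:R) = 1 :> K.
Proof.
have [z0 zM|z0 zM] := leP 0 z.
  have [p zp] : exists p : nat, z = p by exists (absz z); lia.
  have pM : (p < M)%N by lia.
  rewrite (bigD1 (Ordinal pM)) // big1 => [|j jp].
    rewrite [nat_of_ord _]/= zp eqxx (_ : (_ == - _) = false) ?add0r; first exact: addr0.
    by apply/eqP; lia.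
  rewrite zp (_ : (_ == - _) = false) ?add0r; last by apply/eqP; lia.
  by case: eqP => // -[pj]; case/eqP: jp; apply: val_inj.
have [p zp] : exists p : nat, z = - p.+1%:Z by exists (absz z).-1; lia.
have pM : (p < M)%N by lia.
rewrite (bigD1 (Ordinal pM)) // big1 => [|j jp].
  rewrite [nat_of_ord _]/= zp eqxx (_ : (_ == p%:Z) = false) ?addr0; first exact: addr0.
  by apply/eqP; lia.
rewrite zp (_ : (_ == j%:Z) = false) ?addr0; last by apply/eqP; lia.
by case: eqP => // pj; case/eqP: jp; apply: val_inj => /=; lia.
Qed.

Variables (al w : 'I_3 -> 'rV[K]_3).
Hypothesis al_w : forall a, \sum_i formK a (al i) *: w i = a.
Hypothesis w_al : forall a, \sum_i formK a (w i) *: al i = a.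

Let h_sum (c : 'I_3 -> K) (b : 'I_3 -> 'rV[K]_3) k v :
  h (\sum_i c i *: b i) k v = \sum_i c i *: h (b i) k v.
Proof. by rewrite !big_ord_recr !big_ord0 /= !add0r !h_addl !h_scalel. Qed.

(** Normally ordered half sum of the al_i(z) w_i(z) for dual families al and w,
    truncated after M terms of each half. *)
Definition sugawara M n v : V := 2^-1 *: \sum_i
  \sum_(j < M) (h (al i) (- j.+1%:Z) (h (w i) (n + j.+1%:Z) v)
                + h (w i) (n - j%:Z) (h (al i) j%:Z v)).

(** For each of the two factors of a product, exactly one index among the two
    halves has a nonzero commutator with a(l). Summed over i, the duality of al
    and w turns it into a(n + l), once for each factor, which compensates the
    factor one half. *)
Lemma sugawara_comm a l n v M : (absz l < M)%N -> (absz (n + l)%R < M)%N ->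
  h a l (sugawara M n v) = sugawara M n (h a l v) + l%:~R *: h a (n + l) v.
Proof.
move=> lM nlM; rewrite /sugawara hZ hS.
have -> : l%:~R *: h a (n + l) v = 2^-1 *: \sum_i
    (l%:~R * formK a (al i)) *: h (w i) (n + l) v
    + 2^-1 *: \sum_i (l%:~R * formK a (w i)) *: h (al i) (n + l) v.
  under [X in _ = _ *: X + _]eq_bigr do rewrite -scalerA.
  under [X in _ = _ + _ *: X]eq_bigr do rewrite -scalerA.
  rewrite -!scaler_sumr -!h_sum al_w w_al.
  lincomb K V; by field.
rewrite -!scalerDr -!big_split; congr (_ *: _); apply: eq_bigr => i _ /=.
have -> : (l%:~R * formK a (al i)) *: h (w i) (n + l) v =
   \sum_(j < M) ((- l == - j.+1%:Z)%:R + (- l == j%:Z)%:R) *: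
      ((l%:~R * formK a (al i)) *: h (w i) (n + l) v).
  by rewrite -scaler_suml delta_sum ?scale1r // abszN.
have -> : (l%:~R * formK a (w i)) *: h (al i) (n + l) v =
   \sum_(j < M) ((n + l == - j.+1%:Z)%:R + (n + l == j%:Z)%:R) *:
      ((l%:~R * formK a (w i)) *: h (al i) (n + l) v).
  by rewrite -scaler_suml delta_sum ?scale1r.
rewrite hS -!big_split; apply: eq_bigr => j _ /=.
rewrite hD (h_comm a (al i) l) (h_comm a (w i) l (n + _)).
rewrite (h_comm a (w i) l) (h_comm a (al i) l j) !hD !hZ.
have -> : (l + - j.+1%:Z == 0) = (- l == - j.+1%:Z) by apply/eqP/eqP; lia.
have -> : (l + (n + j.+1%:Z) == 0) = (n + l == - j.+1%:Z) by apply/eqP/eqP; lia.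
have -> : (l + (n - j%:Z) == 0) = (n + l == j%:Z) by apply/eqP/eqP; lia.
have -> : (l + j%:Z == 0) = (- l == j%:Z) by apply/eqP/eqP; lia.
have e1 c : (- l == - j.+1%:Z)%:R *: (c *: h (w i) (n + l) v) =
  (c * (- l == - j.+1%:Z)%:R) *: h (w i) (n + j.+1%:Z) v.
  rewrite scale_swap scalerA; case: eqP => [lj|_]; last by rewrite mulr0 !scale0r.
  by rewrite (_ : l = j.+1%:Z) //; lia.
have e2 c : (- l == j%:Z)%:R *: (c *: h (w i) (n + l) v) =
  (c * (- l == j%:Z)%:R) *: h (w i) (n - j%:Z) v.
  rewrite scale_swap scalerA; case: eqP => [lj|_]; last by rewrite mulr0 !scale0r.
  by rewrite (_ : l = - j%:Z) //; lia.
have e3 c : (n + l == - j.+1%:Z)%:R *: (c *: h (al i) (n + l) v) =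
  (c * (n + l == - j.+1%:Z)%:R) *: h (al i) (- j.+1%:Z) v.
  rewrite scale_swap scalerA; case: eqP => [->//|_]; by rewrite mulr0 !scale0r.
have e4 c : (n + l == j%:Z)%:R *: (c *: h (al i) (n + l) v) =
  (c * (n + l == j%:Z)%:R) *: h (al i) j%:Z v.
  rewrite scale_swap scalerA; case: eqP => [->//|_]; by rewrite mulr0 !scale0r.
rewrite !scalerDl e1 e2 e3 e4.
rewrite -(mulr_natr (l%:~R * formK a (al i)) (- l == - j.+1%:Z)).
rewrite -(mulr_natr (l%:~R * formK a (al i)) (- l == j%:Z)).
rewrite -(mulr_natr (l%:~R * formK a (w i)) (n + l == - j.+1%:Z)).
rewrite -(mulr_natr (l%:~R * formK a (w i)) (n + l == j%:Z)).
lincomb K V.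
Qed.

Lemma sugawara_E_gt0 M n g : (0 < n)%R -> sugawara M n (E g) = 0.
Proof.
move=> n0; rewrite /sugawara big1 ?scaler0 // => i _; rewrite big1 // => j _.
rewrite h_E_gt0; last lia.
rewrite h0 add0r; case: (posnP j) => [->|j0].
  by rewrite h_E0 hZ h_E_gt0 ?scaler0 //; lia.
by rewrite (h_E_gt0 (al i)) ?h0 //; lia.
Qed.

Lemma sugawara_E0 M g : sugawara M.+1 0 (E g) = ((form g g)%:~R / 2) *: E g.
Proof.
set gK := to_K K g.
have fg : \sum_i formK (al i) gK * formK (w i) gK = formK gK gK.
  have := congr1 (formK gK) (al_w gK).
  rewrite !big_ord_recr !big_ord0 /= !add0r !formKDr !formKZr => <-.
  by rewrite ![formK (al _) gK]formKC ![formK (w _) gK]formKC.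
rewrite -formK_int -/gK -fg mulrC -scalerA /sugawara; congr (_ *: _).
rewrite scaler_suml; apply: eq_bigr => i _.
rewrite big_ord_recl big1 /= => [|j _].
  rewrite h_E_gt0 ?h0 ?add0r; last lia.
  by rewrite addr0 (h_E0 (al i)) hZ -[h (w i) _ _]/(h (w i) 0 (E g)) h_E0 scalerA.
by rewrite h_E_gt0 ?h0 ?add0r // (h_E_gt0 (al i)) ?h0.
Qed.

Lemma sugawara_EN1 M g : sugawara M.+1 (-1) (E g) = h (to_K K g) (-1) (E g).
Proof.
set gK := to_K K g.
have -> : h gK (-1) (E g) = 2^-1 *: \sum_i
  (formK gK (w i) *: h (al i) (-1) (E g) + formK gK (al i) *: h (w i) (-1) (E g)).
  rewrite big_split /= -!h_sum al_w w_al; lincomb K V; by field.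
rewrite /sugawara; congr (_ *: _); apply: eq_bigr => i _.
rewrite big_ord_recl big1 /= => [|j _].
  rewrite addr0 (_ : -1 + _ = 0 :> int) // (_ : -1 - _ = -1 :> int) //.
  by rewrite !h_E0 !hZ ![formK gK _]formKC.
rewrite h_E_gt0 ?h0 ?add0r; last by rewrite /bump /=; lia.
by rewrite (h_E_gt0 (al i)) ?h0.
Qed.
End Sugawara.

(** * The conformal vector and the field of a derivative *)

Section Conformal.
Variable K : numFieldType.
Local Notation V := (VF K).
Local Notation al i := (to_K K (alpha i)).
Local Notation normal_product a m :=
  (is_normal_product (@heis K) (dcoef K) a m).

Lemma Ymode_linl c (u v : V) n w :
  Ymode (c *: u + v) n w = c *: Ymode u n w + Ymode v n w.
Proof. exact: (linext_is_linear _ c u v). Qed.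

Lemma Ymode0l n (w : V) : Ymode 0 n w = 0.
Proof.
have := Ymode_linl (-1) 0 0 n w.
by rewrite scaler0 addr0 scaleN1r addNr.
Qed.

Lemma Ymode_Dl (u v : V) n w : Ymode (u + v) n w = Ymode u n w + Ymode v n w.
Proof. by have := Ymode_linl 1 u v n w; rewrite !scale1r. Qed.

Lemma Ymode_Zl c (u : V) n w : Ymode (c *: u) n w = c *: Ymode u n w.
Proof.
have flin : linear (fun x : V => Ymode x n w) by move=> d x y; exact: Ymode_linl.
pose f : {linear V -> V} := HB.pack (fun x : V => Ymode x n w)
  (GRing.isLinear.Build K _ _ _ _ flin).
exact: (linearZZ f).
Qed.

Lemma Ymode_sum I r (P : pred I) (F : I -> V) n w :
  Ymode (\sum_(i <- r | P i) F i) n w = \sum_(i <- r | P i) Ymode (F i) n w.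
Proof.
by apply: (big_morph (fun u => Ymode u n w)) => [u v|]; [exact: Ymode_Dl | exact: Ymode0l].
Qed.

Lemma Ymode_lin (v : V) n : linear (Ymode v n).
Proof. exact: linearP. Qed.

Lemma Ymode_modeE (v u : V) c :
  Ymode (c *: u + v) = (fun n w => c *: Ymode u n w + Ymode v n w).
Proof. by apply/funext => n; apply/funext => w; exact: Ymode_linl. Qed.

Lemma Ymode_ketE s g : Ymode (ket K s g) = normord_seq g (factors s).
Proof. by apply/funext => n; apply/funext => w; exact: Ymode_ket. Qed.

Let eq_normal_product a m (B B' C C' : modes K) : B = C -> B' = C' ->
  normal_product a m C C' -> normal_product a m B B'.
Proof. by move=> -> ->. Qed.

(** A creation operator acts on states as a normally ordered product acts on
    fields. On a monomial this adds a variable to the list of factors, possibly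
    in the middle, whence the need for the independence of their order. *)
Lemma Ymode_heis i m (v : V) :
  normal_product (al i) m (Ymode v) (Ymode (heis (al i) (Negz m) v)).
Proof.
move: v; apply: ket_ind => [n w|c u v Pu Pv|s g].
- exists 0%N => M _; rewrite heisL0 Ymode0l /normal_sum; symmetry.
  rewrite [X in X + _]big1 => [|j _]; last by rewrite Ymode0l heisL0 scaler0.
  rewrite [X in _ + X]big1 => [|j _]; last by rewrite Ymode0l scaler0.
  exact: addr0.
- rewrite heisLD heisLZ !Ymode_modeE.
  exact: (normal_product_lin (@heis_lin K) c Pu Pv).
- apply: (eq_normal_product (Ymode_ketE s g) _
    (normord_product (i, m) (normord_seq_field K g (factors s)))).
  rewrite heis_alphaN; apply: etrans (Ymode_ketE _ g) _.
  exact: (normord_seq_perm K g (perm_factors (i, m) s)).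
Qed.

Lemma factors_onecm : factors (onecm ('I_3 * nat)%type) = [::].
Proof.
case E : (factors _) => [|x l]; first exact: erefl.
by have := count_factors (onecm _) x; rewrite E /= eqxx onecmE.
Qed.

Lemma Ymode_expQ g : Ymode (expQ K g) = Yexp g.
Proof. by rewrite /expQ Ymode_ketE factors_onecm. Qed.

Lemma eps0l g : eps 0 g = 1.
Proof.
rewrite /eps big1 // => i _; rewrite big1 // => j _.
by rewrite (_ : (0 : lattice) 0 i = 0) ?mxE // mul0r expr0z.
Qed.

Lemma to_K0 : to_K K 0 = 0.
Proof. by apply/matrixP => i j; rewrite !mxE. Qed.

Lemma formK0r a : formK a 0 = 0 :> K.
Proof. by rewrite -(scale0r a) formKZr mul0r. Qed.

Lemma heis0l k (v : V) : heis 0 k v = 0.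
Proof. by rewrite -(scale0r (0 : 'rV[K]_3)) heisZ scale0r. Qed.

Lemma Yexp0 n (v : V) : Yexp 0 n v = (n == -1)%:R *: v.
Proof.
move: v n; apply: VF_ind => [|c u v Pu Pv|g|i m v Pv] n.
- by rewrite (linear_at0 (Yexp_linear 0 n)) scaler0.
- by rewrite Yexp_linear Pu Pv scalerDr; apply: eq_add; [exact: scale_swap | exact: erefl].
- rewrite Yexp_expQ eps0l scale1r add0r.
  have -> : form 0 g = 0 by rewrite /form !mul0mx mxE.
  rewrite subr0; have [->|n1] := eqVneq n (-1).
    by rewrite scale1r /= creation0.
  rewrite scale0r; case E : (- n - 1) => [p|p] //; case: p E => [|p] E; first by lia.
  have pn0 : p.+1%:R != 0 :> K by rewrite pnatr_eq0.
  apply: (scalerI pn0); rewrite scaler0; apply: etrans (creation_recurrence _ _ _) _.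
  by rewrite big1 ?scaler0 // => k _; rewrite to_K0 heis0l.
- have := Yexp_comm 0 (al i) (Negz m) n v.
  rewrite to_K0 formK0r scale0r addr0 => <-.
  by rewrite Pv heisLZ.
Qed.

Lemma Ymode_creation1 a n (v : V) : Ymode (heis a (-1) (expQ K 0)) n v = heis a n v.
Proof.
have H i : Ymode (heis (al i) (-1) (expQ K 0)) n v = heis (al i) n v.
  apply: (normal_product_id (@heis_lin K) (dcoef0 K) _ n v).
  have -> : (fun n v => (n == -1)%:R *: v) = Ymode (expQ K 0).
    by rewrite Ymode_expQ; apply/funext => r; apply/funext => w; rewrite Yexp0.
  exact: Ymode_heis.
rewrite [a]row_alpha; elim/big_ind: _ => [|b c Hb Hc|i _].
- by rewrite !heis0l Ymode0l.
- rewrite [heis (b + c) (-1) _]heisD [heis (b + c) n v]heisD.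
  rewrite Ymode_Dl; apply: eq_add; [exact: Hb | exact: Hc].
- rewrite [heis (_ *: _) (-1) _]heisZ [heis (_ *: _) n v]heisZ.
  rewrite Ymode_Zl; apply: eq_scale; [exact: erefl | exact: H].
Qed.

Local Notation w := (fundw K).

Lemma cartan_unit : map_mx intr cartan \in (@unitmx K 3).
Proof.
(* The inverse is the adjugate divided by the determinant - 2. *)
pose B : 'M[K]_3 := \matrix_(i, j)
  (nth 0 (nth [::] [:: [:: 3; 4; 2]; [:: 4; 4; 2]; [:: 2; 2; 0]] i) j / - 2).
suff /mulmx1_unit[] : map_mx intr cartan *m B = 1%:M by [].
apply/matrixP => i j; rewrite !mxE !big_ord_recr big_ord0 /= !mxE.
by case: i => [[|[|[|i]]] hi] //=; case: j => [[|[|[|j]]] hj] //=; rewrite ?mulr1n ?mulr0n; field.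
Qed.

Lemma alpha_fundw a : \sum_i formK a (al i) *: w i = a.
Proof.
transitivity (a *m map_mx intr cartan *m invmx (map_mx intr cartan)); last first.
  by rewrite mulmxK ?cartan_unit.
rewrite mulmx_sum_row; apply: eq_bigr => i _; congr (_ *: _).
rewrite /formK to_K_alphaE trmx_delta [LHS]mxE (bigD1 i) //=.
rewrite [delta_mx _ _ _ _]mxE !eqxx mulr1 big1 ?addr0 // => j ji.
by rewrite [delta_mx _ _ _ _]mxE (negPf ji) mulr0.
Qed.

Lemma fundw_alpha a : \sum_i formK a (w i) *: al i = a.
Proof.
rewrite [RHS]row_alpha; apply: eq_bigr => i _; congr (_ *: _).
rewrite formKC /formK /fundw -row_mul mulVmx ?cartan_unit // row1.
by rewrite mxE (bigD1 i) //= !mxE !eqxx mul1r big1 ?addr0 // => j ji;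
  rewrite !mxE eqxx (negPf ji) mul0r.
Qed.

Lemma conformalE : conformal K =
  2^-1 *: \sum_i heis (al i) (-1) (heis (w i) (-1) (expQ K 0)).
Proof. exact: erefl. Qed.

(** The conformal vector is a sum of products of two creation operators, so its
    field is a sum of normally ordered products of two Heisenberg fields. *)
Lemma Lop_sugawara n (v : V) : eventually (fun M =>
  Lop n v = sugawara (@heis K) (fun i => al i) w M n v).
Proof.
have H i : eventually (fun M => Ymode (heis (al i) (-1) (heis (w i) (-1) (expQ K 0))) (n + 1) v
   = normal_sum (@heis K) (dcoef K) (al i) 0 M (fun r u => heis (w i) r u) (n + 1) v).
  have -> : (fun r u => heis (w i) r u) = Ymode (heis (w i) (-1) (expQ K 0)).
    by apply/funext => r; apply/funext => u; rewrite Ymode_creation1.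
  exact: Ymode_heis.
apply: eventually_mono (eventually_forall H) => M {}H.
rewrite /Lop conformalE Ymode_Zl Ymode_sum /sugawara.
apply: eq_scale; first exact: erefl.
apply: eq_bigr => i _; rewrite H (normal_sum_weight1 _ _ _ _ _ _ (dcoef0 K)).
apply: eq_bigr => j _.
rewrite (_ : n + 1 + j%:Z = n + j.+1%:Z); last lia.
rewrite (_ : n + 1 - j.+1%:Z = n - j%:Z); last lia.
exact: erefl.
Qed.

Lemma Lop_linear n : linear (Lop (K := K) n).
Proof. exact: linearP. Qed.

Lemma Lop_comm a l n (v : V) :
  heis a l (Lop n v) = Lop n (heis a l v) + l%:~R *: heis a (n + l) v.
Proof.
have [M HM] := eventually_and (eventually_ge (absz l + absz (n + l)%R).+1)
  (eventually_and (Lop_sugawara n v) (Lop_sugawara n (heis a l v))).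
have [lM [-> ->]] := HM M (leqnn M).
by apply: (sugawara_comm (@heis_lin K) (@heis_comm K) (@heisD K) (@heisZ K)
  alpha_fundw fundw_alpha); lia.
Qed.

Lemma Lop_expQ_gt0 n g : (0 < n)%R -> Lop n (expQ K g) = 0.
Proof.
move=> n0; have [M HM] := Lop_sugawara n (expQ K g); rewrite (HM M (leqnn M)).
exact: (sugawara_E_gt0 (@heis_lin K) (@heis_expQ_gt0 K) (@heis_expQ0 K)).
Qed.

Lemma Lop0_expQ g : Lop 0 (expQ K g) = ((form g g)%:~R / 2) *: expQ K g.
Proof.
have [M HM] := Lop_sugawara 0 (expQ K g); rewrite (HM M.+1 (leqnSn M)).
exact: (sugawara_E0 (@heis_lin K) (@heis_expQ_gt0 K) (@heis_expQ0 K) alpha_fundw).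
Qed.

Lemma LopN1_expQ g : Lop (-1) (expQ K g) = heis (to_K K g) (-1) (expQ K g).
Proof.
have [M HM] := Lop_sugawara (-1) (expQ K g); rewrite (HM M.+1 (leqnSn M)).
exact: (sugawara_EN1 (@heis_lin K) (@heisD K) (@heisZ K) (@heis_expQ_gt0 K)
  (@heis_expQ0 K) alpha_fundw fundw_alpha).
Qed.

Lemma Yexp_primary b m n (v : V) : form b b = 2 -> (-1 <= m)%R ->
  Lop m (Yexp b n v) = Yexp b n (Lop m v) - n%:~R *: Yexp b (m + n) v.
Proof.
move=> bb m1.
exact (vertex_primary (@heis_lin K) (@heis_comm K) (@heisD K) (@heis_expQ_gt0 K)
  (@heis_expQ0 K) (@VF_ind K) (@creation_linear K b) (@creation0 K b) (@creation_recurrence K b)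
  (@Yexp_linear K b) (@Yexp_expQ K b) (@Yexp_comm K b) Lop_linear Lop_comm Lop_expQ_gt0
  Lop0_expQ LopN1_expQ bb n v m1).
Qed.

Lemma heis_linl c a b k (v : V) : heis (c *: a + b) k v = c *: heis a k v + heis b k v.
Proof. by rewrite heisD heisZ. Qed.

Lemma Ymode_heis1 a (u : V) :
  normal_product a 0 (Ymode u) (Ymode (heis a (-1) u)).
Proof.
have closed c b b' : normal_product b 0 (Ymode u) (Ymode (heis b (-1) u)) ->
    normal_product b' 0 (Ymode u) (Ymode (heis b' (-1) u)) ->
    normal_product (c *: b + b') 0 (Ymode u) (Ymode (heis (c *: b + b') (-1) u)).
  move=> Hb Hb' n v; apply: eventually_mono (eventually_and (Hb n v) (Hb' n v)).
  move=> M [E E'].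
  have -> := normal_sum_linl (dcoef K) 0 M n v
    (Ymode_lin u) (heis_linl c b b').
  rewrite heis_linl; apply: etrans (Ymode_linl _ _ _ _ _) _.
  by apply: eq_add; [apply: eq_scale; [exact: erefl | exact: E] | exact: E'].
rewrite [a]row_alpha !big_ord_recl big_ord0.
do 3 (apply: (closed); first exact: Ymode_heis).
move=> n v; exists 0%N => M _.
have := normal_sum_linl (dcoef K) 0 M n v (Ymode_lin u) (heis_linl (-1) 0 0).
rewrite heis0l Ymode0l scaler0 addr0 => ->.
by rewrite scaleN1r addNr.
Qed.

Lemma Yexp_derivative b n (v : V) :
  Ymode (heis (to_K K b) (-1) (expQ K b)) n v = translate (Yexp b) n v.
Proof.
have [M HM] := eventually_and (Ymode_heis1 (to_K K b) (expQ K b) n v)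
  (vertex_derivative (@heis_lin K) (@heis_comm K) (@heis_expQ_gt0 K)
  (@heis_expQ0 K) (@VF_ind K) (@creation_recurrence K b)
  (@Yexp_linear K b) (@Yexp_expQ K b) (@Yexp_comm K b) n v).
have [-> E] := HM M (leqnn M); apply: etrans E.
rewrite normal_sum_weight1 ?big_split ?Ymode_expQ; last exact: dcoef0.
exact: erefl.
Qed.

(** L_(-1) acts on states as d/dz acts on fields. For e^g this is the derivative of
    a vertex operator, and a creation operator adds the same Leibniz rule on both
    sides. *)
Lemma Ymode_LopN1 (u : V) : Ymode (Lop (-1) u) = translate (Ymode u).
Proof.
move: u; apply: VF_ind => [|c u v Pu Pv|g|i m u Pu]; apply/funext => n; apply/funext => w.
- by rewrite (linear_at0 (Lop_linear (-1))) /translate !Ymode0l scaler0.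
- rewrite Lop_linear; apply: etrans (Ymode_linl _ _ _ _ _) _.
  apply: etrans (eq_add (eq_scale (erefl c) (congr1 (fun B => B n w) Pu))
    (congr1 (fun B => B n w) Pv)) _.
  rewrite /translate [Ymode (c *: u + v) _ _]Ymode_linl [RHS]scalerDr.
  by apply: eq_add; [exact: scale_swap | exact: erefl].
- by rewrite LopN1_expQ Ymode_expQ Yexp_derivative.
have -> : Lop (-1) (heis (al i) (Negz m) u) =
    heis (al i) (Negz m) (Lop (-1) u) + m.+1%:R *: heis (al i) (Negz m.+1) u.
  rewrite Lop_comm (_ : -1 + Negz m = Negz m.+1); last lia.
  have -> : (Negz m)%:~R = - m.+1%:R :> K by rewrite NegzE rmorphN.
  by rewrite -addrA -scalerDl addNr scale0r addr0.
rewrite Ymode_Dl Ymode_Zl.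
have HX : normal_product (al i) m (translate (Ymode u))
    (Ymode (heis (al i) (Negz m) (Lop (-1) u))).
  by rewrite -Pu; exact: Ymode_heis.
exact (normal_product_translate (@heis_lin K) (dcoefS K m)
  (Ymode_heis i m u) HX (Ymode_heis i m.+1 u) n w).
Qed.
End Conformal.

(** * The coefficient of e^g *)

Section Vacuum.
Variable K : numFieldType.
Local Notation V := (VF K).
Local Notation al i := (to_K K (alpha i)).

Lemma Lop_heis m a l (v : V) :
  Lop m (heis a l v) = heis a l (Lop m v) - l%:~R *: heis a (m + l) v.
Proof. by rewrite Lop_comm addrK. Qed.

Lemma Lop_LZ m c (v : V) : Lop m (c *: v) = c *: Lop m v.
Proof. exact: linearZZ. Qed.
Lemma Lop_L0 m : Lop m (0 : V) = 0.
Proof. exact: linear0. Qed.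

(** Linear forms built from vac and the annihilation operators detect the vectors
    that are not in the image of L_(-1). *)
Definition vac g (v : V) : K := mcoeff (onecm _, g) v.

Lemma vacD g u v : vac g (u + v) = vac g u + vac g v.
Proof. exact: mcoeffD. Qed.
Lemma vacZ g c v : vac g (c *: v) = c * vac g v.
Proof. exact: mcoeffZ. Qed.
Lemma vac0 g : vac g 0 = 0.
Proof. exact: mcoeff0. Qed.
Lemma vac_ket g s h : vac g (ket K s h) = ((s, h) == (onecm _, g))%:R.
Proof. by rewrite /vac /ket mcoeffU. Qed.
Lemma vac_expQ g h : vac g (expQ K h) = (h == g)%:R.
Proof. by rewrite /expQ vac_ket xpair_eqE eqxx. Qed.

Let lin0 (c x y : K) : x = 0 -> y = 0 -> c * x + y = 0.
Proof. by move=> -> ->; rewrite mulr0 addr0. Qed.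
Let linM (c k x y x' y' : K) : x = k * x' -> y = k * y' ->
  c * x + y = k * (c * x' + y').
Proof. by move=> -> ->; rewrite mulrDr mulrCA. Qed.

Lemma vac_creation g a m v : vac g (heis a (Negz m) v) = 0.
Proof.
move: v; apply: ket_ind => [|c u v Pu Pv|s h].
- by rewrite heisL0 vac0.
- by rewrite heisLD heisLZ vacD vacZ; exact: lin0 Pu Pv.
rewrite heis_ketN; apply: (big_ind (fun v => vac g v = 0)) => [|u v Pu Pv|i _].
- exact: vac0.
- by rewrite vacD Pu Pv addr0.
rewrite vacZ vac_ket xpair_eqE (_ : (mulcm _ _ == _) = false) ?mulr0 //.
apply/negP => /eqP/(congr1 (fun t : mono => t (i, m))).
by rewrite mulcmE ucmE eqxx onecmE.
Qed.

Lemma vac_heis0 g a v : vac g (heis a 0 v) = formK a (to_K K g) * vac g v.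
Proof.
move: v; apply: ket_ind => [|c u v Pu Pv|s h].
- by rewrite heisL0 vac0 mulr0.
- rewrite heisLD heisLZ [vac g (_ + _)]vacD [vac g (c *: heis _ _ _)]vacZ.
  rewrite [vac g (c *: u + v)]vacD [vac g (c *: u)]vacZ.
  exact: linM Pu Pv.
rewrite heis_ket0 vacZ vac_ket xpair_eqE; case: (h =P g) => [->//|_].
by rewrite andbF !mulr0.
Qed.

Lemma LopN1_heisN a m (u : V) : Lop (-1) (heis a (Negz m) u) =
    heis a (Negz m) (Lop (-1) u) + m.+1%:R *: heis a (Negz m.+1) u.
Proof.
rewrite Lop_heis (_ : -1 + Negz m = Negz m.+1); last lia.
by rewrite NegzE rmorphN scaleNr opprK.
Qed.

(** L_(-1) raises the level, so that its values have no component of level zero. *)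
Lemma vac_LopN1 g (u : V) : vac g (Lop (-1) u) = 0.
Proof.
move: u; apply: VF_ind => [|c u v Pu Pv|h|i m u Pu].
- by rewrite Lop_L0 vac0.
- by rewrite Lop_linear vacD vacZ; exact: lin0 Pu Pv.
- by rewrite LopN1_expQ (vac_creation g _ 0).
rewrite LopN1_heisN vacD addrC vacZ; apply: lin0; exact: vac_creation.
Qed.

Lemma vac_LopN1_2 g a (u : V) :
  vac g (heis a 2 (Lop (-1) u)) = 2 * vac g (heis a 1 u).
Proof.
rewrite Lop_comm vacD; apply: etrans (eq_add (vac_LopN1 _ _) (vacZ _ _ _)) _.
rewrite add0r (_ : -1 + 2 = 1 :> int); last by [].
exact: erefl.
Qed.

Lemma heis1_LopN1 a (u : V) :
  heis a 1 (Lop (-1) u) = Lop (-1) (heis a 1 u) + heis a 0 u.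
Proof.
rewrite Lop_comm (_ : -1 + 1 = 0 :> int); last by [].
apply: eq_add; [exact: erefl | exact: scale1r].
Qed.

Lemma vac_LopN1_1 g a (u : V) :
  vac g (heis a 1 (Lop (-1) u)) = formK a (to_K K g) * vac g u.
Proof.
rewrite heis1_LopN1 vacD; apply: etrans (eq_add (vac_LopN1 _ _) (vac_heis0 _ _ _)) _.
exact: add0r.
Qed.

Lemma vac_LopN1_11 g a b (u : V) :
  vac g (heis a 1 (heis b 1 (Lop (-1) u))) =
  formK b (to_K K g) * vac g (heis a 1 u) + formK a (to_K K g) * vac g (heis b 1 u).
Proof.
rewrite heis1_LopN1 heisLD vacD addrC; apply: eq_add; last exact: vac_LopN1_1.
rewrite heis_comm (_ : 1 + 0 == 0 = false); last by [].
rewrite mulr0n scale0r addr0; exact: vac_heis0.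
Qed.
End Vacuum.

(** * Level two in degree - rho *)

Lemma sum_ord3 (W : nmodType) (F : 'I_3 -> W) : \sum_i F i = F i1 + F i2 + F i3.
Proof.
rewrite !big_ord_recr big_ord0 /= add0r.
by congr (F _ + F _ + F _); apply: val_inj.
Qed.

Lemma formE b c : form b c =
  b 0 i1 * (2 * c 0 i1 - 2 * c 0 i2) + b 0 i2 * (- 2 * c 0 i1 + 2 * c 0 i2 - c 0 i3)
  + b 0 i3 * (- c 0 i2 + 2 * c 0 i3).
Proof. rewrite /form !mxE sum_ord3 !mxE !sum_ord3 !mxE /=; ring. Qed.

Lemma alphaE i j : alpha i 0 j = (j == i)%:R.
Proof. by rewrite mxE eqxx. Qed.

Lemma mrhoE : mrho = alpha i1 *+ 2 + alpha i2 *+ 2 + alpha i3.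
Proof. by rewrite /mrho /beta1 /beta2 [alpha i2 *+ 2]mulr2n addrAC addrA. Qed.

Lemma form_mrho b : form b mrho = - b 0 i2.
Proof. by rewrite formE !mxE /=; ring. Qed.

Lemma form_alpha i j : form (alpha i) (alpha j) = cartan i j.
Proof.
rewrite formE !alphaE !mxE.
by case: i => [[|[|[|i]]] hi]; case: j => [[|[|[|j]]] hj].
Qed.

Section LevelTwo.
Variables (K : numFieldType) (V : lmodType K).
Variables (h : 'rV[K]_3 -> int -> V -> V) (E : lattice -> V).
Hypothesis h_lin : forall a k, linear (h a k).
Hypothesis h_comm : forall a b k l v, h a k (h b l v) =
  h b l (h a k v) + (k%:~R * formK a b *+ (k + l == 0)) *: v.
Hypothesis h_addl : forall a b k v, h (a + b) k v = h a k v + h b k v.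
Hypothesis h_scalel : forall c a k v, h (c *: a) k v = c *: h a k v.
Hypothesis h_E_gt0 : forall a k g, (0 < k)%R -> h a k (E g) = 0.
Hypothesis h_E0 : forall a g, h a 0 (E g) = formK a (to_K K g) *: E g.

Let hl a k : {linear V -> V} :=
  HB.pack (h a k) (GRing.isLinear.Build K _ _ _ (h a k) (h_lin a k)).
Let hD a k u v : h a k (u + v) = h a k u + h a k v.
Proof. exact: (linearD (hl a k)). Qed.
Let hZ a k c v : h a k (c *: v) = c *: h a k v.
Proof. exact: (linearZZ (hl a k)). Qed.
Let hN a k v : h a k (- v) = - h a k v.
Proof. exact: (linearN (hl a k)). Qed.
Let h0 a k : h a k 0 = 0.
Proof. exact: (linear0 (hl a k)). Qed.

Variable L : int -> V -> V.
Hypothesis L_lin : forall m, linear (L m).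
Hypothesis L_comm : forall a l n v,
  h a l (L n v) = L n (h a l v) + l%:~R *: h a (n + l) v.
Hypothesis L_E_gt0 : forall m g, (0 < m)%R -> L m (E g) = 0.
Hypothesis L_E0 : forall g, L 0 (E g) = ((form g g)%:~R / 2) *: E g.
Hypothesis L_EN1 : forall g, L (-1) (E g) = h (to_K K g) (-1) (E g).

Let Ll m : {linear V -> V} :=
  HB.pack (L m) (GRing.isLinear.Build K _ _ _ (L m) (L_lin m)).
Let LD m u v : L m (u + v) = L m u + L m v.
Proof. exact: (linearD (Ll m)). Qed.
Let LZ m c v : L m (c *: v) = c *: L m v.
Proof. exact: (linearZZ (Ll m)). Qed.
Let LN m v : L m (- v) = - L m v.
Proof. exact: (linearN (Ll m)). Qed.
Let L0 m : L m 0 = 0.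
Proof. exact: (linear0 (Ll m)). Qed.
Let L_h m a l v : L m (h a l v) = h a l (L m v) - l%:~R *: h a (m + l) v.
Proof. by rewrite L_comm addrK. Qed.

(* The vectors of level two and one in degree - rho: d and q, and s. *)
Local Notation d a := (h a (-2) (E mrho)).
Local Notation s a := (h a (-1) (E mrho)).
Local Notation q a b := (h a (-1) (h b (-1) (E mrho))).
Local Notation gK := (to_K K mrho).

Let hs a (k : nat) b : h a k.+2 (s b) = 0.
Proof. by rewrite h_comm h_E_gt0 // h0 add0r mulr0n scale0r. Qed.
Let hs1 a b : h a 1 (s b) = formK a b *: E mrho.
Proof. by rewrite h_comm h_E_gt0 // h0 add0r mul1r mulr1n. Qed.
Let hs0 a b : h a 0 (s b) = formK a gK *: s b.
Proof. by rewrite h_comm h_E0 mulr0n scale0r addr0 hZ. Qed.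

Lemma L0_d a : L 0 (d a) = d a.
Proof.
rewrite L_h L_E0 form_mrho hZ add0r !mxE /=; lincomb K V; by field.
Qed.
Lemma L0_s a : L 0 (s a) = 0.
Proof.
rewrite L_h L_E0 form_mrho hZ add0r !mxE /=; lincomb K V; by field.
Qed.
Lemma L0_q a b : L 0 (q a b) = q a b.
Proof. rewrite L_h L0_s h0 add0r; lincomb K V. Qed.

Lemma L1_d a : L 1 (d a) = 2 *: s a.
Proof. by rewrite L_h L_E_gt0 // h0 add0r -scaleNr rmorphN opprK. Qed.
Lemma L1_s a : L 1 (s a) = formK a gK *: E mrho.
Proof. by rewrite L_h L_E_gt0 // h0 add0r -scaleNr rmorphN opprK scale1r h_E0. Qed.
Lemma L1_q a b : L 1 (q a b) = formK b gK *: s a + formK a gK *: s b.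
Proof. by rewrite L_h L1_s hZ -scaleNr rmorphN opprK scale1r hs0. Qed.

Lemma L2_d a : L 2 (d a) = (2 * formK a gK) *: E mrho.
Proof. by rewrite L_h L_E_gt0 // h0 add0r -scaleNr rmorphN opprK h_E0 scalerA. Qed.
Lemma L2_s a : L 2 (s a) = 0.
Proof. by rewrite L_h L_E_gt0 // h0 add0r -scaleNr rmorphN opprK h_E_gt0 // scaler0. Qed.
Lemma L2_q a b : L 2 (q a b) = formK a b *: E mrho.
Proof. by rewrite L_h L2_s h0 add0r -scaleNr rmorphN opprK scale1r hs1. Qed.

Lemma L3_d (m : nat) a : L m.+3 (d a) = 0.
Proof. by rewrite L_h L_E_gt0 // h0 add0r -scaleNr rmorphN opprK h_E_gt0 // scaler0. Qed.
Lemma L3_s (m : nat) a : L m.+3 (s a) = 0.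
Proof. by rewrite L_h L_E_gt0 // h0 add0r -scaleNr rmorphN opprK h_E_gt0 // scaler0. Qed.
Lemma L3_q (m : nat) a b : L m.+3 (q a b) = 0.
Proof. by rewrite L_h L3_s h0 add0r -scaleNr rmorphN opprK scale1r hs. Qed.

Lemma LN1_s a : L (-1) (s a) = d a + q a gK.
Proof. by rewrite L_h L_EN1 addrC -scaleNr rmorphN opprK scale1r. Qed.

Local Notation al i := (to_K K (alpha i)).
Local Notation p1 := (d (al i2) + q (al i2) (al i2)).
Local Notation p2 := (- q (al i1) (al i1) + q (al i3) (al i3)).
Local Notation p3 := (q (al i1) (al i3)).

Let g1 : formK (al i1) gK = 0.
Proof. by rewrite formK_int form_mrho alphaE. Qed.
Let g2 : formK (al i2) gK = -1.
Proof. by rewrite formK_int form_mrho alphaE rmorphN. Qed.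
Let g3 : formK (al i3) gK = 0.
Proof. by rewrite formK_int form_mrho alphaE. Qed.
Let faa i j : formK (al i) (al j) = (cartan i j)%:~R.
Proof. by rewrite formK_int form_alpha. Qed.

Lemma qC a b : q a b = q b a.
Proof. by rewrite h_comm mulr0n scale0r addr0. Qed.

Lemma p1_primary (m : nat) : L m.+1 p1 = 0.
Proof.
case: m => [|[|m]]; rewrite LD.
- rewrite L1_d L1_q g2; lincomb K V.
- rewrite L2_d L2_q g2 faa !mxE /=; lincomb K V.
- by rewrite L3_d L3_q addr0.
Qed.

Lemma p2_primary (m : nat) : L m.+1 p2 = 0.
Proof.
case: m => [|[|m]]; rewrite LD LN.
- rewrite !L1_q g1 g3; lincomb K V.
- rewrite !L2_q !faa !mxE /=; lincomb K V.
- by rewrite !L3_q oppr0 addr0.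
Qed.

Lemma p3_primary (m : nat) : L m.+1 p3 = 0.
Proof.
case: m => [|[|m]].
- rewrite !L1_q g1 g3; lincomb K V.
- rewrite !L2_q !faa !mxE /=; lincomb K V.
- by rewrite !L3_q.
Qed.

Lemma p1_level : L 0 p1 = p1. Proof. by rewrite LD L0_d L0_q. Qed.
Lemma p2_level : L 0 p2 = p2. Proof. by rewrite LD LN !L0_q. Qed.
Lemma p3_level : L 0 p3 = p3. Proof. exact: L0_q. Qed.

(** L_1 is the only obstruction, and it measures (alpha_i, - rho), which vanishes
    for i = 1 and i = 3. *)
Lemma s_primary i (m : nat) : i != i2 -> L m.+1 (s (al i)) = 0.
Proof.
move=> ii2; case: m => [|[|m]].
- rewrite L1_s formK_int form_mrho alphaE eq_sym (negPf ii2).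
  by rewrite oppr0 scale0r.
- exact: L2_s.
- exact: L3_s.
Qed.

Variables (vac : V -> K) (w : 'I_3 -> 'rV[K]_3).
Hypothesis vac_lin : forall c u v, vac (c *: u + v) = c * vac u + vac v.
Hypothesis vac_E : vac (E mrho) = 1.
Hypothesis w_al : forall k i, formK (w k) (al i) = (i == k)%:R.

Let vac0 : vac 0 = 0.
Proof.
have := vac_lin (-1) 0 0.
by rewrite scaler0 addr0 mulN1r addNr.
Qed.
Let vacZ c u : vac (c *: u) = c * vac u.
Proof. by rewrite -[c *: u]addr0 vac_lin vac0 addr0. Qed.
Let vacD u v : vac (u + v) = vac u + vac v.
Proof. by rewrite -[u]scale1r vac_lin scale1r mul1r. Qed.

(** L_1 gives three equations and L_2 one. They leave five of the nine
    dimensions: two are filled by L_(-1) of vectors of P_0, three by the p_i. *)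
(** On degree - rho, L_0 is wt - 1, so that the eigenvalue 1 requires wt = 2. *)
Lemma level_two_primary (x : 'I_3 -> K) (y : 'I_3 -> 'I_3 -> K) v :
  v = \sum_i x i *: d (al i) + \sum_i \sum_j y i j *: q (al i) (al j) ->
  L 1 v = 0 -> L 2 v = 0 -> exists A B C : K,
  v = L (-1) (x i1 *: s (al i1) + x i3 *: s (al i3)) + A *: p1 + B *: p2 + C *: p3.
Proof.
rewrite !sum_ord3 => -> H1 H2.
(* L_1 v = 0, then its coordinates, read off with the dual basis w. *)
have {H1} E1 : (2 * x i1 - y i1 i2 - y i2 i1) *: s (al i1)
    + (2 * x i2 - 2 * y i2 i2) *: s (al i2)
    + (2 * x i3 - y i2 i3 - y i3 i2) *: s (al i3) = 0.
  rewrite -H1 !(LD, LZ) !L1_d !L1_q g1 g2 g3; lincomb K V.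
have S k : vac (h (w k) 1 ((2 * x i1 - y i1 i2 - y i2 i1) *: s (al i1)
    + (2 * x i2 - 2 * y i2 i2) *: s (al i2)
    + (2 * x i3 - y i2 i3 - y i3 i2) *: s (al i3))) =
    (2 * x i1 - y i1 i2 - y i2 i1) * (i1 == k)%:R
    + (2 * x i2 - 2 * y i2 i2) * (i2 == k)%:R
    + (2 * x i3 - y i2 i3 - y i3 i2) * (i3 == k)%:R.
  by rewrite !hD !hZ !hs1 !vacD !vacZ !w_al vac_E !mulr1.
have {S} Sk k : (2 * x i1 - y i1 i2 - y i2 i1) * (i1 == k)%:R
    + (2 * x i2 - 2 * y i2 i2) * (i2 == k)%:R
    + (2 * x i3 - y i2 i3 - y i3 i2) * (i3 == k)%:R = 0.
  by rewrite -S E1 h0 vac0.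
have e1 : y i2 i1 = 2 * x i1 - y i1 i2.
  have /= := Sk i1; rewrite mulr1 !mulr0 !addr0 => /eqP; rewrite subr_eq0 => /eqP <-//.
have e2 : x i2 = y i2 i2.
  have /= := Sk i2; rewrite mulr1 !mulr0 add0r addr0 -mulrBr => /eqP.
  by rewrite mulf_eq0 pnatr_eq0 /= subr_eq0 => /eqP.
have e3 : y i3 i2 = 2 * x i3 - y i2 i3.
  have /= := Sk i3; rewrite mulr1 !mulr0 !add0r => /eqP; rewrite subr_eq0 => /eqP <-//.
have {H2} E2 : 2 * (y i1 i1 + y i2 i2 + y i3 i3 - x i2) - 2 * (y i1 i2 + y i2 i1)
    - (y i2 i3 + y i3 i2) = 0.
  have := congr1 vac H2; rewrite vac0 => <-.
  rewrite !(LD, LZ) !L2_d !L2_q g1 g2 g3 !faa !mxE /= !(vacD, vacZ) vac_E; ring.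
have e4 : y i3 i3 = 2 * x i1 + x i3 - y i1 i1.
  apply: (@mulfI _ 2); first by rewrite pnatr_eq0.
  apply/eqP; rewrite -subr_eq0 -E2 e1 e2 e3; apply/eqP; ring.
(* A is read off from alpha_2(-2), B and C from the squares of alpha_1(-1) and
   alpha_1(-1) alpha_3(-1), after removing the L_(-1) part. *)
exists (y i2 i2), (2 * x i1 - y i1 i1), (y i1 i3 + y i3 i1 - x i1 - 2 * x i3).
rewrite LD !LZ !LN1_s.
have gE : gK = 2 *: al i1 + 2 *: al i2 + al i3.
  apply/rowP => k; rewrite mrhoE /to_K !mxE.
  by case: k => [[|[|[|k]]] hk] //=; ring.
have qg i : q (al i) gK = 2 *: q (al i) (al i1) + 2 *: q (al i) (al i2) + q (al i) (al i3).
  by rewrite gE !h_addl !h_scalel !hD !hZ.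
rewrite !qg e2 (qC (al i2) (al i1)) (qC (al i3) (al i1)) (qC (al i3) (al i2)) e1 e3 e4.
lincomb K V.
Qed.

Section Action.
Variables (b : lattice) (Y : int -> V -> V) (F : V).
Hypothesis Y_lin : forall n, linear (Y n).
Hypothesis Y_comm : forall a k n v,
  h a k (Y n v) = Y n (h a k v) + formK a (to_K K b) *: Y (n + k) v.
Hypotheses (Y_E0 : Y 0 (E mrho) = 0) (Y_E1 : Y (-1) (E mrho) = 0).
Hypothesis Y_E2 : Y (-2) (E mrho) = F.

Let Yl m : {linear V -> V} :=
  HB.pack (Y m) (GRing.isLinear.Build K _ _ _ (Y m) (Y_lin m)).
Let YD m u v : Y m (u + v) = Y m u + Y m v.
Proof. exact: (linearD (Yl m)). Qed.
Let YZ m c v : Y m (c *: v) = c *: Y m v.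
Proof. exact: (linearZZ (Yl m)). Qed.
Let YN m v : Y m (- v) = - Y m v.
Proof. exact: (linearN (Yl m)). Qed.
Let Y_h n a k v : Y n (h a k v) = h a k (Y n v) - formK a (to_K K b) *: Y (n + k) v.
Proof. by rewrite Y_comm addrK. Qed.

Lemma Y_level_d a : Y 0 (d a) = - formK a (to_K K b) *: F.
Proof. by rewrite Y_h Y_E0 h0 !add0r Y_E2 scaleNr. Qed.

Lemma Y_level_q a a' : Y 0 (q a a') = (formK a (to_K K b) * formK a' (to_K K b)) *: F.
Proof.
rewrite !Y_h !add0r Y_E0 Y_E1 !h0 !add0r hN hZ (_ : -1 + -1 = -2 :> int) //.
rewrite Y_E2 ?h0; lincomb K V.
Qed.

(** As Y kills E mrho in modes 0 and -1, only the terms where the commutators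
    lower the mode to -2 survive. *)
Lemma Y_p_comb A B C c1 c2 c3 :
  formK (al i1) (to_K K b) = c1 -> formK (al i2) (to_K K b) = c2 ->
  formK (al i3) (to_K K b) = c3 ->
  Y 0 (A *: p1 + B *: p2 + C *: p3) =
  (A * (c2 ^+ 2 - c2) + B * (c3 ^+ 2 - c1 ^+ 2) + C * (c1 * c3)) *: F.
Proof.
move=> f1 f2 f3; rewrite !(YD, YZ, YN) Y_level_d !Y_level_q f1 f2 f3; lincomb K V.
Qed.
End Action.

(** The two hypotheses are the values of second-order forms on L_(-1) u. The first
    expresses the first-order forms of u by A; in the second, evaluated in the
    directions (w_3, w_3) and (w_1, w_3), the resulting terms vanish and B and C
    remain. *)
Lemma p_independent A B C u :
  (forall a, vac (h a 2 (L (-1) u)) = 2 * vac (h a 1 u)) ->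
  (forall a b, vac (h a 1 (h b 1 (L (-1) u))) =
     formK b gK * vac (h a 1 u) + formK a gK * vac (h b 1 u)) ->
  L (-1) u = A *: p1 + B *: p2 + C *: p3 -> B = 0 /\ C = 0.
Proof.
move=> V2 V11 Eu.
have d2 a b : h a 2 (d b) = (2 * formK a b) *: E mrho.
  by rewrite h_comm h_E_gt0 // h0 add0r mulr1n.
have d1 a b : h a 1 (d b) = 0.
  by rewrite h_comm h_E_gt0 // h0 add0r mulr0n scale0r.
have q2 a b b' : h a 2 (q b b') = 0.
  by rewrite h_comm hs h0 add0r mulr0n scale0r.
have q11 a a' b b' : h a 1 (h a' 1 (q b b')) =
    (formK a b * formK a' b' + formK a b' * formK a' b) *: E mrho.
  rewrite (h_comm a' b) hs1 hZ hD !hZ !hs1 mul1r mulr1n; lincomb K V.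
have f a : vac (h a 1 u) = A * formK a (al i2).
  apply: (@mulfI _ 2); first by rewrite pnatr_eq0.
  rewrite -V2 Eu !(hD, hZ, hN) d2 !q2 !(vacD, vacZ) ?scaler0 ?oppr0 ?addr0 ?vac0.
  rewrite ?vac_E; ring.
have := V11 (w i1) (w i3); have := V11 (w i3) (w i3).
rewrite !f Eu !(hD, hZ, hN) !d1 !h0 !q11 !w_al /=.
have vE (x y z t : K) : vac (A *: (0 + x *: E mrho) + B *: (- (y *: E mrho) + z *: E mrho)
    + C *: (t *: E mrho)) = A * x + B * (z - y) + C * t.
  by rewrite add0r -scaleNr !(vacD, vacZ) vac_E !mulr1 [- y + z]addrC.
rewrite !vE !(mulr0, mul0r, mulr1, add0r, addr0, subr0) => B0 C0; split.
  by apply: (@mulIf _ 2); rewrite ?pnatr_eq0 // mul0r -[RHS]B0; ring.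
rewrite -[RHS]C0; ring.
Qed.
End LevelTwo.

(** * Vectors of conformal weight one in degree - rho *)

Section Combination.
Variables (K : numFieldType) (W : lmodType K) (n : nat).
Variables (D : 'I_n -> W) (Q : 'I_n -> 'I_n -> W).

Definition comb2 (x : 'I_n -> K) (y : 'I_n -> 'I_n -> K) : W :=
  \sum_i x i *: D i + \sum_i \sum_j y i j *: Q i j.

Lemma comb2_lin c x y x' y' : c *: comb2 x y + comb2 x' y' =
  comb2 (fun i => c * x i + x' i) (fun i j => c * y i j + y' i j).
Proof.
rewrite /comb2 scalerDr addrACA; congr (_ + _);
  rewrite scaler_sumr -big_split; apply: eq_bigr => i _ /=.
  by rewrite scalerA -scalerDl.
rewrite scaler_sumr -big_split; apply: eq_bigr => j _ /=.
by rewrite scalerA -scalerDl.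
Qed.

Lemma comb2_0 : comb2 (fun _ => 0) (fun _ _ => 0) = 0.
Proof.
rewrite /comb2 !big1 ?addr0 // => i _; rewrite ?scale0r // big1 // => j _.
by rewrite scale0r.
Qed.

Lemma comb2_D j : comb2 (fun i => (i == j)%:R) (fun _ _ => 0) = D j.
Proof.
rewrite /comb2 (bigD1 j) //= eqxx scale1r !big1 ?addr0 // => i.
  by move=> _; rewrite big1 // => k _; rewrite scale0r.
by move=> /negPf ->; rewrite scale0r.
Qed.

Lemma comb2_Q i j :
  comb2 (fun _ => 0) (fun i' j' => ((i' == i) && (j' == j))%:R) = Q i j.
Proof.
rewrite /comb2 big1 ?add0r => [|k _]; last by rewrite scale0r.
rewrite (bigD1 i) //= (bigD1 j) //= !eqxx scale1r !big1 ?addr0 // => k.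
  by move=> /negPf ki; rewrite big1 // => l _; rewrite ki scale0r.
by move=> /negPf ->; rewrite andbF scale0r.
Qed.
End Combination.

Section Degree.
Variable K : numFieldType.
Local Notation V := (VF K).
Local Notation al i := (to_K K (alpha i)).
Local Notation E := (expQ K).

(** The eigenvalue of L_0 on a monomial, apart from the contribution of the
    lattice degree. *)
Definition wt (s : mono) : nat := \sum_(x <- factors s) x.2.+1.

Lemma wt1 : wt (onecm _) = 0%N.
Proof. by rewrite /wt factors_onecm big_nil. Qed.

Lemma wtM x s : wt (mulcm (ucm x) s) = (x.2.+1 + wt s)%N.
Proof. by rewrite /wt (perm_big _ (perm_factors x s)) big_cons. Qed.

Lemma Lop0_ket s g :
  Lop 0 (ket K s g) = ((wt s)%:R + (form g g)%:~R / 2) *: ket K s g.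
Proof.
elim/mono_ind: s => [|[i m] s IH].
  by apply: etrans (Lop0_expQ K g) _; rewrite wt1 add0r.
rewrite -heis_alphaN Lop_heis add0r.
apply: etrans (eq_add (congr1 (heis (al i) (Negz m)) IH) (erefl _)) _.
rewrite heisLZ -scaleNr -scalerDl; apply: eq_scale; last exact: erefl.
by rewrite wtM natrD NegzE rmorphN opprK; ring.
Qed.

(** The partitions of 0, 1 and 2. *)
Lemma wt_small s : (wt s = 0%N -> s = onecm _) /\
  (wt s = 1%N -> exists j, s = mulcm (ucm (j, 0%N)) (onecm _)) /\
  (wt s = 2%N -> (exists j, s = mulcm (ucm (j, 1%N)) (onecm _)) \/
    exists i j, s = mulcm (ucm (i, 0%N)) (mulcm (ucm (j, 0%N)) (onecm _))).
Proof.
elim/mono_ind: s => [|[i m] s [H0 [H1 H2]]]; first by rewrite wt1.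
rewrite wtM /=; split; [by []|split].
  case: m => [|m]; last by lia.
  by rewrite add1n => -[/H0 ->]; exists i.
case: m => [|[|m]]; last by lia.
  by rewrite add1n => -[/H1[j ->]]; right; exists i, j.
by rewrite add2n => -[/H0 ->]; left; exists i.
Qed.

Lemma mcoeff_Lop0 s g (v : V) : mcoeff (s, g) (Lop 0 v) =
  ((wt s)%:R + (form g g)%:~R / 2) * mcoeff (s, g) v.
Proof.
move: v; apply: ket_ind => [|c u v Pu Pv|t h].
- by rewrite Lop_L0 mcoeff0 mulr0.
- rewrite Lop_linear mcoeffD mcoeffZ [in RHS]mcoeffD [in RHS]mcoeffZ.
  rewrite mulrDr mulrCA; apply: eq_add; last exact: Pv.
  by apply: (congr1 (fun x => c * x)); exact: Pu.
rewrite Lop0_ket mcoeffZ /ket mcoeffU.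
by case: eqP => [[-> ->]|] //; rewrite !mulr0.
Qed.

Local Notation level2 := (comb2 (fun i => heis (al i) (-2) (E mrho))
  (fun i j => heis (al i) (-1) (heis (al j) (-1) (E mrho)))).

Lemma level_two (v : V) : Lop 0 v = v -> in_degree mrho v ->
  exists (x : 'I_3 -> K) (y : 'I_3 -> 'I_3 -> K), v = level2 x y.
Proof.
move=> L0v vdeg.
pose W (u : V) := exists (x : 'I_3 -> K) (y : 'I_3 -> 'I_3 -> K), u = level2 x y.
have WL c u u' : W u -> W u' -> W (c *: u + u').
  move=> [x [y ->]] [x' [y' ->]].
  by do 2 eexists; exact: comb2_lin.
have W0 : W 0 by do 2 eexists; symmetry; exact: comb2_0.
rewrite [v]ketE big_seq; apply: (big_ind W) => // [u u' Wu Wu'|[s g] sv].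
  by rewrite -[u]scale1r; apply: WL.
rewrite -[X in W X]addr0; apply: WL => //.
have /= gm := vdeg _ sv; rewrite /= {}gm in sv *.
have ws : wt s = 2%N.
  have := mcoeff_Lop0 s mrho v; rewrite L0v.
  have v0 : mcoeff (s, mrho) v != 0 by rewrite mcoeff_neq0.
  have -> : form mrho mrho = -2 by rewrite form_mrho !mxE.
  rewrite -{1}[mcoeff _ _]mul1r => /(mulIf v0) w1.
  apply/eqP; rewrite -(eqr_nat K); apply/eqP.
  have w2 : (-2)%:~R / 2 = -1 :> K by rewrite rmorphN; field.
  by rewrite w2 in w1; rewrite -[LHS](subrK 1) -w1.
have [_ [_ /(_ ws)[[j ->]|[i [j ->]]]]] := wt_small s.
- do 2 eexists; symmetry; rewrite -heis_alphaN; exact: (comb2_D _ _ j).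
- do 2 eexists; symmetry; rewrite -!heis_alphaN; exact: (comb2_Q _ _ i j).
Qed.

Lemma eps_neq0 b g : (eps b g)%:~R != 0 :> K.
Proof.
rewrite intr_eq0 /eps; apply/prodf_neq0 => i _; apply/prodf_neq0 => j _.
have e0 : eps_mx i j != 0.
  rewrite mxE; by case: i => [[|[|[|i]]] hi]; case: j => [[|[|[|j]]] hj].
case: (b 0 i * g 0 j) => n; first exact: expf_neq0.
by rewrite -[_ ^ _]/(eps_mx i j ^- n.+1) invr_eq0 expf_neq0.
Qed.
End Degree.

(** * Classes modulo L_(-1)(P_0) and the bracket with e^b *)

Section Concrete.
Variable K : numFieldType.
Local Notation V := (VF K).
Local Notation al i := (to_K K (alpha i)).
Local Notation E := (expQ K).
Local Notation H := (@heis K).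
Local Notation T := (Lop (K := K) (-1)).

Lemma fundw_dual k i : formK (fundw K k) (al i) = (i == k)%:R.
Proof.
rewrite /formK /fundw -row_mul mulVmx ?cartan_unit // row1 to_K_alphaE.
rewrite trmx_delta mul_delta_mx_cond eq_sym.
by case: eqP => _; rewrite ?mulr1n ?mulr0n mxE.
Qed.

Lemma Pspace1I (v : V) : Lop 0 v = v -> (forall m : nat, Lop m.+1 v = 0) -> Pspace 1 v.
Proof.
move=> h0 hm; split; first by apply: etrans h0 _; rewrite scale1r.
by case=> [[|m]|m] // _; exact: hm.
Qed.

Lemma Pspace1E (v : V) : Pspace 1 v -> Lop 0 v = v /\ (forall m : nat, Lop m.+1 v = 0).
Proof.
case=> h0 hm; split; last by move=> m; exact: hm.
by apply: etrans h0 _; rewrite scale1r.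
Qed.

Lemma p1_P1 : Pspace 1 (p1 K).
Proof.
apply: Pspace1I.
  exact: (p1_level (@heis_lin K) (@Lop_linear K) (@Lop_comm K) (@Lop0_expQ K)).
exact: (p1_primary (@heis_lin K) (@heis_comm K) (@heis_expQ_gt0 K) (@heis_expQ0 K)
  (@Lop_linear K) (@Lop_comm K) (@Lop_expQ_gt0 K)).
Qed.

Lemma p2_P1 : Pspace 1 (p2 K).
Proof.
apply: Pspace1I.
  exact: (p2_level (@heis_lin K) (@Lop_linear K) (@Lop_comm K) (@Lop0_expQ K)).
exact: (p2_primary (@heis_lin K) (@heis_comm K) (@heis_expQ_gt0 K) (@heis_expQ0 K)
  (@Lop_linear K) (@Lop_comm K) (@Lop_expQ_gt0 K)).
Qed.

Lemma p3_P1 : Pspace 1 (p3 K).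
Proof.
apply: Pspace1I.
  exact: (p3_level (@heis_lin K) (@Lop_comm K) (@Lop0_expQ K)).
exact: (p3_primary (@heis_lin K) (@heis_comm K) (@heis_expQ_gt0 K) (@heis_expQ0 K)
  (@Lop_comm K) (@Lop_expQ_gt0 K)).
Qed.

Lemma Pspace_lin i c (u v : V) : Pspace i u -> Pspace i v -> Pspace i (c *: u + v).
Proof.
move=> [u0 um] [v0 vm]; split=> [|m m0]; apply: etrans (Lop_linear _ _ _ _) _.
  apply: etrans (eq_add (eq_scale (erefl c) u0) v0) _.
  rewrite [RHS]scalerDr; apply: eq_add; [exact: scale_swap | exact: erefl].
apply: etrans (eq_add (eq_scale (erefl c) (um m m0)) (vm m m0)) _.
by rewrite scaler0 addr0.
Qed.

Lemma Pspace0 i : Pspace i (0 : V).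
Proof. by split=> [|m _]; apply: etrans (Lop_L0 _ _) _; rewrite ?scaler0. Qed.

Lemma alpha_P0 i : i != i2 -> Pspace 0 (H (al i) (-1) (E mrho)).
Proof.
move=> ii2; split.
  apply: etrans (L0_s (@heis_lin K) (@Lop_comm K) (@Lop0_expQ K) _) _.
  by rewrite scale0r.
case=> [[|m]|m] // _.
exact: (s_primary (@heis_lin K) (@heis_expQ_gt0 K) (@heis_expQ0 K)
  (@Lop_comm K) (@Lop_expQ_gt0 K) m ii2).
Qed.

Lemma alpha13_P0 c c' : Pspace 0 (c *: H (al i1) (-1) (E mrho) + c' *: H (al i3) (-1) (E mrho)).
Proof.
apply: (Pspace_lin c (alpha_P0 (i := i1) isT)).
rewrite -[X in Pspace 0 X]addr0.
apply: (Pspace_lin c' (alpha_P0 (i := i3) isT)); exact: Pspace0.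
Qed.

Lemma cls_eq (u v : V) : cls u = cls v <-> exists2 w, Pspace 0 w & u = v + T w.
Proof.
split.
  move/lclass_eq/asboolP => [w hw ew]; exists w => //.
  by rewrite ew addrC subrK.
move=> [w hw ew]; apply/lclass_eq/asboolP; exists w => //.
by rewrite ew addrAC subrr add0r.
Qed.

Lemma cls_repr (v : V) : exists2 w, Pspace 0 w & lrepr (cls v) = v + T w.
Proof. apply/cls_eq; exact: lreprK. Qed.

Lemma clsD (u v : V) : cls (u + v) = cls u + cls v.
Proof. exact: lclassD. Qed.
Lemma clsZ c (v : V) : cls (c *: v) = c *: cls v.
Proof. exact: lclassZ. Qed.
Lemma cls0 : cls (0 : V) = 0.
Proof. exact: (linear0 (lclass (LP0 (K := K)))). Qed.

(** L_(-1) raises the level, so the classes of the e^g do not vanish. *)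
Lemma cls_expQ_eq0 c g : cls (c *: E g) = 0 -> c = 0.
Proof.
rewrite -cls0 => /cls_eq[w _ ew].
have := congr1 (vac g) ew; rewrite vacZ vac_expQ eqxx mulr1 => ->.
rewrite vacD vac_LopN1 vac0; exact: addr0.
Qed.

(** A zero mode of a primary field of weight one commutes with all the L_m. *)
Lemma Yexp_mode0_LopN1 b (w : V) : form b b = 2 -> Yexp b 0 (T w) = T (Yexp b 0 w).
Proof.
move=> bb; apply: esym; apply: etrans (Yexp_primary 0 w bb (lexx _)) _.
by rewrite scale0r subr0.
Qed.

Lemma Yexp_mode0_P0 b (w : V) : form b b = 2 -> Pspace 0 w -> Pspace 0 (Yexp b 0 w).
Proof.
move=> bb [w0 wm]; split.
  apply: etrans (Yexp_primary (m := 0) 0 w bb isT) _.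
  rewrite [X in _ - X]scale0r subr0; apply: etrans (congr1 (Yexp b 0) w0) _.
  exact: Yexp_Z.
move=> m m0; apply: etrans (Yexp_primary 0 w bb _) _; first by lia.
rewrite scale0r subr0; apply: etrans (congr1 (Yexp b 0) (wm m m0)) _.
exact: (linear_at0 (Yexp_linear b 0)).
Qed.

(** The representatives chosen in the bracket differ from c e^b and v by L_(-1) u
    and L_(-1) w. The zero mode of L_(-1) u is that of a derivative, hence zero,
    and the zero mode of e^b commutes with L_(-1) and preserves P_0. *)
Lemma bracket_expQ b c (v : V) : form b b = 2 ->
  P1bar_br (cls (c *: E b)) (cls v) = cls (c *: Yexp b 0 v).
Proof.
move=> bb; rewrite /P1bar_br.
have [u hu ->] := cls_repr (c *: E b).
have [w hw ->] := cls_repr v.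
apply/cls_eq; exists (c *: Yexp b 0 w).
  rewrite -[X in Pspace 0 X]addr0; apply: Pspace_lin; last exact: Pspace0.
  exact: Yexp_mode0_P0.
apply: etrans (Ymode_Dl _ _ _ _) _.
rewrite Ymode_LopN1 /translate oppr0 [X in _ + X]scale0r addr0.
apply: etrans (Ymode_Zl _ _ _ _) _.
rewrite Ymode_expQ [T (_ *: _)]Lop_LZ -[RHS]scalerDr; apply: eq_scale; first exact: erefl.
rewrite -Yexp_mode0_LopN1 // -[v in LHS]scale1r; apply: etrans (Yexp_linear _ _ _ _ _) _.
by apply: eq_add; last exact: erefl; exact: scale1r.
Qed.
End Concrete.

(** * The lowering generators of Fib *)

Section Generators.
Variable K : numFieldType.
Local Notation V := (VF K).
Local Notation al i := (to_K K (alpha i)).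
Local Notation E := (expQ K).
Local Notation H := (@heis K).

Lemma creation1 b (v : V) : creation b 1 v = H (to_K K b) (-1) v.
Proof.
have := creation_recurrence b 1 v; rewrite big_nat1 creation0.
by rewrite !scale1r.
Qed.

(** Y(e^b, z) e^g is z^(b, g) times a power series with values in the creation
    exponential; this lemma and the next two give its first coefficients. *)
Lemma Yexp_expQ_regular b g n : (0 <= form b g + n)%R -> Yexp b n (E g) = 0 :> V.
Proof.
move=> e; rewrite Yexp_expQ coef_int_lt0; last lia.
exact: scaler0.
Qed.

Lemma Yexp_expQ_lead b g n : form b g + n = -1 ->
  Yexp b n (E g) = (eps b g)%:~R *: E (b + g) :> V.
Proof.
move=> e; rewrite Yexp_expQ (_ : _ - form b g = 0); last lia.
apply: eq_scale; [exact: erefl | exact: creation0].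
Qed.

Lemma Yexp_expQ_next b g n : form b g + n = -2 ->
  Yexp b n (E g) = (eps b g)%:~R *: H (to_K K b) (-1) (E (b + g)) :> V.
Proof.
move=> e; rewrite Yexp_expQ (_ : _ - form b g = 1); last lia.
apply: eq_scale; [exact: erefl | exact: creation1].
Qed.

Lemma bracket_expQZ b c c' (v : V) : form b b = 2 ->
  P1bar_br (cls (c *: E b)) (cls (c' *: v)) = cls ((c * c') *: Yexp b 0 v).
Proof.
move=> bb; apply: etrans (bracket_expQ c (c' *: v) bb) _; apply: (congr1 (@cls K)).
rewrite -scalerA; apply: eq_scale; first exact: erefl.
exact: Yexp_Z.
Qed.

Lemma form_self i : form (- alpha i) (- alpha i) = 2.
Proof. by rewrite formE !mxE; case: i => [[|[|[|i]]] hi]. Qed.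

Variable p : {linear kac_moody K cartan -> Vbar K}.
Hypothesis hp : is_piF p.

Lemma piF_lowering i : p (kmF K cartan i) = cls (-1 *: E (- alpha i)).
Proof. by rewrite (piF_f hp) scaleN1r. Qed.

(** Each bracket is a zero mode acting on the previous result: [f_2, f_3] is a
    multiple of e^(- alpha_2 - alpha_3), the bracket with f_1 gives
    alpha_1(-1) on e^(- alpha_1 - alpha_2 - alpha_3), and the second one with f_1
    a multiple of e^(- beta_1). The scalar is a product of signs and
    powers of 2. *)
Lemma piF_fibF1 : exists2 c : K, c != 0 & p (fibF1 K) = cls (c *: E (- beta1)).
Proof.
have e23 : form (- alpha i2) (- alpha i3) + 0 = -1 by rewrite formE !mxE.
have e1 : form (- alpha i1) (- alpha i2 + - alpha i3) + 0 = -2 by rewrite formE !mxE.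
set g := - alpha i1 + (- alpha i2 + - alpha i3).
have e0 : form (- alpha i1) g = 0 by rewrite formE !mxE.
have gb : - alpha i1 + g = - beta1.
  by rewrite /g /beta1 mulr2n !opprD !addrA.
set b := - alpha i1 in e0 gb e1 *.
have Y2 : Yexp b 0 (H (to_K K b) (-1) (E g)) =
    (- (2 * (eps b g)%:~R)) *: E (- beta1) :> V.
  have z0 : Yexp b 0 (E g) = 0 :> V by apply: Yexp_expQ_regular; rewrite e0.
  have z1 : Yexp b (0 + -1) (E g) = (eps b g)%:~R *: E (- beta1) :> V.
    by rewrite -gb; apply: Yexp_expQ_lead; rewrite e0.
  have := Yexp_comm b (to_K K b) (-1) 0 (E g).
  rewrite z0 z1 heisL0 formK_int form_self scalerA => /esym/eqP.
  by rewrite addr_eq0 -scaleNr => /eqP.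
pose c := - 2^-1 * (-1 * (-1 * (-1 * -1 * (eps (- alpha i2) (- alpha i3))%:~R)
   * (eps b (- alpha i2 + - alpha i3))%:~R) * - (2 * (eps b g)%:~R)) : K.
exists c.
  rewrite /c !mulf_neq0 ?oppr_eq0 ?mulf_neq0 ?eps_neq0 ?invr_eq0 ?pnatr_eq0 ?oner_eq0 //.
rewrite /fibF1 linearN linearZ !(piF_br hp) !piF_lowering.
have Y1 : Yexp b 0 (E (- alpha i2 + - alpha i3)) =
    (eps b (- alpha i2 + - alpha i3))%:~R *: H (to_K K b) (-1) (E g) :> V.
  exact: Yexp_expQ_next.
pose br := P1bar_br (K := K).
have clsA d e x y : x = e *: y :> V -> cls (d *: x) = cls ((d * e) *: y).
  by move=> ->; rewrite scalerA.
have B1 : br (cls (-1 *: E (- alpha i2))) (cls (-1 *: E (- alpha i3))) =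
   cls ((-1 * -1 * (eps (- alpha i2) (- alpha i3))%:~R) *: E (- alpha i2 + - alpha i3)).
  apply: etrans (bracket_expQZ _ _ _ (form_self i2)) _.
  apply: clsA; exact: (Yexp_expQ_lead e23).
have B2 d : br (cls (-1 *: E b)) (cls (d *: E (- alpha i2 + - alpha i3))) =
   cls ((-1 * d * (eps b (- alpha i2 + - alpha i3))%:~R) *: H (to_K K b) (-1) (E g)).
  apply: etrans (bracket_expQZ _ _ _ (form_self i1)) _.
  exact: clsA Y1.
have B3 d : br (cls (-1 *: E b)) (cls (d *: H (to_K K b) (-1) (E g))) =
   cls ((-1 * d * - (2 * (eps b g)%:~R)) *: E (- beta1)).
  apply: etrans (bracket_expQZ _ _ _ (form_self i1)) _.
  exact: clsA Y2.
have Bn d x : - (2^-1 *: cls (d *: x)) = cls ((- 2^-1 * d) *: x) :> Vbar K.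
  apply: etrans (esym (scaleNr _ _)) _; apply: etrans (esym (clsZ _ _)) _.
  exact: (congr1 (@cls K) (scalerA _ _ _)).
apply: etrans (congr1 (fun x => - (2^-1 *: br _ (br _ x))) B1) _.
apply: etrans (congr1 (fun x => - (2^-1 *: br _ x)) (B2 _)) _.
apply: etrans (congr1 (fun x => - (2^-1 *: x)) (B3 _)) _.
exact: Bn.
Qed.
End Generators.

(** * The lowest-weight vectors of weight - rho *)

Lemma addr_rot (W : zmodType) (t a b c : W) : t + a + b + c = a + b + c + t.
Proof. by rewrite -!addrA addrC -!addrA. Qed.

Lemma basis_comb (K : numFieldType) (W : lmodType K) (a b d : W) (c c' : K) :
  c *: (a + 2 *: b) + c' *: (- a + 3 *: d) =
  (c - c') *: a + (2 * c) *: b + (3 * c') *: d.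
Proof. lincomb K W. Qed.

Lemma is_basis_pair (K : pzRingType) (M : lmodType K) (W : set M) (x y : M) :
  (forall c d, W (c *: x + d *: y)) ->
  (forall c d, c *: x + d *: y = 0 -> c = 0 /\ d = 0) ->
  (forall w, W w -> exists c d, w = c *: x + d *: y) ->
  is_basis W [tuple x; y].
Proof.
move=> W_xy free span.
have sum2 (c : 'I_2 -> K) : \sum_i c i *: tnth [tuple x; y] i =
    c ord0 *: x + c ord_max *: y.
  rewrite big_ord_recr big_ord1; congr (_ *: _ + _ *: _).
  by congr c; exact: val_inj.
have ord2 (i : 'I_2) : i = ord0 \/ i = ord_max.
  by case: i => [[|[|i]] hi] //; [left|right]; exact: val_inj.
split.
- move=> i; case: (ord2 i) => ->.
    by have := W_xy 1 0; rewrite scale1r scale0r addr0.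
  by have := W_xy 0 1; rewrite scale1r scale0r add0r.
- by move=> c; rewrite sum2 => /free[cx cy] i; case: (ord2 i) => ->.
move=> w /span[c [d ->]]; exists (fun i => if i == ord0 then c else d).
by rewrite sum2.
Qed.

Section Low.
Variable K : numFieldType.
Local Notation V := (VF K).
Local Notation al i := (to_K K (alpha i)).
Local Notation E := (expQ K).
Local Notation H := (@heis K).
Local Notation T := (Lop (K := K) (-1)).

Definition p_comb A B C : V := A *: p1 K + B *: p2 K + C *: p3 K.

Lemma cls_p_comb A B C :
  cls (p_comb A B C) = A *: cls (p1 K) + B *: cls (p2 K) + C *: cls (p3 K).
Proof.
apply: etrans (clsD _ _) _; apply: eq_add; last exact: clsZ.
by apply: etrans (clsD _ _) _; apply: eq_add; exact: clsZ.
Qed.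

Lemma in_degreeP g (v : V) : in_degree g v <->
  forall s h, h != g -> mcoeff (s, h) v = 0.
Proof.
split=> [dv s h hg|dv [s h] /=].
  by apply/mcoeff_outdom/negP => /dv /= eh; rewrite eh eqxx in hg.
by rewrite -mcoeff_neq0; apply: contraNeq => /dv ->.
Qed.

Lemma in_degree_lin g c (u v : V) :
  in_degree g u -> in_degree g v -> in_degree g (c *: u + v).
Proof.
move=> /in_degreeP du /in_degreeP dv; apply/in_degreeP => s h hg.
by rewrite mcoeffD mcoeffZ (du _ _ hg) (dv _ _ hg) mulr0 addr0.
Qed.

Lemma in_degree0 g : in_degree g (0 : V).
Proof. by apply/in_degreeP => s h _; rewrite mcoeff0. Qed.

Lemma in_degree_add g (u v : V) :
  in_degree g u -> in_degree g v -> in_degree g (u + v).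
Proof. by rewrite -[u in u + v]scale1r; exact: in_degree_lin. Qed.

Lemma in_degreeZ g c (u : V) : in_degree g u -> in_degree g (c *: u).
Proof.
by move=> du; rewrite -[X in in_degree g X]addr0; apply: in_degree_lin (in_degree0 g).
Qed.

Lemma in_degree_ket g s : in_degree g (ket K s g).
Proof.
apply/in_degreeP => t h hg; rewrite /ket mcoeffU xpair_eqE [g == h]eq_sym.
by rewrite (negPf hg) andbF.
Qed.

Lemma in_degree_al2 i : in_degree mrho (H (al i) (-2) (E mrho)).
Proof. rewrite (heis_alphaN K i 1); exact: in_degree_ket. Qed.

Lemma in_degree_al11 i j : in_degree mrho (H (al i) (-1) (H (al j) (-1) (E mrho))).
Proof. rewrite (heis_alphaN K j 0) (heis_alphaN K i 0); exact: in_degree_ket. Qed.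

Lemma in_degree_p_comb A B C : in_degree mrho (p_comb A B C).
Proof.
apply: in_degree_add; last by apply: in_degreeZ; exact: in_degree_al11.
apply: in_degree_add; apply: in_degreeZ; apply: in_degree_add.
- exact: in_degree_al2.
- exact: in_degree_al11.
- by rewrite -scaleN1r; apply: in_degreeZ; exact: in_degree_al11.
- exact: in_degree_al11.
Qed.

Lemma p_comb_P1 A B C : Pspace 1 (p_comb A B C).
Proof.
rewrite /p_comb -addrA; apply: Pspace_lin; first exact: p1_P1.
apply: Pspace_lin; first exact: p2_P1.
rewrite -[X in Pspace 1 X]addr0; apply: Pspace_lin; [exact: p3_P1 | exact: Pspace0].
Qed.

Lemma P1bar_degP x : P1bar_deg mrho x <-> exists A B C : K, x = cls (p_comb A B C).
Proof.
split=> [[v [/Pspace1E[v0 vm] dv] <-]|[A [B [C ->]]]]; last first.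
  by exists (p_comb A B C) => //; split; [exact: p_comb_P1 | exact: in_degree_p_comb].
have [x0 [y ev]] := level_two v0 dv.
have [||A [B [C e]]] := level_two_primary (@heis_lin K) (@heis_comm K) (@heisD K)
  (@heisZ K) (@heis_expQ_gt0 K) (@heis_expQ0 K) (@Lop_linear K) (@Lop_comm K)
  (@Lop_expQ_gt0 K) (@LopN1_expQ K) (vac := vac mrho) (w := fundw K) _ _
  (@fundw_dual K) ev (vm 0%N) (vm 1%N).
- by move=> c u u'; rewrite vacD vacZ.
- by rewrite vac_expQ eqxx.
exists A, B, C; apply/cls_eq.
pose u := x0 i1 *: H (al i1) (-1) (E mrho) + x0 i3 *: H (al i3) (-1) (E mrho).
exists u; first exact: alpha13_P0.
apply: etrans (addr_rot (T u) (A *: p1 K) (B *: p2 K) (C *: p3 K)).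
exact e.
Qed.

(** On the lowest-weight vectors A is a function of B and C, so that this gives
    their independence. *)
Lemma cls_p_comb_eq0 A B C : cls (p_comb A B C) = 0 -> B = 0 /\ C = 0.
Proof.
rewrite -cls0 => /cls_eq[u _]; rewrite add0r => e.
have VL c v v' : vac mrho (c *: v + v' : V) = c * vac mrho v + vac mrho v'.
  by rewrite vacD vacZ.
have VE : vac mrho (E mrho) = 1 by rewrite vac_expQ eqxx.
exact (p_independent (@heis_lin K) (@heis_comm K) (@heis_expQ_gt0 K) VL VE
  (@fundw_dual K) (fun a => vac_LopN1_2 mrho a u)
  (fun a b => vac_LopN1_11 mrho a b u) (esym e)).
Qed.

(** The third hypothesis says that the quadratic expression of Y_p_comb equals the
    common functional; it is the form in which both lowering generators meet. *)
Lemma bracket_p_comb_eq0 b c A B C : form b b = 2 -> form b mrho = 1 ->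
  (A * ((form (alpha i2) b)%:~R ^+ 2 - (form (alpha i2) b)%:~R)
   + B * ((form (alpha i3) b)%:~R ^+ 2 - (form (alpha i1) b)%:~R ^+ 2)
   + C * ((form (alpha i1) b)%:~R * (form (alpha i3) b)%:~R)
   = 6 * A - 3 * B + 2 * C) ->
  c != 0 ->
  P1bar_br (cls (c *: E b)) (cls (p_comb A B C)) = 0 <->
  6 * A - 3 * B + 2 * C = 0.
Proof.
move=> bb bm f c0.
have Y0 : Yexp b 0 (E mrho) = 0 :> V by apply: Yexp_expQ_regular; rewrite bm.
have Y1 : Yexp b (-1) (E mrho) = 0 :> V by apply: Yexp_expQ_regular; rewrite bm.
have Y2 : Yexp b (-2) (E mrho) = (eps b mrho)%:~R *: E (b + mrho) :> V.
  by apply: Yexp_expQ_lead; rewrite bm.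
have := Y_p_comb (@heis_lin K) (@Yexp_linear K b) (@Yexp_comm K b) Y0 Y1 Y2 A B C
  (formK_int K _ _) (formK_int K _ _) (formK_int K _ _).
rewrite f scalerA => e.
have -> : P1bar_br (cls (c *: E b)) (cls (p_comb A B C)) =
    cls ((c * ((6 * A - 3 * B + 2 * C) * (eps b mrho)%:~R)) *: E (b + mrho)).
  apply: etrans (bracket_expQ _ _ bb) _; apply: (congr1 (@cls K)).
  apply: etrans (scalerA _ _ _); apply: eq_scale; [exact: erefl | exact: e].
split=> [/cls_expQ_eq0/eqP|->]; last by rewrite mul0r mulr0 scale0r; exact: cls0.
by rewrite !mulf_eq0 (negPf c0) (negPf (eps_neq0 _ _ _)) orbF => /eqP.
Qed.

Variable p : {linear kac_moody K cartan -> Vbar K}.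
Hypothesis hp : is_piF p.

Lemma act_F1 A B C :
  act p (fibF1 K) (cls (p_comb A B C)) = 0 <-> 6 * A - 3 * B + 2 * C = 0.
Proof.
have [c c0 e] := piF_fibF1 hp; rewrite /act e.
apply: bracket_p_comb_eq0 => //; try by rewrite formE !mxE.
by rewrite !formE !mxE /=; ring.
Qed.

Lemma act_F2 A B C :
  act p (fibF2 K) (cls (p_comb A B C)) = 0 <-> 6 * A - 3 * B + 2 * C = 0.
Proof.
rewrite /act (piF_lowering hp); apply: bracket_p_comb_eq0; try by rewrite formE !mxE.
  by rewrite !formE !mxE /=; ring.
by rewrite oppr_eq0 oner_eq0.
Qed.

Lemma LowP x : Low p mrho x <->
  exists A B C : K, x = cls (p_comb A B C) /\ 6 * A - 3 * B + 2 * C = 0.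
Proof.
split=> [[/P1bar_degP[A [B [C ->]]] /act_F1 e _]|[A [B [C [-> e]]]]].
  by exists A, B, C.
split; [by apply/P1bar_degP; exists A, B, C | exact/act_F1 | exact/act_F2].
Qed.

Lemma x1_x2_p_comb c c' : c *: x1 K + c' *: x2 K = cls (p_comb (c - c') (2 * c) (3 * c')).
Proof.
apply: etrans _ (esym (cls_p_comb _ _ _)); exact: basis_comb.
Qed.

Lemma low_basis : is_basis (Low p mrho) [tuple x1 K; x2 K].
Proof.
apply: is_basis_pair => [c d|c d|w].
- rewrite x1_x2_p_comb; apply/LowP; do 3 eexists; split; first exact: erefl.
  ring.
- rewrite x1_x2_p_comb => /cls_p_comb_eq0[/eqP b0 /eqP d0].
  by move: b0 d0; rewrite !mulf_eq0 !pnatr_eq0 /= => /eqP b0 /eqP d0.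
move=> /LowP[A [B [C [-> e]]]]; exists (B / 2), (C / 3); rewrite x1_x2_p_comb.
(* The coordinates of p_2 and p_3 in x_1 and x_2 are 2 and 3. *)
have eA : A = B / 2 - C / 3.
  apply: (@mulfI _ 6); first by rewrite pnatr_eq0.
  by apply/eqP; rewrite -subr_eq0 -e; apply/eqP; field.
have eB : B = 2 * (B / 2) by field.
have eC : C = 3 * (C / 3) by field.
by rewrite -eA -eB -eC.
Qed.
End Low.

Lemma rho_mrho : - rho = to_rat mrho.
Proof.
rewrite /rho /lambda1 /lambda2 /mrho.
have -> : to_rat (beta1 + beta2) = to_rat beta1 + to_rat beta2 by exact: raddfD.
move: (to_rat beta1) (to_rat beta2) => a b; lincomb rat ('rV[rat]_3).
Qed.

Theorem theorem6p4 (R : realType)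
    (pi_F : {linear kac_moody R[i] cartan -> Vbar R[i]}) (hpi : is_piF pi_F) :
  [/\ - rho = to_rat mrho,
      mrho = alpha i1 *+ 2 + alpha i2 *+ 2 + alpha i3,
      [/\ Pspace 1 (p1 R[i]), Pspace 1 (p2 R[i]) & Pspace 1 (p3 R[i])]
    & is_basis (Low pi_F mrho) [tuple x1 R[i]; x2 R[i]]].
Proof.
split; [exact: rho_mrho | exact: mrhoE | | exact: low_basis hpi].
split; [exact: p1_P1 | exact: p2_P1 | exact: p3_P1].
Qed.
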